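(* Let $K$ be a Noetherian commutative ring and let $A$ and $B$ be Noetherian $K$-algebras which are projective as $K$-modules. Suppose that $({}_AM_B,{}_BN_A)$ induces a singular equivalence of Morita type between $A$ and $B$. (1) Then there is $n_0\in\mathbb{N}$ such that $HH_n(A)\simeq HH_n(B)$ for each $n>n_0$. (2) If $K$ is a field, and if $A$ and $B$ are finite dimensional, then $HH_n(A)\simeq HH_n(B)$ for each $n>0$.
   Context: $HH_n(A)$ denotes the $n$-th Hochschild homology of the $K$-algebra $A$, $HH_n(A)=\mathrm{Tor}_n^{A^e}(A,A)$ with $A^e=A^{op}\otimes_KA$. Modules are right modules unless said otherwise; left $A$-modules are $A^{op}$-modules, and $A$-$B$-bimodules (with $K$ acting centrally) are $A^{op}\otimes_KB$-modules. $\mathcal{P}^{<\infty}(A^e)$ is the full subcategory of the category of finitely generated $A^e$-modules consisting of modules of finite projective dimension. A pair $({}_AM_B,{}_BN_A)$ of bimodules induces a singular equivalence of Morita type between $A$ and $B$ if: $M$ is finitely generated and projective as a left $A$-module and as a right $B$-module; $N$ is finitely generated and projective as a right $A$-module and as a left $B$-module; ${}_AM\otimes_BN_A\simeq {}_AA_A\oplus{}_AX_A$ as bimodules for some $X\in\mathcal{P}^{<\infty}(A^e)$; and ${}_BN\otimes_AM_B\simeq{}_BB_B\oplus{}_BY_B$ as bimodules for some $Y\in\mathcal{P}^{<\infty}(B^e)$. *)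

(* Defs.v *)
From HB Require Import structures.
From mathcomp Require Import all_boot all_algebra.
From mathcomp Require Import ring_quotient.
From mathcomp Require Import finmap monalg.
From mathcomp Require Import boolp.

Set Implicit Arguments.
Unset Strict Implicit.
Unset Printing Implicit Defensive.

Import GRing.Theory.
Local Open Scope ring_scope.
Local Open Scope quotient_scope.

(* Right R-modules are [lmodType R^c], where R^c is the opposite ring. *)

Section ConverseAlgebra.
Variables (K : comNzRingType) (A : algType K).

HB.instance Definition _ := GRing.Lmodule.copy A^c A.

Fact converse_scalerAl (k : K) (x y : A^c) : k *: (x * y) = (k *: x : A^c) * y.
Proof. exact: (@scalerAr K A k y x). Qed.
HB.instance Definition _ :=
  GRing.Lmodule_isLalgebra.Build K A^c converse_scalerAl.

Fact converse_scalerAr (k : K) (x y : A^c) : k *: (x * y) = x * (k *: y : A^c).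
Proof. exact: (@scalerAl K A k y x). Qed.
HB.instance Definition _ :=
  GRing.Lalgebra_isAlgebra.Build K A^c converse_scalerAr.

End ConverseAlgebra.

Section ModuleProperties.
Variable R : nzRingType.

Definition in_span (M : lmodType R) (s : seq M) (x : M) : Prop :=
  exists c : 'I_(size s) -> R, x = \sum_i c i *: s`_i.

Definition fin_gen (M : lmodType R) : Prop :=
  exists s : seq M, forall x, in_span s x.

Definition noetherian_mod (M : lmodType R) : Prop :=
  forall S : {pred M}, submod_closed S ->
    exists2 s : seq M, {subset s <= S} & forall x, x \in S -> in_span s x.

Definition projective (P : lmodType R) : Prop :=
  forall (U V : lmodType R) (g : {linear U -> V}) (f : {linear P -> V}),
    (forall v, exists u, g u = v) ->
    exists h : {linear P -> U}, forall x, g (h x) = f x.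

Definition exact_at (U V W : lmodType R)
    (f : {linear U -> V}) (g : {linear V -> W}) : Prop :=
  forall v, g v = 0 <-> exists u, f u = v.

Definition finite_pd (M : lmodType R) : Prop :=
  exists (n : nat) (P : nat -> lmodType R)
         (d : forall i, {linear P i.+1 -> P i}) (e : {linear P 0%N -> M}),
    [/\ forall i, projective (P i),
        forall x, exists y, e y = x,
        exact_at (d 0%N) e,
        forall i, exact_at (d i.+1) (d i)
      & forall i, (n < i)%N -> forall x : P i, x = 0].

Definition lmod_iso (U V : lmodType R) : Prop :=
  exists f : {linear U -> V}, bijective f.

End ModuleProperties.

Definition noetherian_ring (R : nzRingType) : Prop :=
  noetherian_mod (R^o : lmodType R) /\
  noetherian_mod ((R^c)^o : lmodType R^c).

(* 1 != 0 holds in every comNzRingType *)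
Definition is_field (K : comNzRingType) : Prop :=
  forall x : K, x != 0 -> exists y, y * x = 1.

Section Kernel.
Variables (R : nzRingType) (U V : lmodType R) (f : {linear U -> V}).

Definition ker_pred : {pred U} := fun x => f x == 0.

Fact ker_pred_closed : submod_closed ker_pred.
Proof.
split=> [|a x y]; rewrite !unfold_in ?linear0 // => /eqP fx /eqP fy.
by rewrite linearP fx fy scaler0 addr0.
Qed.
HB.instance Definition _ := GRing.isSubmodClosed.Build R U ker_pred ker_pred_closed.

Record kermod := KerMod { ker_val : U; _ : ker_val \in ker_pred }.
HB.instance Definition _ := [isSub for ker_val].
HB.instance Definition _ := [Choice of kermod by <:].
HB.instance Definition _ := [SubChoice_isSubLmodule of kermod by <:].

End Kernel.

(* The quotient of M by the submodule generated by the elements satisfying P *)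
Section QuotientModule.
Variables (R : nzRingType) (M : lmodType R) (P : M -> Prop).

Definition gen_submod : {pred M} := fun x =>
  `[< forall S : {pred M}, submod_closed S ->
        (forall y, P y -> y \in S) -> x \in S >].

Fact gen_submod_closed : submod_closed gen_submod.
Proof.
split=> [|a x y]; first by apply/asboolP => S [].
move=> /asboolP Sx /asboolP Sy; apply/asboolP => S clS PS.
by case: (clS) => _; apply; [apply: Sx | apply: Sy].
Qed.
HB.instance Definition _ :=
  GRing.isSubmodClosed.Build R M gen_submod gen_submod_closed.

Definition quotmod := Quotient.quot gen_submod.
HB.instance Definition _ := EqQuotient.on quotmod.
HB.instance Definition _ := ZmodQuotient.on quotmod.

Definition quot_proj (x : M) : quotmod := \pi_quotmod x.

Lemma quot_projK (q : quotmod) : quot_proj (repr q) = q.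
Proof. exact: reprK. Qed.

Lemma quot_projP (x y : M) :
  (quot_proj x = quot_proj y) <-> (x - y \in gen_submod).
Proof. by rewrite Quotient.idealrBE; split => /eqP. Qed.

Lemma quot_projD (x y : M) : quot_proj (x + y) = quot_proj x + quot_proj y.
Proof. by rewrite /quot_proj !piE. Qed.

Definition quot_scale (a : R) (q : quotmod) : quotmod :=
  quot_proj (a *: repr q).

Lemma quot_scaleE a x : quot_scale a (quot_proj x) = quot_proj (a *: x).
Proof.
apply/quot_projP; rewrite -scalerBr rpredZ //; apply/quot_projP.
exact: quot_projK.
Qed.

Fact quot_scaleA a b q : quot_scale a (quot_scale b q) = quot_scale (a * b) q.
Proof. by rewrite -[q]quot_projK !quot_scaleE scalerA. Qed.
Fact quot_scale1 : left_id 1 quot_scale.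
Proof. by move=> q; rewrite -[q]quot_projK quot_scaleE scale1r. Qed.
Fact quot_scaleDr : right_distributive quot_scale +%R.
Proof.
move=> a p q; rewrite -[p]quot_projK -[q]quot_projK -quot_projD !quot_scaleE.
by rewrite scalerDr quot_projD.
Qed.
Fact quot_scaleDl q : {morph quot_scale^~ q : a b / a + b}.
Proof.
by move=> a b; rewrite -[q]quot_projK !quot_scaleE scalerDl quot_projD.
Qed.
HB.instance Definition _ := GRing.Zmodule_isLmodule.Build R quotmod
  quot_scaleA quot_scale1 quot_scaleDr quot_scaleDl.

Fact quot_proj_linear : linear quot_proj.
Proof. by move=> a x y; rewrite quot_projD -quot_scaleE. Qed.
HB.instance Definition _ :=
  GRing.isLinear.Build R M quotmod _ quot_proj quot_proj_linear.

Lemma quot_proj_rel x y : P (x - y) -> quot_proj x = quot_proj y.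
Proof. by move=> Pxy; apply/quot_projP/asboolP => S _; apply. Qed.

Lemma quot_repr_lift (Z : lmodType R) (f : {linear M -> Z}) (x : M) :
  (forall y, P y -> f y = 0) -> f (repr (quot_proj x)) = f x.
Proof.
move=> fP; apply/eqP; rewrite -subr_eq0 -linearB.
have /asboolP/(_ (ker_pred f)) : repr (quot_proj x) - x \in gen_submod.
  by apply/quot_projP; rewrite quot_projK.
by apply; [apply: ker_pred_closed | move=> y /fP fy; apply/eqP].
Qed.

End QuotientModule.

(* {malg R[X]} is the free module on X; free_lift extends a map on X. *)
Section FreeModule.
Variables (R : nzRingType) (X : choiceType) (M : lmodType R) (h : X -> M).

Definition free_lift (g : {malg R[X]}) : M := \sum_(x <- msupp g) g@_x *: h x.

Lemma free_liftEw (d : {fset X}) g : (msupp g `<=` d)%fset ->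
  free_lift g = \sum_(x <- d) g@_x *: h x.
Proof.
move=> le; rewrite [LHS](big_fset_incl _ le) => //= x xd /mcoeff_outdom ->.
by rewrite scale0r.
Qed.

Fact free_lift_linear : linear free_lift.
Proof.
move=> a g1 g2.
pose d := (msupp g1 `|` msupp g2)%fset.
have s1 : (msupp g1 `<=` d)%fset by apply: fsubsetUl.
have s2 : (msupp g2 `<=` d)%fset by apply: fsubsetUr.
have s3 : (msupp (a *: g1 + g2) `<=` d)%fset.
  apply: fsubset_trans (msuppD_le _ _) _.
  by rewrite fsubUset s2 andbT; apply: fsubset_trans (msuppZ_le _ _) s1.
rewrite !(free_liftEw s1, free_liftEw s2, free_liftEw s3).
rewrite scaler_sumr -big_split /=; apply: eq_bigr => x _.
by rewrite mcoeffD mcoeffZ scalerDl scalerA.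
Qed.
HB.instance Definition _ :=
  GRing.isLinear.Build R {malg R[X]} M _ free_lift free_lift_linear.

Lemma free_liftU x : free_lift << 1 *g x >> = h x.
Proof. by rewrite (free_liftEw msuppU_le) big_seq_fset1 mcoeffUU scale1r. Qed.

End FreeModule.

(* M ⊗_R N, as a K-module, for a right action rho and a left action lam of R
   on the K-modules M and N. *)
Section Tensor.
Variables (K : comNzRingType) (M N : lmodType K) (R : Type).
Variables (rho : M -> R -> M) (lam : R -> N -> N).

Local Notation "[ x , y ]" := (<< 1 *g (x, y) >> : {malg K[(M * N)%type]}).

Inductive tens_rel : {malg K[(M * N)%type]} -> Prop :=
| TensDl x x' y : tens_rel ([x + x', y] - ([x, y] + [x', y]))
| TensDr x y y' : tens_rel ([x, y + y'] - ([x, y] + [x, y']))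
| TensZl k x y : tens_rel ([k *: x, y] - k *: [x, y])
| TensZr k x y : tens_rel ([x, k *: y] - k *: [x, y])
| TensA x r y : tens_rel ([rho x r, y] - [x, lam r y]).

Definition tens : Type := quotmod tens_rel.
HB.instance Definition _ := GRing.Lmodule.on tens.

Definition tmk (x : M) (y : N) : tens := quot_proj tens_rel [x, y].

Lemma tmkDl x x' y : tmk (x + x') y = tmk x y + tmk x' y.
Proof. by rewrite /tmk -linearD; apply: quot_proj_rel (TensDl _ _ _). Qed.
Lemma tmkDr x y y' : tmk x (y + y') = tmk x y + tmk x y'.
Proof. by rewrite /tmk -linearD; apply: quot_proj_rel (TensDr _ _ _). Qed.
Lemma tmkZl k x y : tmk (k *: x) y = k *: tmk x y.
Proof. by rewrite /tmk -linearZ; apply: quot_proj_rel (TensZl _ _ _). Qed.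
Lemma tmkZr k x y : tmk x (k *: y) = k *: tmk x y.
Proof. by rewrite /tmk -linearZ; apply: quot_proj_rel (TensZr _ _ _). Qed.
Lemma tmkA x r y : tmk (rho x r) y = tmk x (lam r y).
Proof. exact: quot_proj_rel (TensA _ _ _). Qed.

Lemma tens_ind (Q : tens -> Prop) :
  Q 0 -> (forall x y, Q (tmk x y)) -> (forall s t, Q s -> Q t -> Q (s + t)) ->
  forall t, Q t.
Proof.
move=> Q0 Qmk QD t; rewrite -[t]quot_projK; set g := repr t.
rewrite [g]monalgE linear_sum; elim/big_ind: _ => //= -[x y] _.
have -> : << g@_(x, y) *g (x, y) >> = g@_(x, y) *: [x, y].
  by apply/malgP => z; rewrite mcoeffZ !mcoeffU mulrnAr mulr1.
by rewrite linearZ /= -[_ *: _]tmkZl; apply: Qmk.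
Qed.

Record balanced (Z : lmodType K) (b : M -> N -> Z) : Prop := Balanced {
  balDl : forall x x' y, b (x + x') y = b x y + b x' y;
  balDr : forall x y y', b x (y + y') = b x y + b x y';
  balZl : forall k x y, b (k *: x) y = k *: b x y;
  balZr : forall k x y, b x (k *: y) = k *: b x y;
  balA : forall x r y, b (rho x r) y = b x (lam r y) }.

Section Lift.
Variables (Z : lmodType K) (b : M -> N -> Z).

Definition tens_lift (t : tens) : Z :=
  free_lift (fun xy => b xy.1 xy.2) (repr t).

Hypothesis bal : balanced b.

Lemma tens_lift_proj g :
  tens_lift (quot_proj tens_rel g) = free_lift (fun xy => b xy.1 xy.2) g.
Proof.
apply: quot_repr_lift => _ [] *;
  rewrite !(linearB, linearD, linearZ) /= !free_liftU /=;
  by rewrite ?(balDl bal, balDr bal, balZl bal, balZr bal, balA bal) ?scalerN -?opprD subrr.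
Qed.

Lemma tens_liftE x y : tens_lift (tmk x y) = b x y.
Proof. by rewrite tens_lift_proj free_liftU. Qed.

Lemma tens_lift_linear : linear tens_lift.
Proof.
move=> a s t; rewrite -[s]quot_projK -[t]quot_projK -linearP.
by rewrite !tens_lift_proj linearP.
Qed.

Lemma tens_liftD s t : tens_lift (s + t) = tens_lift s + tens_lift t.
Proof. by have := tens_lift_linear 1 s t; rewrite !scale1r. Qed.

Lemma tens_lift0 : tens_lift 0 = 0.
Proof. by rewrite -[0 in LHS](linear0 (quot_proj tens_rel)) tens_lift_proj linear0. Qed.

Lemma tens_liftZ k t : tens_lift (k *: t) = k *: tens_lift t.
Proof. by have := tens_lift_linear k t 0; rewrite !addr0 tens_lift0 addr0. Qed.

End Lift.
End Tensor.

Section RestrictScalars.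
Variables (K : comNzRingType) (S : algType K) (M : lmodType S).

Definition restr : Type := M.
HB.instance Definition _ := GRing.Zmodule.on restr.

Definition restr_scale (k : K) (x : restr) : restr := (k%:A : S) *: (x : M).
Fact restr_scaleA a b x : restr_scale a (restr_scale b x) = restr_scale (a * b) x.
Proof. by rewrite /restr_scale scalerA -scalerAl mul1r scalerA. Qed.
Fact restr_scale1 : left_id 1 restr_scale.
Proof. by move=> x; rewrite /restr_scale !scale1r. Qed.
Fact restr_scaleDr : right_distributive restr_scale +%R.
Proof. by move=> a x y; rewrite /restr_scale scalerDr. Qed.
Fact restr_scaleDl x : {morph restr_scale^~ x : a b / a + b}.
Proof. by move=> a b; rewrite /restr_scale !scalerDl. Qed.
HB.instance Definition _ := GRing.Zmodule_isLmodule.Build K restr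
  restr_scaleA restr_scale1 restr_scaleDr restr_scaleDl.

End RestrictScalars.

Section TensorOverAlgebra.
Variables (K : comNzRingType) (R : algType K) (N : lmodType R).

Definition tensR (M : lmodType R^c) : lmodType K :=
  tens (M := restr M) (N := restr N)
    (fun (x : M) (r : R) => (r : R^c) *: x) (fun (r : R) (y : N) => r *: y).

Section Map.
Variables (M M' : lmodType R^c) (f : {linear M -> M'}).

Definition tensR_map : tensR M -> tensR M' :=
  tens_lift (fun (x : restr M) (y : restr N) => tmk _ _ (f x : restr M') y).

Fact tensR_map_linear : linear tensR_map.
Proof.
apply: tens_lift_linear; split=> *.
- by rewrite linearD tmkDl.
- by rewrite tmkDr.
- by rewrite -tmkZl /= linearZ.
- by rewrite tmkZr.
- by rewrite /= linearZ tmkA.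
Qed.
HB.instance Definition _ :=
  GRing.isLinear.Build K (tensR M) (tensR M') _ tensR_map tensR_map_linear.

End Map.
End TensorOverAlgebra.

(* The standard free resolution of M: each syzygy is covered by the free module
   on its underlying set. *)
Section StandardResolution.
Variables (S : nzRingType) (M : lmodType S).

Definition free_cover (V : lmodType S) : {linear {malg S[V]} -> V} :=
  free_lift (idfun : V -> V).

Fixpoint syzygy (n : nat) : lmodType S :=
  if n is n'.+1 then kermod (free_cover (syzygy n')) else M.

Definition std_res (n : nat) : lmodType S := {malg S[syzygy n]}.

Definition std_diff (n : nat) : {linear std_res n.+1 -> std_res n} :=
  (val : kermod (free_cover (syzygy n)) -> std_res n)
    \o free_cover (syzygy n.+1).

End StandardResolution.

Section Tor.
Variables (K : comNzRingType) (R : algType K).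
Variables (M : lmodType R^c) (N : lmodType R).

Definition tor_diff (n : nat) :
    {linear tensR N (std_res M n.+1) -> tensR N (std_res M n)} :=
  tensR_map (N := N) (std_diff M n).

Definition Tor (n : nat) : lmodType K :=
  match n with
  | 0%N => quotmod (fun z => exists y, tor_diff 0 y = z)
  | m.+1 => quotmod (fun z : kermod (tor_diff m) =>
                       exists y, tor_diff m.+1 y = val z)
  end.

End Tor.

(* A-B-bimodules with K acting centrally: the two actions are K-bilinear for
   one and the same K-module structure. *)
Record bimod (K : comNzRingType) (A B : algType K) := Bimod {
  bm_sort :> lmodType K;
  lact : A -> bm_sort -> bm_sort;
  ract : bm_sort -> B -> bm_sort;
  lactDl : forall a a' x, lact (a + a') x = lact a x + lact a' x;
  lactDr : forall a x x', lact a (x + x') = lact a x + lact a x';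
  lactZl : forall k a x, lact (k *: a) x = k *: lact a x;
  lactZr : forall k a x, lact a (k *: x) = k *: lact a x;
  lact1 : forall x, lact 1 x = x;
  lactM : forall a a' x, lact (a * a') x = lact a (lact a' x);
  ractDl : forall x x' b, ract (x + x') b = ract x b + ract x' b;
  ractDr : forall x b b', ract x (b + b') = ract x b + ract x b';
  ractZl : forall k x b, ract (k *: x) b = k *: ract x b;
  ractZr : forall k x b, ract x (k *: b) = k *: ract x b;
  ract1 : forall x, ract x 1 = x;
  ractM : forall x b b', ract x (b * b') = ract (ract x b) b';
  lractA : forall a x b, lact a (ract x b) = ract (lact a x) b }.

Section BimoduleAsModule.
Variables (K : comNzRingType) (A B : algType K) (M : bimod A B).

Definition left_mod : Type := M.
HB.instance Definition _ := GRing.Zmodule.on left_mod.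
HB.instance Definition _ := GRing.Zmodule_isLmodule.Build A left_mod
  (fun a a' x => esym (lactM a a' (x : M)))
  (@lact1 _ _ _ M) (@lactDr _ _ _ M)
  (fun (x : M) a a' => lactDl a a' x).

Definition right_mod : Type := M.
HB.instance Definition _ := GRing.Zmodule.on right_mod.
HB.instance Definition _ := GRing.Zmodule_isLmodule.Build B^c right_mod
  (fun (b b' : B) (x : M) => esym (ractM x b' b))
  (@ract1 _ _ _ M) (fun (b : B) (x y : M) => ractDl x y b)
  (@ractDr _ _ _ M).

End BimoduleAsModule.

Definition bimod_iso (K : comNzRingType) (A B : algType K) (M N : bimod A B) :
    Prop :=
  exists f : {linear M -> N},
    [/\ bijective f,
        forall a x, f (lact a x) = lact a (f x)
      & forall x b, f (ract x b) = ract (f x) b].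

Definition regular_bimod (K : comNzRingType) (A : algType K) : bimod A A.
Proof.
exists (A : lmodType K) (fun a x => a * x) (fun x b => x * b).
- exact: mulrDl.
- exact: mulrDr.
- by move=> k a x; rewrite scalerAl.
- by move=> k a x; rewrite scalerAr.
- exact: mul1r.
- by move=> a a' x; rewrite mulrA.
- by move=> x x' b; rewrite mulrDl.
- by move=> x b b'; rewrite mulrDr.
- by move=> k x b; rewrite scalerAl.
- by move=> k x b; rewrite scalerAr.
- exact: mulr1.
- by move=> x b b'; rewrite mulrA.
- by move=> a x b; rewrite mulrA.
Defined.

Definition sum_bimod (K : comNzRingType) (A B : algType K) (M N : bimod A B) :
  bimod A B.
Proof.
exists (M * N : lmodType K)%type
  (fun a u => (lact a u.1, lact a u.2)) (fun u b => (ract u.1 b, ract u.2 b)).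
- by move=> *; rewrite !lactDl.
- by move=> *; rewrite !lactDr.
- by move=> *; rewrite !lactZl.
- by move=> *; rewrite !lactZr.
- by case=> *; rewrite !lact1.
- by move=> *; rewrite !lactM.
- by move=> *; rewrite !ractDl.
- by move=> *; rewrite !ractDr.
- by move=> *; rewrite !ractZl.
- by move=> *; rewrite !ractZr.
- by case=> *; rewrite !ract1.
- by move=> *; rewrite !ractM.
- by move=> *; rewrite /= !lractA.
Defined.

Section TensorBimodule.
Variables (K : comNzRingType) (A B C : algType K).
Variables (M : bimod A B) (N : bimod B C).

Local Notation MN := (tens (@ract _ _ _ M) (@lact _ _ _ N)).

Fact MN_addACA (s t u v : MN) : s + t + (u + v) = s + u + (t + v).
Proof. exact: addrACA. Qed.

Definition tens_lact (a : A) : MN -> MN :=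
  tens_lift (fun x y => tmk _ _ (lact a x) y).
Definition tens_ract (t : MN) (c : C) : MN :=
  tens_lift (fun x y => tmk _ _ x (ract y c)) t.

Fact tens_lact_bal a : balanced (@ract _ _ _ M) (@lact _ _ _ N)
  (fun x y => tmk _ _ (lact a x) y : MN).
Proof.
split=> *; rewrite ?(lactDr, lactZr, lractA).
- by rewrite tmkDl.
- by rewrite tmkDr.
- by rewrite tmkZl.
- by rewrite tmkZr.
- by rewrite tmkA.
Qed.

Fact tens_ract_bal c : balanced (@ract _ _ _ M) (@lact _ _ _ N)
  (fun x y => tmk _ _ x (ract y c) : MN).
Proof.
split=> *; rewrite ?(ractDl, ractZl).
- by rewrite tmkDl.
- by rewrite tmkDr.
- by rewrite tmkZl.
- by rewrite tmkZr.
- by rewrite tmkA lractA.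
Qed.

Fact tens_lactE a x y : tens_lact a (tmk _ _ x y) = tmk _ _ (lact a x) y.
Proof. exact: tens_liftE (tens_lact_bal a) _ _. Qed.
Fact tens_ractE c x y : tens_ract (tmk _ _ x y) c = tmk _ _ x (ract y c).
Proof. exact: tens_liftE (tens_ract_bal c) _ _. Qed.
Fact tens_lactDr a s t : tens_lact a (s + t) = tens_lact a s + tens_lact a t.
Proof. exact: tens_liftD (tens_lact_bal a) _ _. Qed.
Fact tens_ractDl s t c : tens_ract (s + t) c = tens_ract s c + tens_ract t c.
Proof. exact: tens_liftD (tens_ract_bal c) _ _. Qed.
Fact tens_lact0 a : tens_lact a 0 = 0.
Proof. exact: tens_lift0 (tens_lact_bal a). Qed.
Fact tens_ract0 c : tens_ract 0 c = 0.
Proof. exact: tens_lift0 (tens_ract_bal c). Qed.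

Definition tens_bimod : bimod A C.
Proof.
exists (MN : lmodType K) tens_lact tens_ract.
- move=> a a' t; elim/tens_ind: t => [|x y|s t IHs IHt].
  + by rewrite !tens_lact0 addr0.
  + by rewrite !tens_lactE lactDl tmkDl.
  + by rewrite !tens_lactDr IHs IHt; exact: MN_addACA.
- exact: tens_lactDr.
- move=> k a t; elim/tens_ind: t => [|x y|s t IHs IHt].
  + by rewrite !tens_lact0 scaler0.
  + by rewrite !tens_lactE lactZl tmkZl.
  + by rewrite !tens_lactDr IHs IHt scalerDr.
- by move=> k a t; apply: tens_liftZ (tens_lact_bal a) _ _.
- move=> t; elim/tens_ind: t => [|x y|s t IHs IHt].
  + exact: tens_lact0.
  + by rewrite tens_lactE lact1.
  + by rewrite tens_lactDr IHs IHt.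
- move=> a a' t; elim/tens_ind: t => [|x y|s t IHs IHt].
  + by rewrite !tens_lact0.
  + by rewrite !tens_lactE lactM.
  + by rewrite !tens_lactDr IHs IHt.
- by move=> s t c; apply: tens_ractDl.
- move=> t c c'; elim/tens_ind: t => [|x y|s t IHs IHt].
  + by rewrite !tens_ract0 addr0.
  + by rewrite !tens_ractE ractDr tmkDr.
  + by rewrite !tens_ractDl IHs IHt; exact: MN_addACA.
- by move=> k t c; apply: tens_liftZ (tens_ract_bal c) _ _.
- move=> k t c; elim/tens_ind: t => [|x y|s t IHs IHt].
  + by rewrite !tens_ract0 scaler0.
  + by rewrite !tens_ractE ractZr tmkZr.
  + by rewrite !tens_ractDl IHs IHt scalerDr.
- move=> t; elim/tens_ind: t => [|x y|s t IHs IHt].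
  + exact: tens_ract0.
  + by rewrite tens_ractE ract1.
  + by rewrite tens_ractDl IHs IHt.
- move=> t c c'; elim/tens_ind: t => [|x y|s t IHs IHt].
  + by rewrite !tens_ract0.
  + by rewrite !tens_ractE ractM.
  + by rewrite !tens_ractDl IHs IHt.
- move=> a t c; elim/tens_ind: t => [|x y|s t IHs IHt].
  + by rewrite !(tens_ract0, tens_lact0).
  + by rewrite !(tens_ractE, tens_lactE).
  + rewrite (tens_ractDl s t) (tens_lactDr a s t).
    rewrite (tens_lactDr a (tens_ract s c)) tens_ractDl.
    exact: (congr2 +%R IHs IHt).
Defined.

End TensorBimodule.

(* The algebra A ⊗_K B, with (a ⊗ b)(a' ⊗ b') = aa' ⊗ bb'; the tensor product
   is balanced over K, which acts by scaling on both sides. *)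
Section TensorAlgebra.
Variables (K : comNzRingType) (A B : algType K).

Definition tens_alg : Type :=
  tens (M := A) (N := B) (fun a (k : K) => k *: a) (fun k b => k *: b).
HB.instance Definition _ := GRing.Lmodule.on tens_alg.

Fact ta_addACA (s t u v : tens_alg) : s + t + (u + v) = s + u + (t + v).
Proof. exact: addrACA. Qed.

Definition ta (a : A) (b : B) : tens_alg := tmk _ _ a b.

Definition ta_balanced (Z : lmodType K) (f : A -> B -> Z) :=
  balanced (fun a (k : K) => k *: a) (fun (k : K) b => k *: b) f.

Lemma ta_bilinear (Z : lmodType K) (f : A -> B -> Z) :
  (forall a a' b, f (a + a') b = f a b + f a' b) ->
  (forall a b b', f a (b + b') = f a b + f a b') ->
  (forall k a b, f (k *: a) b = k *: f a b) ->
  (forall k a b, f a (k *: b) = k *: f a b) -> ta_balanced f.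
Proof. by move=> Dl Dr Zl Zr; split=> // *; rewrite Zl Zr. Qed.

Definition ta_rmul (a : A) (b : B) : tens_alg -> tens_alg :=
  tens_lift (fun a' b' => ta (a' * a) (b' * b)).

Fact ta_rmul_bal a b : ta_balanced (fun a' b' => ta (a' * a) (b' * b)).
Proof.
apply: ta_bilinear => *.
- by rewrite mulrDl /ta tmkDl.
- by rewrite mulrDl /ta tmkDr.
- by rewrite -scalerAl /ta tmkZl.
- by rewrite -scalerAl /ta tmkZr.
Qed.

Definition ta_mul (s t : tens_alg) : tens_alg :=
  tens_lift (fun a b => ta_rmul a b s) t.

Lemma ta_rmulE a b a' b' : ta_rmul a b (ta a' b') = ta (a' * a) (b' * b).
Proof. exact: tens_liftE (ta_rmul_bal a b) _ _. Qed.
Lemma ta_rmulD a b s t : ta_rmul a b (s + t) = ta_rmul a b s + ta_rmul a b t.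
Proof. exact: tens_liftD (ta_rmul_bal a b) _ _. Qed.
Lemma ta_rmul0 a b : ta_rmul a b 0 = 0.
Proof. exact: tens_lift0 (ta_rmul_bal a b). Qed.
Lemma ta_rmulZ a b k t : ta_rmul a b (k *: t) = k *: ta_rmul a b t.
Proof. exact: tens_liftZ (ta_rmul_bal a b) _ _. Qed.

Lemma ta_ind (Q : tens_alg -> Prop) :
  Q 0 -> (forall a b, Q (ta a b)) -> (forall s t, Q s -> Q t -> Q (s + t)) ->
  forall t, Q t.
Proof. exact: tens_ind. Qed.

Fact ta_mul_bal s : ta_balanced (fun a b => ta_rmul a b s).
Proof.
apply: ta_bilinear => *; elim/ta_ind: s => [|x y|s t IHs IHt].
- by rewrite !ta_rmul0 addr0.
- by rewrite !ta_rmulE mulrDr /ta tmkDl.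
- by rewrite !ta_rmulD IHs IHt; exact: ta_addACA.
- by rewrite !ta_rmul0 addr0.
- by rewrite !ta_rmulE mulrDr /ta tmkDr.
- by rewrite !ta_rmulD IHs IHt; exact: ta_addACA.
- by rewrite !ta_rmul0 scaler0.
- by rewrite !ta_rmulE -scalerAr /ta tmkZl.
- by rewrite !ta_rmulD IHs IHt scalerDr.
- by rewrite !ta_rmul0 scaler0.
- by rewrite !ta_rmulE -scalerAr /ta tmkZr.
- by rewrite !ta_rmulD IHs IHt scalerDr.
Qed.

Lemma ta_mulE s a b : ta_mul s (ta a b) = ta_rmul a b s.
Proof. exact: tens_liftE (ta_mul_bal s) _ _. Qed.
Lemma ta_mulDr : right_distributive ta_mul +%R.
Proof. by move=> r s t; apply: tens_liftD (ta_mul_bal r) _ _. Qed.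
Lemma ta_mul0r s : ta_mul s 0 = 0.
Proof. exact: tens_lift0 (ta_mul_bal s). Qed.
Lemma ta_mulZr k s t : ta_mul s (k *: t) = k *: ta_mul s t.
Proof. exact: tens_liftZ (ta_mul_bal s) _ _. Qed.

Lemma ta_mulDl : left_distributive ta_mul +%R.
Proof.
move=> r s t; elim/ta_ind: t => [|x y|t t' IH IH'].
- by rewrite !ta_mul0r addr0.
- by rewrite !ta_mulE ta_rmulD.
- by rewrite !ta_mulDr IH IH'; exact: ta_addACA.
Qed.

Lemma ta_mulZl k s t : ta_mul (k *: s) t = k *: ta_mul s t.
Proof.
elim/ta_ind: t => [|x y|t t' IH IH'].
- by rewrite !ta_mul0r scaler0.
- by rewrite !ta_mulE ta_rmulZ.
- by rewrite !ta_mulDr IH IH' scalerDr.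
Qed.

Lemma ta_mul0l t : ta_mul 0 t = 0.
Proof. by have := ta_mulZl 0 0 t; rewrite !scale0r. Qed.

Lemma ta_mulA : associative ta_mul.
Proof.
move=> r s t; elim/ta_ind: t => [|x y|t t' IH IH'].
- by rewrite !ta_mul0r.
- rewrite !ta_mulE; elim/ta_ind: s => [|x' y'|s s' IH IH'].
  + by rewrite ta_rmul0 !ta_mul0r ta_rmul0.
  + rewrite ta_rmulE !ta_mulE; elim/ta_ind: r => [|x'' y''|r r' IH IH'].
    * by rewrite !ta_rmul0.
    * by rewrite !ta_rmulE !mulrA.
    * by rewrite !ta_rmulD IH IH'.
  + rewrite ta_rmulD (ta_mulDr r (ta_rmul x y s)) (ta_mulDr r s) ta_rmulD.
    exact: (congr2 +%R IH IH').
- rewrite (ta_mulDr s t) (ta_mulDr r) (ta_mulDr (ta_mul r s)).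
  exact: (congr2 +%R IH IH').
Qed.

Lemma ta_mul1l : left_id (ta 1 1) ta_mul.
Proof.
move=> t; elim/ta_ind: t => [|x y|t t' IH IH'].
- by rewrite ta_mul0r.
- by rewrite ta_mulE ta_rmulE !mul1r.
- by rewrite ta_mulDr IH IH'.
Qed.

Lemma ta_mul1r : right_id (ta 1 1) ta_mul.
Proof.
move=> t; rewrite ta_mulE; elim/ta_ind: t => [|x y|t t' IH IH'].
- by rewrite ta_rmul0.
- by rewrite ta_rmulE !mulr1.
- by rewrite ta_rmulD IH IH'.
Qed.

HB.instance Definition _ := GRing.Zmodule_isPzRing.Build tens_alg
  ta_mulA ta_mul1l ta_mul1r ta_mulDl ta_mulDr.

Lemma ta_mulrE (a a' : A) (b b' : B) :
  ta a b * ta a' b' = ta (a * a') (b * b').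
Proof. by rewrite -ta_rmulE -ta_mulE. Qed.

End TensorAlgebra.

Section EnvelopingAlgebra.
Variables (K : comNzRingType) (A : algType K).

(* A^e = A^op ⊗_K A *)
Definition env : Type := tens_alg A^c A.
HB.instance Definition _ := GRing.Lmodule.on env.
HB.instance Definition _ := GRing.PzRing.on env.

Definition ev (a b : A) : env := ta (a : A^c) b.

Lemma env_mulE (a b a' b' : A) : ev a b * ev a' b' = ev (a' * a) (b * b').
Proof. exact: ta_mulrE. Qed.

(* multiplication A^e -> A, used to see that A^e is not the zero ring *)
Fact env_mult_bal : ta_balanced (fun (a : A^c) (b : A) => (a : A) * b).
Proof.
apply: ta_bilinear => *.
- exact: mulrDl.
- exact: mulrDr.
- by rewrite scalerAl.
- by rewrite scalerAr.
Qed.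

Fact env_oner_neq0 : (1 : env) != 0.
Proof.
apply/eqP => /(congr1 (tens_lift (fun (a : A^c) (b : A) => (a : A) * b))).
rewrite (tens_lift0 env_mult_bal) (tens_liftE env_mult_bal) mulr1.
by apply/eqP; apply: oner_neq0.
Qed.
HB.instance Definition _ := GRing.PzSemiRing_isNonZero.Build env env_oner_neq0.

Fact env_scalerAl (k : K) (s t : env) : k *: (s * t) = (k *: s : env) * t.
Proof. exact: esym (ta_mulZl _ _ _). Qed.
HB.instance Definition _ := GRing.Lmodule_isLalgebra.Build K env env_scalerAl.

Fact env_scalerAr (k : K) (s t : env) : k *: (s * t) = s * (k *: t : env).
Proof. exact: esym (ta_mulZr _ _ _). Qed.
HB.instance Definition _ := GRing.Lalgebra_isAlgebra.Build K env env_scalerAr.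

End EnvelopingAlgebra.

(* An A-A-bimodule as a right A^e-module, x(a ⊗ b) = axb, and as a left
   A^e-module, (a ⊗ b)x = bxa. *)
Section BimoduleAsEnvModule.
Variables (K : comNzRingType) (A : algType K) (M : bimod A A).

Definition renv_act (x : M) (t : env A) : M :=
  tens_lift (fun (a : A^c) (b : A) => ract (lact (a : A) x) b) t.
Definition lenv_act (t : env A) (x : M) : M :=
  tens_lift (fun (a : A^c) (b : A) => lact b (ract x (a : A))) t.

Fact renv_bal (x : M) :
  ta_balanced (fun (a : A^c) (b : A) => ract (lact (a : A) x) b).
Proof.
apply: ta_bilinear => *.
- by rewrite lactDl ractDl.
- by rewrite ractDr.
- by rewrite lactZl ractZl.
- by rewrite ractZr.
Qed.

Fact lenv_bal (x : M) :
  ta_balanced (fun (a : A^c) (b : A) => lact b (ract x (a : A))).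
Proof.
apply: ta_bilinear => *.
- by rewrite ractDr lactDr.
- by rewrite lactDl.
- by rewrite ractZr lactZr.
- by rewrite lactZl.
Qed.

Lemma renv_actE (x : M) (a b : A) : renv_act x (ev a b) = ract (lact a x) b.
Proof. exact: tens_liftE (renv_bal x) _ _. Qed.
Lemma lenv_actE (a b : A) (x : M) : lenv_act (ev a b) x = lact b (ract x a).
Proof. exact: tens_liftE (lenv_bal x) _ _. Qed.
Fact renv_actDr x s t : renv_act x (s + t) = renv_act x s + renv_act x t.
Proof. exact: tens_liftD (renv_bal x) _ _. Qed.
Fact lenv_actDl x s t : lenv_act (s + t) x = lenv_act s x + lenv_act t x.
Proof. exact: tens_liftD (lenv_bal x) _ _. Qed.
Fact renv_act0 x : renv_act x 0 = 0.
Proof. exact: tens_lift0 (renv_bal x). Qed.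
Fact lenv_act0 x : lenv_act 0 x = 0.
Proof. exact: tens_lift0 (lenv_bal x). Qed.

Lemma env_ind (Q : env A -> Prop) :
  Q 0 -> (forall a b : A, Q (ev a b)) ->
  (forall s t, Q s -> Q t -> Q (s + t)) -> forall t, Q t.
Proof. exact: ta_ind. Qed.

Fact renv_actDl x y t : renv_act (x + y) t = renv_act x t + renv_act y t.
Proof.
elim/env_ind: t => [|a b|s t IHs IHt].
- by rewrite !renv_act0 addr0.
- by rewrite !renv_actE lactDr ractDl.
- by rewrite !renv_actDr IHs IHt addrACA.
Qed.

Fact lenv_actDr t x y : lenv_act t (x + y) = lenv_act t x + lenv_act t y.
Proof.
elim/env_ind: t => [|a b|s t IHs IHt].
- by rewrite !lenv_act0 addr0.
- by rewrite !lenv_actE ractDl lactDr.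
- by rewrite !lenv_actDl IHs IHt addrACA.
Qed.

Fact renv_0act t : renv_act 0 t = 0.
Proof. by apply: (@addrI _ (renv_act 0 t)); rewrite -renv_actDl !addr0. Qed.

Fact lenv_act_0 t : lenv_act t 0 = 0.
Proof. by apply: (@addrI _ (lenv_act t 0)); rewrite -lenv_actDr !addr0. Qed.

Fact renv_actM x s t : renv_act x (s * t) = renv_act (renv_act x s) t.
Proof.
elim/env_ind: t => [|a b|t t' IH IH'].
- by rewrite mulr0 !renv_act0.
- elim/env_ind: s => [|a' b'|s s' IH IH'].
  + by rewrite mul0r (renv_act0 x) renv_0act.
  + by rewrite env_mulE !renv_actE lactM ractM !lractA.
  + rewrite mulrDl 2!(renv_actDr x) renv_actDl.
    exact: (congr2 +%R IH IH').
- rewrite mulrDr (renv_actDr x) (renv_actDr (renv_act x s)).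
  exact: (congr2 +%R IH IH').
Qed.

Fact lenv_actM s t x : lenv_act (s * t) x = lenv_act s (lenv_act t x).
Proof.
elim/env_ind: t => [|a b|t t' IH IH'].
- by rewrite mulr0 !lenv_act0 lenv_act_0.
- elim/env_ind: s => [|a' b'|s s' IH IH'].
  + by rewrite mul0r (lenv_act0 x) (lenv_act0 (lenv_act (ev a b) x)).
  + by rewrite env_mulE !lenv_actE lactM ractM !lractA.
  + rewrite mulrDl (lenv_actDl x) (lenv_actDl (lenv_act (ev a b) x)).
    exact: (congr2 +%R IH IH').
- rewrite mulrDr 2!(lenv_actDl x) lenv_actDr.
  exact: (congr2 +%R IH IH').
Qed.

Fact renv_act1 x : renv_act x 1 = x.
Proof. by rewrite [1]/(ev 1 1) renv_actE lact1 ract1. Qed.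
Fact lenv_act1 x : lenv_act 1 x = x.
Proof. by rewrite [1]/(ev 1 1) lenv_actE lact1 ract1. Qed.

Definition renv_mod : Type := M.
HB.instance Definition _ := GRing.Zmodule.on renv_mod.
HB.instance Definition _ := GRing.Zmodule_isLmodule.Build (env A)^c renv_mod
  (fun (s t : env A) (x : M) => esym (renv_actM x t s))
  renv_act1 (fun t x y => renv_actDl x y t) renv_actDr.

Definition lenv_mod : Type := M.
HB.instance Definition _ := GRing.Zmodule.on lenv_mod.
HB.instance Definition _ := GRing.Zmodule_isLmodule.Build (env A) lenv_mod
  (fun (s t : env A) (x : M) => esym (lenv_actM s t x))
  lenv_act1 lenv_actDr lenv_actDl.

End BimoduleAsEnvModule.

Definition HH (K : comNzRingType) (A : algType K) (n : nat) : lmodType K :=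
  Tor (R := env A) (renv_mod (regular_bimod A)) (lenv_mod (regular_bimod A)) n.

Definition P_fin_env (K : comNzRingType) (A : algType K) (X : bimod A A) :
    Prop :=
  fin_gen (renv_mod X) /\ finite_pd (renv_mod X).

Definition fgproj (R : nzRingType) (M : lmodType R) : Prop :=
  fin_gen M /\ projective M.

Definition singular_equiv_Morita (K : comNzRingType) (A B : algType K)
    (M : bimod A B) (N : bimod B A) : Prop :=
  [/\ fgproj (left_mod M) /\ fgproj (right_mod M),
      fgproj (left_mod N) /\ fgproj (right_mod N),
      exists2 X : bimod A A, P_fin_env X &
        bimod_iso (tens_bimod M N) (sum_bimod (regular_bimod A) X)
    & exists2 Y : bimod B B, P_fin_env Y &
        bimod_iso (tens_bimod N M) (sum_bimod (regular_bimod B) Y)].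

(* Main.v *)
Require Import Defs.
From HB Require Import structures.
From mathcomp Require Import all_boot all_algebra.
From mathcomp Require Import ssrAC zify finmap monalg boolp.

Set Implicit Arguments.
Unset Strict Implicit.
Unset Printing Implicit Defensive.

Import GRing.Theory.
Local Open Scope ring_scope.

(** A bimodule M between A and B that is finitely generated projective over B
    has a transfer from the Hochschild homology of A to that of B. Choose a dual
    basis (x_i, f_i) of M over B; the left action of A becomes a multiplicative
    map rho from A to square matrices over B, rho(a)_ij = f_i(a x_j), and
    a_0 ⊗ ... ⊗ a_n is sent to the generalized trace
    Σ rho(a_0)_{i_0 i_1} ⊗ ... ⊗ rho(a_n)_{i_n i_0}. The properties that matter:

    - on homology it depends only on the isomorphism class of M
      [transfer_dual_basis]; the reason is that the traces of σu and uσ are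
      homotopic when u commutes with rho [trace_map_cyclic];
    - it turns tensor products of bimodules into composites [transfer_tens],
      sends the regular bimodule to the identity [transfer_id], and is additive
      on extensions that split over the right action [transfer_block].

    So if M ⊗_B N ≅ A ⊕ X, then going to B and back is the identity plus the
    transfer of X [summand_basis], and the theorem follows in every degree in
    which the transfers of X and of Y are zero.

    High degrees. The transfer of X factors through the homology of A with
    coefficients in X ⊗_A X^*, where X^* is the right dual: first a ↦ Σ a x_i ⊗ f_i,
    then evaluation [transfer_factor]. A projective bimodule P is a retract of
    A ⊗_K P, and A ⊗_K P ⊗_A X^* has an explicit contraction in positive degrees
    [acyclic_ind]. Hence the intermediate homology vanishes above the projective
    dimension of X [finite_pd_acyclic], and the transfer with it.

    All positive degrees, when A is finitely generated projective over K. Then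
    A ⊗_K X has a dual basis over A, and the sequence
    0 → X' → A ⊗_K X → X → 0 splits on the right. Additivity shows that the
    transfers of X and X' are opposite up to that of A ⊗_K X, which is zero in
    positive degrees. Replacing X by X' lowers by one the degree from which the
    coefficients are acyclic; after finitely many steps it is at most 1
    [transfer_vanish].

    It remains to identify Tor over the enveloping algebra with the homology of
    the Hochschild complex [tor_hochschild]. Since A is projective over K, the
    complex with coefficients in V is exact in V, and its homology vanishes in
    positive degrees when V is a projective bimodule. So both theories shift
    degrees along the syzygies of the standard resolution, down to degree zero,
    where U ⊗_{A^e} A and the Hochschild homology are both the quotient of U by
    the commutators au - ua. *)

(** * Chains: words in an algebra with coefficients *)
Section Chains.
Variables (K : comNzRingType) (A V : lmodType K).

Local Notation "[ v , s ]" := (<< 1 *g (v, s) >> : {malg K[(V * seq A)%type]}).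

Inductive chain_rel : {malg K[(V * seq A)%type]} -> Prop :=
| ChainV k v v' s : chain_rel ([k *: v + v', s] - (k *: [v, s] + [v', s]))
| ChainA v s1 k a a' s2 :
    chain_rel ([v, s1 ++ (k *: a + a') :: s2]
            - (k *: [v, s1 ++ a :: s2] + [v, s1 ++ a' :: s2])).

(** The direct sum over n of V ⊗ A^{⊗ n}. All degrees live in one module, with
    the degree carried by the length of the word, so that faces and boundaries
    are plain linear endomorphisms and no cast between tensor powers occurs. *)
Definition chain : Type := quotmod chain_rel.
HB.instance Definition _ := GRing.Lmodule.on chain.

(** The elementary tensor v ⊗ a_1 ⊗ ... ⊗ a_n is packed behind an opaque proof:
    conversion then never unfolds it to the quotient. *)
Fact pure_exists :
  {g : V -> seq A -> chain | forall v s, g v s = quot_proj chain_rel [v, s]}.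
Proof. by exists (fun v s => quot_proj chain_rel [v, s]). Qed.
Definition pure : V -> seq A -> chain := sval pure_exists.
Lemma pure_def v s : pure v s = quot_proj chain_rel [v, s].
Proof. exact: (svalP pure_exists). Qed.

Lemma pureV k v v' s : pure (k *: v + v') s = k *: pure v s + pure v' s.
Proof. by rewrite !pure_def -linearP; apply: quot_proj_rel (ChainV _ _ _ _). Qed.

Lemma pureA v s1 k a a' s2 : pure v (s1 ++ (k *: a + a') :: s2) =
  k *: pure v (s1 ++ a :: s2) + pure v (s1 ++ a' :: s2).
Proof.
by rewrite !pure_def -linearP; apply: quot_proj_rel (ChainA _ _ _ _ _ _).
Qed.

Lemma chain_ind (Q : chain -> Prop) :
  Q 0 -> (forall v s, Q (pure v s)) -> (forall x y, Q x -> Q y -> Q (x + y)) ->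
  forall x, Q x.
Proof.
move=> Q0 Qg QD t; rewrite -[t]quot_projK; set g := repr t.
rewrite [g]monalgE linear_sum; elim/big_ind: _ => //= -[v s] _.
have -> : << g@_(v, s) *g (v, s) >> = g@_(v, s) *: [v, s].
  by apply/malgP => z; rewrite mcoeffZ !mcoeffU mulrnAr mulr1.
rewrite linearZ /= -pure_def.
have := pureV (g@_(v, s)) v 0 s; rewrite addr0.
have := pureV (-1) v v s; rewrite !scaleN1r !addNr => ->.
by rewrite addr0 => <-.
Qed.

Record multilin (Z : lmodType K) (f : V -> seq A -> Z) : Prop := Multilin {
  mlV : forall s k v v', f (k *: v + v') s = k *: f v s + f v' s;
  mlA : forall v s1 s2 k a a', f v (s1 ++ (k *: a + a') :: s2) =
    k *: f v (s1 ++ a :: s2) + f v (s1 ++ a' :: s2) }.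

Fact chain_lift_exists (Z : lmodType K) (f : V -> seq A -> Z) : multilin f ->
  {h : {linear chain -> Z} | forall v s, h (pure v s) = f v s}.
Proof.
move=> fP; pose F := free_lift (fun vs => f vs.1 vs.2).
pose h (x : chain) : Z := F (repr x).
have hE g : h (quot_proj chain_rel g) = F g.
  apply: quot_repr_lift => _ [] *;
  rewrite !(linearB, linearD, linearZ) /= !free_liftU /=;
  by rewrite ?(mlV fP) ?(mlA fP) ?scalerN -?opprD subrr.
have hL : linear h.
  move=> a s t; rewrite -[s]quot_projK -[t]quot_projK -linearP.
  by rewrite !hE /F linearP.
pose hl := GRing.isLinear.Build K chain Z _ h hL.
exists (HB.pack_for {linear chain -> Z} h hl) => v s.
by rewrite /= pure_def hE /F free_liftU.
Qed.

Definition chain_lift (Z : lmodType K) f (fP : multilin f) : {linear chain -> Z} :=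
  sval (chain_lift_exists fP).

Lemma chain_liftE (Z : lmodType K) f (fP : multilin f) v s :
  chain_lift fP (pure v s) = f v s :> Z.
Proof. exact: (svalP (chain_lift_exists fP)). Qed.

Lemma chain_ext (Z : lmodType K) (f g : {linear chain -> Z}) :
  (forall v s, f (pure v s) = g (pure v s)) -> f =1 g.
Proof.
move=> fg x; elim/chain_ind: x => [|v s|x y IHx IHy]; first by rewrite !linear0.
  exact: fg.
by rewrite !linearD IHx IHy.
Qed.

Lemma pure_multilin : multilin pure.
Proof. by split=> *; [apply: pureV | apply: pureA]. Qed.

Lemma pure0 s : pure 0 s = 0.
Proof. by have := pureV (-1) 0 0 s; rewrite !scaleN1r !addNr. Qed.

Lemma pureD v v' s : pure (v + v') s = pure v s + pure v' s.
Proof. by have := pureV 1 v v' s; rewrite !scale1r. Qed.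

Lemma pureB v v' s : pure (v - v') s = pure v s - pure v' s.
Proof. by have := pureV (-1) v' v s; rewrite !scaleN1r ![- _ + _]addrC. Qed.

Lemma pure_sum (I : Type) (r : seq I) (F : I -> V) s :
  pure (\sum_(i <- r) F i) s = \sum_(i <- r) pure (F i) s.
Proof.
elim: r => [|i r IH]; first by rewrite !big_nil pure0.
by rewrite !big_cons pureD IH.
Qed.

Lemma pureZ k v s : pure (k *: v) s = k *: pure v s.
Proof. by have := pureV k v 0 s; rewrite pure0 !addr0. Qed.

Lemma pureA0 v s1 s2 : pure v (s1 ++ 0 :: s2) = 0.
Proof. by have := pureA v s1 (-1) 0 0 s2; rewrite !scaleN1r !addNr. Qed.

Lemma pureA_sum (I : Type) (r : seq I) (F : I -> A) v s1 s2 :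
  pure v (s1 ++ (\sum_(i <- r) F i) :: s2) =
  \sum_(i <- r) pure v (s1 ++ F i :: s2).
Proof.
elim: r => [|i r IH]; first by rewrite !big_nil pureA0.
rewrite !big_cons -IH.
by have := pureA v s1 1 (F i) (\sum_(j <- r) F j) s2; rewrite !scale1r.
Qed.

Lemma deg_multilin (Z : lmodType K) (n : nat) (f : V -> seq A -> Z) :
  multilin f -> multilin (fun v s => if size s == n then f v s else 0).
Proof.
move=> fP; split=> [s k x y|v s1 s2 k x y]; rewrite ?size_cat /=.
  by case: ifP => _; rewrite ?(mlV fP) // scaler0 addr0.
by case: ifP => _; rewrite ?(mlA fP) // scaler0 addr0.
Qed.

Definition deg_part (n : nat) : {linear chain -> chain} :=
  chain_lift (deg_multilin n pure_multilin).

Lemma deg_part_pure n v s : deg_part n (pure v s) =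
  if size s == n then pure v s else 0.
Proof. exact: chain_liftE. Qed.

Definition homog n x := deg_part n x = x.

Lemma homog_deg_part n x : homog n (deg_part n x).
Proof.
rewrite /homog -[deg_part n (deg_part n x)]/((deg_part n \o deg_part n) x).
apply: chain_ext x => v s /=; rewrite deg_part_pure; case: ifP => e.
  by rewrite deg_part_pure e.
by rewrite linear0.
Qed.

Lemma homog_pure v s : homog (size s) (pure v s).
Proof. by rewrite /homog deg_part_pure eqxx. Qed.

Lemma homogP n k x y : homog n x -> homog n y -> homog n (k *: x + y).
Proof. by rewrite /homog linearP => -> ->. Qed.

Lemma homogD n x y : homog n x -> homog n y -> homog n (x + y).
Proof. by rewrite /homog linearD => -> ->. Qed.

Lemma homogB n x y : homog n x -> homog n y -> homog n (x - y).
Proof. by rewrite /homog linearB => -> ->. Qed.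

Lemma homogZ n k x : homog n x -> homog n (k *: x).
Proof. by rewrite /homog linearZ => ->. Qed.

Lemma homog0 n : homog n 0.
Proof. exact: linear0. Qed.

Lemma homog_sum n (I : Type) (r : seq I) (P : pred I) (F : I -> chain) :
  (forall i, P i -> homog n (F i)) -> homog n (\sum_(i <- r | P i) F i).
Proof. by move=> FP; rewrite /homog linear_sum; apply: eq_bigr => i /FP. Qed.

Lemma homog_ind n (Q : chain -> Prop) :
  Q 0 -> (forall v s, size s = n -> Q (pure v s)) ->
  (forall x y, Q x -> Q y -> Q (x + y)) -> forall x, homog n x -> Q x.
Proof.
move=> Q0 Qg QD x <-; elim/chain_ind: x => [|v s|x y IHx IHy].
- by rewrite linear0.
- by rewrite deg_part_pure; case: eqP => // /Qg; apply.
- by rewrite linearD; apply: QD.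
Qed.

Lemma homog_ext n (Z : lmodType K) (f g : {linear chain -> Z}) :
  (forall v s, size s = n -> f (pure v s) = g (pure v s)) ->
  forall x, homog n x -> f x = g x.
Proof.
move=> fg; apply: homog_ind => [|v s /fg //|x y]; first by rewrite !linear0.
by rewrite !linearD => -> ->.
Qed.

End Chains.

Arguments deg_part {K A V} n.
Arguments homog {K A V} n x.

Section ChainMap.
Variables (K : comNzRingType) (A V W : lmodType K) (f : {linear V -> W}).

Fact chain_map_multilin : multilin (fun v (s : seq A) => pure (f v) s).
Proof.
split=> [s k x y|v s1 s2 k x y]; first by rewrite linearP pureV.
by rewrite pureA.
Qed.

Definition chain_map : {linear chain A V -> chain A W} :=
  chain_lift chain_map_multilin.

Lemma chain_mapE v s : chain_map (pure v s) = pure (f v) s.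
Proof. exact: chain_liftE. Qed.

Lemma chain_map_deg_part n x : chain_map (deg_part n x) = deg_part n (chain_map x).
Proof.
apply: (chain_ext (f := chain_map \o deg_part n) (g := deg_part n \o chain_map)) =>
  v s /=.
by rewrite deg_part_pure chain_mapE deg_part_pure; case: ifP;
  rewrite ?chain_mapE ?linear0.
Qed.

Lemma chain_map_homog n x : homog n x -> homog n (chain_map x).
Proof. by rewrite /homog -chain_map_deg_part => ->. Qed.

Lemma chain_map_surj : (forall w, exists v, f v = w) ->
  forall y, exists x, chain_map x = y.
Proof.
move=> fS y; elim/chain_ind: y => [|w s|y z [x <-] [x' <-]].
- by exists 0; rewrite linear0.
- by have [v <-] := fS w; exists (pure v s); rewrite chain_mapE.
- by exists (x + x'); rewrite linearD.
Qed.

Lemma chain_map_surj_homog : (forall w, exists v, f v = w) ->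
  forall n y, homog n y -> exists2 x, homog n x & chain_map x = y.
Proof.
move=> fS n y ydeg; have [x xy] := chain_map_surj fS y.
by exists (deg_part n x); [apply: homog_deg_part | rewrite chain_map_deg_part xy].
Qed.

End ChainMap.

Lemma chain_map_comp (K : comNzRingType) (A V W U : lmodType K)
    (f : {linear V -> W}) (g : {linear W -> U}) (x : chain A V) :
  chain_map A g (chain_map A f x) = chain_map A (g \o f) x.
Proof.
apply: (chain_ext (f := chain_map A g \o chain_map A f)) => v s /=.
by rewrite !chain_mapE.
Qed.

Lemma chain_map_id (K : comNzRingType) (A V : lmodType K)
    (f : {linear V -> V}) (x : chain A V) : f =1 id -> chain_map A f x = x.
Proof.
move=> fid; apply: (chain_ext (f := chain_map A f) (g := idfun)) => v s /=.
by rewrite chain_mapE fid.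
Qed.

(** * Exactness in the coefficients *)
Section Exactness.
Variables (K : comNzRingType) (A : lmodType K) (projA : projective A).

Lemma sum_widen (T : eqType) (Z : zmodType) (L L' : seq T) (F : T -> Z) :
  uniq L -> uniq L' -> {subset L <= L'} -> (forall x, x \notin L -> F x = 0) ->
  \sum_(x <- L) F x = \sum_(x <- L') F x.
Proof.
move=> uL uL' sub F0.
rewrite [RHS](bigID (mem L)) /= [X in _ = _ + X]big1 ?addr0; last first.
  by move=> x /F0.
rewrite -[RHS]big_filter; apply: perm_big; apply: uniq_perm => // [|x].
  exact: filter_uniq.
by rewrite mem_filter andb_idr // => /sub.
Qed.

(** A section of the projection from the free module on the set A. Its coordinates
    form a possibly infinite dual basis of A over K. *)
Lemma projective_coord : exists sg : {linear A -> {malg K[A]}},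
  forall a, \sum_(y <- msupp (sg a)) (sg a)@_y *: y = a.
Proof.
have surj v : exists u, free_lift (idfun : A -> A) u = v.
  by exists << 1 *g v >>; rewrite free_liftU.
have [h hP] := @projA _ _ (free_lift (idfun : A -> A)) idfun surj.
by exists h => a; exact: (hP a).
Qed.

Section Coord.
Variables (sg : {linear A -> {malg K[A]}}).
Hypothesis sgP : forall a, \sum_(y <- msupp (sg a)) (sg a)@_y *: y = a.

Fixpoint word_coef (x s : seq A) : K :=
  match x, s with
  | [::], [::] => 1
  | y :: x', a :: s' => (sg a)@_y * word_coef x' s'
  | _, _ => 0
  end.

Lemma word_coef_lin x s1 s2 k a a' :
  word_coef x (s1 ++ (k *: a + a') :: s2) =
  k * word_coef x (s1 ++ a :: s2) + word_coef x (s1 ++ a' :: s2).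
Proof.
elim: s1 x => [|b s1 IH] [|y x] /=; rewrite ?mulr0 ?addr0 //.
  by rewrite linearP mcoeffD mcoeffZ mulrDl mulrA.
by rewrite IH mulrDr mulrCA.
Qed.

Variable V : lmodType K.

Fact coord_multilin x : multilin (fun (v : V) s => word_coef x s *: v).
Proof.
split=> [s k v w|v s1 s2 k a a'].
  by rewrite scalerDr !scalerA mulrC.
by rewrite word_coef_lin scalerDl scalerA.
Qed.

Definition coord x : {linear chain A V -> V} := chain_lift (coord_multilin x).

Lemma coord_gen x v s : coord x (pure v s) = word_coef x s *: v.
Proof. exact: chain_liftE. Qed.

Lemma pure_expand s (v : V) : exists L : seq (seq A),
  [/\ uniq L, forall x, x \notin L -> word_coef x s = 0
    & forall s0, pure v (s0 ++ s) =
      \sum_(x <- L) word_coef x s *: pure v (s0 ++ x)].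
Proof.
elim: s => [|a s [L [uL L0 LE]]].
  exists [:: [::]]; split=> // [[|y x] //|s0].
  by rewrite big_seq1 scale1r.
exists [seq y :: x | y <- msupp (sg a), x <- L]; split.
- by apply: allpairs_uniq (fset_uniq _) uL _ => -[y x] [y' x'] _ _ [-> ->].
- case=> [|y x] //= nL; case: (boolP (y \in msupp (sg a))) => ym; last first.
    by rewrite mcoeff_outdom ?mul0r.
  case: (boolP (x \in L)) => xL; last by rewrite (L0 x) // mulr0.
  by case/negP: nL; apply/allpairsP; exists (y, x).
- move=> s0; rewrite big_allpairs_dep /= -[in LHS](sgP a) pureA_sum.
  apply: eq_bigr => y _.
  have -> : pure v (s0 ++ ((sg a)@_y *: y) :: s) =
    (sg a)@_y *: pure v (s0 ++ y :: s).
    by have := pureA v s0 (sg a)@_y y 0 s; rewrite pureA0 !addr0.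
  rewrite -cat_rcons LE scaler_sumr; apply: eq_bigr => x _.
  by rewrite scalerA cat_rcons.
Qed.

(** A chain is determined by its coordinates, which lie in V and are natural in
    V. This is the reason why V ↦ chain A V is exact. *)
Lemma coord_expand (t : chain A V) : exists L : seq (seq A),
  [/\ uniq L, forall x, x \notin L -> coord x t = 0
    & t = \sum_(x <- L) pure (coord x t) x].
Proof.
elim/chain_ind: t => [|v s|t t' [L [uL L0 LE]] [L' [uL' L0' LE']]].
- by exists [::]; split=> // [x _|]; rewrite ?linear0 ?big_nil.
- have [L [uL L0 LE]] := pure_expand s v; exists L; split=> // [x xL|].
    by rewrite coord_gen L0 // scale0r.
  transitivity (\sum_(x <- L) word_coef x s *: pure v x); first exact: (LE [::]).
  apply: eq_bigr => x _; by rewrite coord_gen pureZ.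
- exists (undup (L ++ L')); split; first exact: undup_uniq.
    move=> x; rewrite mem_undup mem_cat negb_or => /andP[xL xL'].
    by rewrite linearD L0 // L0' // addr0.
  have widen (M : seq (seq A)) u : uniq M -> {subset M <= L ++ L'} ->
      (forall x, x \notin M -> coord x u = 0) ->
      u = \sum_(x <- M) pure (coord x u) x ->
      u = \sum_(x <- undup (L ++ L')) pure (coord x u) x.
    move=> uM sM M0 {1}->; apply: sum_widen => //; first exact: undup_uniq.
      by move=> x /sM; rewrite mem_undup.
    by move=> x /M0 ->; rewrite pure0.
  rewrite {1}(widen L t) //; last by move=> x xL; rewrite mem_cat xL.
  rewrite {1}(widen L' t') //; last by move=> x xL; rewrite mem_cat xL orbT.
  rewrite -big_split; apply: eq_bigr => x _ /=.
  by have := pureV 1 (coord x t) (coord x t') x; rewrite !scale1r linearD.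
Qed.

End Coord.

Lemma coord_map (sg : {linear A -> {malg K[A]}}) (V W : lmodType K)
    (f : {linear V -> W}) x (t : chain A V) :
  coord sg W x (chain_map A f t) = f (coord sg V x t).
Proof.
apply: (chain_ext (f := coord sg W x \o chain_map A f) (g := f \o coord sg V x)).
by move=> v s /=; rewrite chain_mapE !coord_gen linearZ.
Qed.

Lemma chain_map_exact (U V W : lmodType K)
    (f : {linear U -> V}) (g : {linear V -> W}) :
  (forall v, g v = 0 -> exists u, f u = v) ->
  forall x : chain A V, chain_map A g x = 0 -> exists y, chain_map A f y = x.
Proof.
move=> ex x gx; have [sg sgP] := projective_coord.
have [L [_ _ ->]] := coord_expand sgP x.
have im z : exists u, f u = coord sg V z x.
  by apply: ex; rewrite -coord_map gx linear0.
have [u uP] := choice im.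
exists (\sum_(z <- L) pure (u z) z); rewrite linear_sum; apply: eq_bigr => z _.
by rewrite chain_mapE uP.
Qed.

Lemma chain_map_inj (U V : lmodType K) (f : {linear U -> V}) :
  injective f -> injective (chain_map A f).
Proof.
move=> fI; apply: raddf_inj => x fx; have [sg sgP] := projective_coord.
have [L [_ _ ->]] := coord_expand sgP x.
rewrite big1 // => z _; rewrite (fI (coord sg U z x) 0) ?pure0 //.
by rewrite -coord_map fx !linear0.
Qed.

End Exactness.

(** * The Hochschild boundary *)

(** A bimodule on which 1 need not act as the identity. The coefficients
    [power] below have this form, with 1 acting on one side through an
    idempotent matrix; the boundary squares to zero all the same. *)
Record prebimod (K : comNzRingType) (A : algType K) := Prebimod {
  pb_sort :> lmodType K;
  plact : A -> pb_sort -> pb_sort;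
  pract : pb_sort -> A -> pb_sort;
  plactPl : forall k a a' v, plact (k *: a + a') v = k *: plact a v + plact a' v;
  plactPr : forall a k v v', plact a (k *: v + v') = k *: plact a v + plact a v';
  practPr : forall v k a a', pract v (k *: a + a') = k *: pract v a + pract v a';
  practPl : forall k v v' a, pract (k *: v + v') a = k *: pract v a + pract v' a;
  plactM : forall a b v, plact (a * b) v = plact a (plact b v);
  practM : forall v a b, pract v (a * b) = pract (pract v a) b;
  plactA : forall a v b, plact a (pract v b) = pract (plact a v) b }.

Section Faces.
Variables (K : comNzRingType) (A : algType K) (V : prebimod A).
Implicit Types (v : V) (s : seq A) (a b : A).

Fixpoint merge_at (i : nat) s : seq A :=
  if s is a :: s' then
    if i is i'.+1 then a :: merge_at i' s'
    else if s' is b :: s'' then a * b :: s'' else s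
  else [::].

Lemma merge_at_cat s1 a b s2 :
  merge_at (size s1) (s1 ++ a :: b :: s2) = s1 ++ a * b :: s2.
Proof. by elim: s1 => //= c s1 ->. Qed.

(** The last, cyclic face a_n v ⊗ a_1 ⊗ ... ⊗ a_{n-1}. *)
Definition wrap v s : chain A V :=
  if s is a :: s' then pure (plact (last a s') v) (belast a s') else 0.

Definition face (i : nat) v s : chain A V :=
  match i, s with
  | _, [::] => 0
  | 0, a :: s' => pure (pract v a) s'
  | i'.+1, a :: s' =>
    if (i'.+1 < size s)%N then pure v (merge_at i' s) else wrap v s
  end.

Lemma wrap_rcons v s z : wrap v (rcons s z) = pure (plact z v) s.
Proof.
case: s => [|a s] //; rewrite rcons_cons /wrap last_rcons.
by rewrite belast_rcons.
Qed.

Lemma face_last v s z : face (size s).+1 v (rcons s z) = pure (plact z v) s.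
Proof.
rewrite -wrap_rcons /face; case E: (rcons s z) => [|a s']; first by case: s E.
by rewrite -E size_rcons ltnn.
Qed.

Lemma face_mid v s1 a b s2 :
  face (size s1).+1 v (s1 ++ a :: b :: s2) = pure v (s1 ++ a * b :: s2).
Proof.
rewrite -merge_at_cat /face; case E: (s1 ++ _) => [|c s]; first by case: s1 E.
by rewrite -E size_cat /= !addnS ltnS ltnS leq_addr.
Qed.

(** Case analysis on the position of a face. Each constructor exhibits the word
    in the shape in which the corresponding face can be computed. *)
Variant face_view : nat -> seq A -> Prop :=
| FaceFirst a s : face_view 0 (a :: s)
| FaceMid s1 a b s2 : face_view (size s1).+1 (s1 ++ a :: b :: s2)
| FaceLast s z : face_view (size s).+1 (rcons s z).

Lemma faceP i s : (i <= size s)%N -> (0 < size s)%N -> face_view i s.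
Proof.
case: i => [|i] ile s0; first by case: s s0 {ile} => // a s _; constructor.
case: (ltngtP i.+1 (size s)) ile => // [lt|E] _.
  rewrite -(cat_take_drop i s) -{1}(size_takel (ltnW (ltnW lt))).
  rewrite (drop_nth 0 (ltnW lt)) (drop_nth 0 lt).
  by constructor.
by case/lastP: s E s0 => // s z; rewrite size_rcons => -[->] _; constructor.
Qed.

Lemma pure_merge_lin v p s1 k a a' s2 i :
  pure v (p ++ merge_at i (s1 ++ (k *: a + a') :: s2)) =
  k *: pure v (p ++ merge_at i (s1 ++ a :: s2)) +
    pure v (p ++ merge_at i (s1 ++ a' :: s2)).
Proof.
elim: s1 p i => [|c s1 IH] p [|i] /=.
- case: s2 => [|b s2]; first exact: pureA.
  by rewrite mulrDl -scalerAl pureA.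
- by case: s2 => [|b s2]; rewrite pureA.
- case: s1 {IH} => [|d s1] /=.
    by rewrite mulrDr -scalerAr pureA.
  by rewrite -!cat_cons !catA pureA.
- by rewrite -!(cat_rcons c p) IH.
Qed.

Lemma face_multilin i : multilin (face i).
Proof.
split=> [s k v v'|v s1 s2 k a a'].
  case: s i => [|a s] [|i] /=; rewrite ?scaler0 ?addr0 //.
    by rewrite practPl pureV.
  by case: ifP => _; rewrite ?plactPr pureV.
case: i => [|i].
  by case: s1 => [|b s1] /=; rewrite ?practPr ?pureV ?pureA.
have E x : face i.+1 v (s1 ++ x :: s2) =
    if (i < size s1 + size s2)%N then pure v (merge_at i (s1 ++ x :: s2))
    else wrap v (s1 ++ x :: s2).
  have : size (s1 ++ x :: s2) = (size s1 + size s2).+1.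
    by rewrite size_cat /= addnS.
  by rewrite /face; case: (s1 ++ _) => // c s ->.
rewrite !E; case: ifP => _; first exact: (pure_merge_lin v [::]).
case/lastP: s2 {E} => [|s2 z]; first by rewrite !cats1 !wrap_rcons plactPl pureV.
by rewrite -!rcons_cons -!rcons_cat !wrap_rcons pureA.
Qed.

Definition dface i : {linear chain A V -> chain A V} :=
  chain_lift (face_multilin i).

Lemma dface_pure i v s : dface i (pure v s) = face i v s.
Proof. exact: chain_liftE. Qed.

Lemma dface_first v a s : dface 0 (pure v (a :: s)) = pure (pract v a) s.
Proof. by rewrite dface_pure. Qed.

Lemma dface_mid v s1 a b s2 n : n = (size s1).+1 ->
  dface n (pure v (s1 ++ a :: b :: s2)) = pure v (s1 ++ a * b :: s2).
Proof. by move=> ->; rewrite dface_pure face_mid. Qed.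

Lemma dface_last v s z n : n = (size s).+1 -> dface n (pure v (rcons s z)) =
  pure (plact z v) s.
Proof. by move=> ->; rewrite dface_pure face_last. Qed.

Lemma bnd_multilin :
  multilin (fun v s => \sum_(i < (size s).+1) (-1) ^+ i *: face i v s).
Proof.
split=> [s k v v'|v s1 s2 k a a'].
  rewrite scaler_sumr -big_split; apply: eq_bigr => i _ /=.
  by rewrite (mlV (face_multilin i)) scalerDr !scalerA mulrC.
rewrite !size_cat /= scaler_sumr -big_split; apply: eq_bigr => i _ /=.
by rewrite (mlA (face_multilin i)) scalerDr !scalerA mulrC.
Qed.

Definition bnd : {linear chain A V -> chain A V} := chain_lift bnd_multilin.

Lemma bndE n x : homog n x -> bnd x = \sum_(i < n.+1) (-1) ^+ i *: dface i x.
Proof.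
elim/homog_ind: x / => [|v s <-|x y IHx IHy].
- by rewrite linear0 big1 // => i _; rewrite linear0 scaler0.
- by rewrite /bnd chain_liftE; apply: eq_bigr => i _; rewrite dface_pure.
- rewrite linearD IHx IHy -big_split; apply: eq_bigr => i _ /=.
  by rewrite linearD scalerDr.
Qed.

Lemma dface_homog n i x : (i <= n.+1)%N -> homog n.+1 x -> homog n (dface i x).
Proof.
move=> ile; elim/homog_ind: x / => [|v s sz|x y IHx IHy].
- by rewrite linear0; apply: homog0.
- have iv : face_view i s by apply: faceP; rewrite sz.
  case: i s / iv ile sz => [a s|s1 a b s2|s z] _.
  + by rewrite dface_first => -[<-]; apply: homog_pure.
  + rewrite dface_mid // size_cat /= !addnS => -[<-].
    by have := @homog_pure _ _ V v (s1 ++ a * b :: s2); rewrite size_cat /= addnS.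
  + by rewrite dface_last // size_rcons => -[<-]; apply: homog_pure.
- by rewrite linearD; apply: homogD.
Qed.

Lemma bnd_homog n x : homog n.+1 x -> homog n (bnd x).
Proof.
move=> xd; rewrite (bndE xd); apply: homog_sum => i _.
by apply: homogZ; apply: dface_homog => //; rewrite -ltnS.
Qed.

Lemma bnd_homog0 x : homog 0 x -> bnd x = 0.
Proof.
elim/homog_ind: x / => [|v s|x y IHx IHy]; first exact: linear0.
- by case: s => // _; rewrite /bnd chain_liftE big_ord1 /= scaler0.
- by rewrite linearD IHx IHy addr0.
Qed.

Lemma dface_dface i j v s : (i < j)%N -> (j <= size s)%N -> (1 < size s)%N ->
  dface i (dface j (pure v s)) = dface j.-1 (dface i (pure v s)).
Proof.
move=> ij js s_gt1.
have s_gt0 : (0 < size s)%N by apply: ltnW.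
have jv := faceP js s_gt0.
case: j s / jv ij s_gt1 {js s_gt0} => [a s //|s1 a b s2|s z] ij.
  move=> _; rewrite (dface_mid v a b s2 erefl) /=.
  case: (posnP (size s1)) ij => [/size0nil -> | s1_gt0]; rewrite ltnS.
    by rewrite leqn0 => /eqP ->; rewrite !dface_first practM.
  move=> ile; have iv := faceP ile s1_gt0.
  case: i s1 / iv {ile s1_gt0} => [c t|t c d t'|t c].
  - by rewrite !dface_first dface_mid.
  - rewrite -!catA /= !dface_mid // -[in RHS]cat_cons [in RHS]catA.
    by rewrite dface_mid -?catA // !size_cat /= !addnS.
  - by rewrite size_rcons !cat_rcons !dface_mid // mulrA.
rewrite size_rcons ltnS => t_gt0; rewrite dface_last //=.
move: ij; rewrite ltnS => ile.
have iv := faceP ile t_gt0.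
case: i s / iv {ile t_gt0} => [c t|t c d t'|t c].
- by rewrite !dface_first dface_last // plactA.
- rewrite dface_mid // rcons_cat /= dface_mid //.
  by rewrite -rcons_cons -rcons_cat dface_last // !size_cat /= !addnS.
- rewrite dface_last // -(cats1 (rcons t c) z) cat_rcons size_rcons dface_mid //.
  by rewrite cats1 dface_last // plactM.
Qed.

(** The terms at (i, j) and (j - 1, i), for i < j, are equal with opposite
    signs. *)
Lemma alt_sum_cancel (Z : lmodType K) (G : nat -> nat -> Z) n :
  (forall i j, (i < j)%N -> (j <= n)%N -> G i j = G j.-1 i) ->
  \sum_(j < n.+1) \sum_(i < n) ((-1) ^+ j * (-1) ^+ i) *: G i j = 0.
Proof.
elim: n => [|n IH] GE; first by rewrite big_ord1 big_ord0.
(* Only the column j = n + 1 and the row i = n are new, and they cancel. *)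
rewrite big_ord_recr /=; under eq_bigr do rewrite big_ord_recr /=.
rewrite big_split /=.
rewrite IH; last by move=> i j ij jn; rewrite GE // ltnW.
rewrite add0r -big_split /=.
rewrite big1 // => j _.
rewrite (GE j n.+1) //= [X in X *: _ + _]mulrC exprS mulN1r mulNr scaleNr.
by rewrite subrr.
Qed.

(** The faces form a presimplicial module: this is [dface_dface], and the rest
    is the cancellation of signs. Degrees 0 and 1 are apart because the boundary
    vanishes on degree 0. *)
Lemma bnd_bnd x : bnd (bnd x) = 0.
Proof.
elim/chain_ind: x => [|v s|x y IHx IHy]; first by rewrite !linear0.
  have sd := homog_pure v s.
  case: (ltnP 1 (size s)) => [s_gt1|]; last first.
    case E: (size s) sd => [|[|n]] // sd _;
      first by rewrite (bnd_homog0 sd) linear0.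
    by rewrite (@bnd_homog0 (bnd _)) //; apply: bnd_homog.
  case E: (size s) (sd) => [|n] // sdn; first by rewrite E in s_gt1.
  rewrite (bndE (bnd_homog sdn)) (bndE sdn).
  under eq_bigr => i _ do rewrite linear_sum scaler_sumr.
  rewrite exchange_big /=.
  rewrite -[RHS](alt_sum_cancel (n := n.+1)
    (G := fun i j => dface i (dface j (pure v s)))).
    apply: eq_bigr => j _; apply: eq_bigr => i _.
    by rewrite linearZ scalerA mulrC.
  by move=> i j ij jn; rewrite dface_dface // E.
by rewrite !linearD IHx IHy addr0.
Qed.

End Faces.

Arguments dface {K A V} i.
Arguments bnd {K A V}.

(** * Isomorphisms of subquotients *)
Section Subquotients.
Variable K : comNzRingType.

(** An isomorphism ZU / BU ≅ ZW / BW, given by its graph on representatives.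
    Connecting homomorphisms are relations of this kind, and composing
    relations needs no choice of representatives. *)
Definition subquot_iso (U W : lmodType K) (ZU BU : U -> Prop) (ZW BW : W -> Prop) :=
  exists R : U -> W -> Prop,
  [/\ forall k x x' y y', R x y -> R x' y' -> R (k *: x + x') (k *: y + y'),
      forall x y, R x y -> ZU x /\ ZW y,
      forall x, ZU x -> exists y, R x y,
      forall y, ZW y -> exists x, R x y
    & forall x y, R x y -> (BU x <-> BW y)].

Lemma subquot_iso_sym (U W : lmodType K) (ZU BU : U -> Prop) (ZW BW : W -> Prop) :
  subquot_iso ZU BU ZW BW -> subquot_iso ZW BW ZU BU.
Proof.
case=> R [RP RZ RU RW RB]; exists (fun y x => R x y); split=> //.
- by move=> k x x' y y'; apply: RP.
- by move=> y x /RZ[].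
- by move=> y x /RB[].
Qed.

Lemma subquot_iso_trans (U V W : lmodType K) (ZU BU : U -> Prop) (ZV BV : V -> Prop)
    (ZW BW : W -> Prop) :
  subquot_iso ZU BU ZV BV -> subquot_iso ZV BV ZW BW -> subquot_iso ZU BU ZW BW.
Proof.
case=> R [RP RZ RU RV RB] [S [SP SZ SV SW SB]].
exists (fun x z => exists2 y, R x y & S y z); split.
- move=> k x x' z z' [y Rxy Syz] [y' Rxy' Syz'].
  by exists (k *: y + y'); [apply: RP | apply: SP].
- by move=> x z [y /RZ[? _] /SZ[_ ?]].
- move=> x /RU[y Rxy]; have [z Syz] := SV y (RZ _ _ Rxy).2.
  by exists z, y.
- move=> z /SW[y Syz]; have [x Rxy] := RV y (SZ _ _ Syz).1.
  by exists x, y.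
- move=> x z [y /RB Rxy /SB Syz]; exact: iff_trans Rxy Syz.
Qed.

Lemma subquot_iso_trivial (U W : lmodType K) (ZU BU : U -> Prop)
  (ZW BW : W -> Prop) :
  subquot_iso ZU BU ZW BW -> (forall x, ZU x -> BU x) -> forall y, ZW y -> BW y.
Proof.
case=> R [_ RZ _ RW RB] ZB y /RW[x Rxy].
by apply/(RB _ _ Rxy)/ZB; case: (RZ _ _ Rxy).
Qed.

Lemma subquot_iso_ext (U W : lmodType K) (ZU BU ZU' BU' : U -> Prop)
    (ZW BW ZW' BW' : W -> Prop) :
  subquot_iso ZU BU ZW BW -> (forall x, ZU x <-> ZU' x) ->
    (forall x, BU x <-> BU' x) ->
  (forall x, ZW x <-> ZW' x) -> (forall x, BW x <-> BW' x) ->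
  subquot_iso ZU' BU' ZW' BW'.
Proof.
case=> R [RP RZ RU RW RB] eZU eBU eZW eBW; exists R; split=> //.
- by move=> x y /RZ; rewrite eZU eZW.
- by move=> x; rewrite -eZU; apply: RU.
- by move=> x; rewrite -eZW; apply: RW.
- by move=> x y /RB; rewrite eBU eBW.
Qed.

Section Realize.
Variables (U0 U1 U2 W0 W1 W2 : lmodType K).
Variables (f : {linear U1 -> U0}) (d : {linear U2 -> U1}).
Variables (g : {linear W1 -> W0}) (e : {linear W2 -> W1}).

Lemma ker_quotP (U0' U1' U2' : lmodType K) (h : {linear U1' -> U0'})
    (c : {linear U2' -> U1'}) (x y : kermod h) :
  quot_proj (fun z : kermod h => exists y, c y = val z) x =
  quot_proj (fun z : kermod h => exists y, c y = val z) y <->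
  exists u, c u = val x - val y.
Proof.
rewrite quot_projP; split=> [/asboolP|[u cu]]; last first.
  by apply/asboolP => S _; apply; exists u; rewrite cu linearB.
pose S : {pred kermod h} := fun z => `[< exists u, c u = val z >].
move=> /(_ S); rewrite !unfold_in linearB => H; apply/asboolP.
apply: H => [|z [u cu]]; last by apply/asboolP; exists u.
split=> [|k z z']; rewrite !unfold_in.
  by apply/asboolP; exists 0; rewrite !linear0.
move=> /asboolP[u cu] /asboolP[u' cu']; apply/asboolP.
by exists (k *: u + u'); rewrite !linearP cu cu'.
Qed.

Lemma subquot_iso_lmod :
  subquot_iso (fun x => f x = 0) (fun x => exists y, d y = x)
        (fun x => g x = 0) (fun x => exists y, e y = x) ->
  lmod_iso (quotmod (fun z : kermod f => exists y, d y = val z))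
           (quotmod (fun z : kermod g => exists y, e y = val z)).
Proof.
case=> R [RP RZ RU RW RB].
have R0 : R 0 0.
  have [y Ry] := RU 0 (linear0 _).
  by have := RP (-1) _ _ _ _ Ry Ry; rewrite !scaleN1r !addNr.
have RBs k x y : R x y -> R (k *: x) (k *: y).
  by move=> Rxy; have := RP k _ _ _ _ Rxy R0; rewrite !addr0.
have Rsub x x' y y' : R x y -> R x' y' -> R (x - x') (y - y').
  by move=> Rxy Rxy'; have := RP (-1) _ _ _ _ Rxy' Rxy;
    rewrite !scaleN1r ![- _ + _]addrC.
pose PU := fun z : kermod f => exists y, d y = val z.
pose PW := fun z : kermod g => exists y, e y = val z.
have valf (z : kermod f) : f (val z) = 0 by apply/eqP; exact: (valP z).
have valg (z : kermod g) : g (val z) = 0 by apply/eqP; exact: (valP z).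
have ex (q : quotmod PU) : exists w : kermod g, R (val (repr q)) (val w).
  have [w Rw] := RU _ (valf (repr q)).
  have gw : w \in ker_pred g by apply/eqP; case: (RZ _ _ Rw).
  by exists (KerMod gw).
have [phi phiP] := choice ex.
pose F (q : quotmod PU) : quotmod PW := quot_proj PW (phi q).
have FE z w : R (val z) (val w) -> F (quot_proj PU z) = quot_proj PW w.
  move=> Rzw; apply/ker_quotP.
  have [u du] : exists u, d u = val (repr (quot_proj PU z)) - val z.
    by apply/ker_quotP; rewrite quot_projK.
  by apply/(RB _ _ (Rsub _ _ _ _ (phiP _) Rzw)); exists u.
have Flin : linear F.
  move=> k p q; rewrite -[p]quot_projK -[q]quot_projK -linearP.
  rewrite (FE _ (phi p)) // (FE _ (phi q)) // -linearP.
  by apply: FE; rewrite !linearP; apply: RP; apply: phiP.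
pose Fl := GRing.isLinear.Build K (quotmod PU) (quotmod PW) _ F Flin.
exists (HB.pack_for {linear quotmod PU -> quotmod PW} F Fl).
have exW (q : quotmod PW) : exists z : kermod f, R (val z) (val (repr q)).
  have [z Rz] := RW _ (valg (repr q)).
  have fz : z \in ker_pred f by apply/eqP; case: (RZ _ _ Rz).
  by exists (KerMod fz).
have [psi psiP] := choice exW.
exists (fun q => quot_proj PU (psi q)) => /= q; last first.
  by rewrite (FE _ (repr q)) ?quot_projK.
rewrite -[RHS]quot_projK; apply/ker_quotP.
apply/(RB _ (val (repr (F q)) - val (phi q))); first exact: Rsub.
by apply/ker_quotP; rewrite quot_projK.
Qed.

End Realize.
End Subquotients.

(** * Cycles, boundaries and dimension shifting *)
Section Morphisms.
Variables (K : comNzRingType) (A : algType K).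

Definition pb_hom (V W : prebimod A) (f : {linear V -> W}) :=
  (forall a v, f (plact a v) = plact a (f v)) /\
    (forall v a, f (pract v a) = pract (f v) a).

Lemma chain_map_bnd (V W : prebimod A) (f : {linear V -> W}) : pb_hom f ->
  forall x, chain_map A f (bnd x) = bnd (chain_map A f x).
Proof.
move=> [fl fr]; apply: (chain_ext (f := chain_map A f \o @bnd _ _ V)
  (g := @bnd _ _ W \o chain_map A f)) => v s /=.
rewrite chain_mapE !(bndE (homog_pure _ _)) linear_sum; apply: eq_bigr => i _.
rewrite linearZ !dface_pure; congr (_ *: _).
case: s i => [|a s] [[|i] ilt] /=; rewrite ?linear0 //.
  by rewrite chain_mapE fr.
by case: ifP; rewrite chain_mapE ?fl.
Qed.

Definition cycles (V : prebimod A) n (x : chain A V) := homog n x /\ bnd x = 0.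
Definition boundaries (V : prebimod A) n (x : chain A V) :=
  exists2 y, homog n.+1 y & bnd y = x.
Definition acyclic (V : prebimod A) n :=
  forall x : chain A V, cycles n x -> boundaries n x.

Section MorphismCycles.
Variables (V W : prebimod A) (f : {linear V -> W}) (fP : pb_hom f).

Lemma chain_map_cycles n x : cycles n x -> cycles n (chain_map A f x).
Proof.
case=> xd bx; split; first exact: chain_map_homog.
by rewrite -(chain_map_bnd fP) bx linear0.
Qed.

Lemma chain_map_boundaries n x : boundaries n x -> boundaries n (chain_map A f x).
Proof.
case=> y yd <-; exists (chain_map A f y); first exact: chain_map_homog.
by rewrite (chain_map_bnd fP).
Qed.

Lemma acyclic_retract (g : {linear W -> V}) n :
  pb_hom g -> cancel f g -> acyclic W n -> acyclic V n.
Proof.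
move=> gP fg aW x /chain_map_cycles/aW[y yd yx].
exists (chain_map A g y); first exact: chain_map_homog.
by rewrite -(chain_map_bnd gP) yx chain_map_comp chain_map_id.
Qed.

End MorphismCycles.

Lemma cyclesP (V : prebimod A) n k (x y : chain A V) : cycles n x -> cycles n y ->
  cycles n (k *: x + y).
Proof.
by case=> xd bx [yd byy]; split;
  [apply: homogP | rewrite linearP bx byy scaler0 addr0].
Qed.

Lemma boundaries0 (V : prebimod A) n : boundaries n (0 : chain A V).
Proof. by exists 0; [apply: homog0 | rewrite linear0]. Qed.

Lemma boundariesP (V : prebimod A) n k (x y : chain A V) : boundaries n x ->
  boundaries n y -> boundaries n (k *: x + y).
Proof.
case=> x' xd <- [y' yd <-].
by exists (k *: x' + y'); [apply: homogP | rewrite linearP].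
Qed.

Lemma boundariesD (V : prebimod A) n (x y : chain A V) : boundaries n x ->
  boundaries n y -> boundaries n (x + y).
Proof. by move=> Bx By; have := boundariesP 1 Bx By; rewrite scale1r. Qed.

Lemma boundariesB (V : prebimod A) n (x y : chain A V) : boundaries n x ->
  boundaries n y -> boundaries n (x - y).
Proof. by move=> Bx By; have := boundariesP (-1) By Bx; rewrite scaleN1r addrC. Qed.

Lemma prebimod_iso_homology (V W : prebimod A) (f : {linear V -> W})
  (g : {linear W -> V}) n :
  pb_hom f -> pb_hom g -> cancel f g -> cancel g f ->
  subquot_iso (@cycles V n) (@boundaries V n) (@cycles W n) (@boundaries W n).
Proof.
move=> fP gP fg gf; have cfg x : chain_map A g (chain_map A f x) = x.
  by rewrite chain_map_comp chain_map_id.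
have cgf x : chain_map A f (chain_map A g x) = x.
  by rewrite chain_map_comp chain_map_id.
exists (fun x y => cycles n x /\ chain_map A f x = y); split.
- move=> k x x' y y' [Zx <-] [Zx' <-].
  by split; [apply: cyclesP | rewrite linearP].
- by move=> x y [Zx <-]; split=> //; apply: chain_map_cycles.
- by move=> x Zx; exists (chain_map A f x).
- by move=> y Zy; exists (chain_map A g y); split; rewrite ?cgf //;
    apply: chain_map_cycles.
- move=> x y [Zx <-]; split; first exact: chain_map_boundaries.
  by move=> /(chain_map_boundaries gP); rewrite cfg.
Qed.

Section Shift.
Hypothesis projA : projective (A : lmodType K).
Variables (V' F V : prebimod A) (io : {linear V' -> F}) (pi : {linear F -> V}).
Hypotheses (ioP : pb_hom io) (piP : pb_hom pi) (io_inj : injective io).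
Hypothesis pi_surj : forall v, exists u, pi u = v.
Hypothesis io_pi : forall v, pi v = 0 <-> exists u, io u = v.

Local Notation Io := (chain_map A io).
Local Notation Pi := (chain_map A pi).

Let Io_inj : injective Io. Proof. exact: chain_map_inj. Qed.

Let PiIo x : Pi (Io x) = 0.
Proof.
rewrite chain_map_comp; elim/chain_ind: x => [|v s|x y IHx IHy].
- exact: linear0.
- rewrite chain_mapE /=; have -> : pi (io v) = 0 by apply/io_pi; exists v.
  exact: pure0.
- by rewrite linearD IHx IHy addr0.
Qed.

Let Pi_ker n x : homog n x -> Pi x = 0 -> exists2 y, homog n y & Io y = x.
Proof.
move=> xd Px; have ex v : pi v = 0 -> exists u, io u = v by move/io_pi.
have [y yx] := chain_map_exact projA ex Px.
by exists (deg_part n y); [apply: homog_deg_part | rewrite chain_map_deg_part yx].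
Qed.

(** The connecting homomorphism of the long exact sequence: z in V and w in V'
    correspond when a chain f of F lifts z and its boundary comes from w. As
    H_{n+1}(F) = 0, it identifies H_{n+1}(V) with the kernel of
    H_n(V') → H_n(F). *)
Lemma shift_iso n : acyclic F n.+1 ->
  subquot_iso (@cycles V n.+1) (@boundaries V n.+1)
        (fun w : chain A V' => cycles n w /\ boundaries n (Io w))
          (@boundaries V' n).
Proof.
move=> aF.
exists (fun z w => exists f, [/\ homog n.+1 f, Pi f = z & bnd f = Io w]); split.
- move=> k z z' w w' [f [fd <- fw]] [f' [fd' <- fw']].
  exists (k *: f + f'); split; rewrite ?linearP ?fw ?fw' //.
  exact: homogP.
- move=> z w [f [fd <- fw]]; split; last split.
  + split; first exact: chain_map_homog.
    by rewrite -(chain_map_bnd piP) fw PiIo.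
  + split.
      by apply: Io_inj; rewrite chain_map_deg_part -fw; apply: bnd_homog.
    by apply: Io_inj; rewrite (chain_map_bnd ioP) -fw bnd_bnd linear0.
  + by exists f.
- move=> z [zd bz]; have [f fd fz] := chain_map_surj_homog pi_surj zd.
  have [w wd wE] : exists2 w, homog n w & Io w = bnd f.
    by apply: Pi_ker; [apply: bnd_homog | rewrite (chain_map_bnd piP) fz].
  by exists w, f.
- by move=> w [_ [f fd fw]]; exists (Pi f), f.
- move=> z w [f [fd <- fw]]; split.
    (* If z bounds y, correct the lift f by the boundary of a lift of y. *)
    case=> y yd yz; have [g gd gy] := chain_map_surj_homog pi_surj yd.
    have [w' wd' wE'] : exists2 w', homog n.+1 w' & Io w' = f - bnd g.
      apply: Pi_ker; first by apply: homogB => //; apply: bnd_homog.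
      by rewrite linearB (chain_map_bnd piP) gy yz subrr.
    exists w' => //; apply: Io_inj.
    by rewrite (chain_map_bnd ioP) wE' linearB bnd_bnd subr0.
  case=> w' wd' wE.
  (* If w bounds w', then f - w' is a cycle of F, hence a boundary. *)
  have [|g gd gE] := aF (f - Io w').
    split; first by apply: homogB => //; apply: chain_map_homog.
    by rewrite linearB fw -(chain_map_bnd ioP) wE subrr.
  exists (Pi g); first exact: chain_map_homog.
  by rewrite -(chain_map_bnd piP) gE linearB PiIo subr0.
Qed.

Lemma shift_iso_pos n : acyclic F n -> acyclic F n.+1 ->
  subquot_iso (@cycles V n.+1) (@boundaries V n.+1) (@cycles V' n)
    (@boundaries V' n).
Proof.
move=> aF /shift_iso/subquot_iso_ext; apply=> // w; split=> [[]//|Zw].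
by split=> //; apply: aF; apply: chain_map_cycles.
Qed.

Lemma acyclic_quotient n : acyclic F n.+1 -> acyclic V' n -> acyclic V n.+1.
Proof.
move=> /shift_iso/subquot_iso_sym/subquot_iso_trivial H aV'.
by apply: H => w [/aV'].
Qed.

Lemma acyclic_kernel n : acyclic F n -> acyclic F n.+1 -> acyclic V n.+1 ->
  acyclic V' n.
Proof. by move=> aF /(shift_iso_pos aF)/subquot_iso_trivial; apply. Qed.

End Shift.
End Morphisms.

(** * The generalized trace *)
Section GeneralizedTrace.
Variables (K : comNzRingType) (B : algType K) (V : prebimod B) (X : finType).
Implicit Types (M N : X -> X -> B) (Ms : seq (X -> X -> B)) (sg : X -> X -> V).

(** The words M_1(x, z_1), M_2(z_1, z_2), ..., M_n(z_{n-1}, y) read off the index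
    paths from x to y: entry (x, y) of a product of the M_i in which the
    products are left formal. *)
Fixpoint path_words (x y : X) Ms : seq (seq B) :=
  if Ms is M :: Ms' then
    flatten [seq [seq M x z :: m | m <- path_words z y Ms'] | z <- index_enum X]
  else if x == y then [:: [::]] else [::].

Lemma path_words_nil (Z : nmodType) (phi : seq B -> Z) x y :
  \sum_(m <- path_words x y [::]) phi m = if x == y then phi [::] else 0.
Proof. by rewrite /=; case: ifP; rewrite ?big_seq1 ?big_nil. Qed.

Lemma path_words_cons (Z : nmodType) (phi : seq B -> Z) x y M Ms :
  \sum_(m <- path_words x y (M :: Ms)) phi m =
  \sum_z \sum_(m <- path_words z y Ms) phi (M x z :: m).
Proof. by rewrite big_flatten big_map; apply: eq_bigr => z _; rewrite big_map. Qed.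

Lemma sum_if_eq (Z : nmodType) (F : X -> Z) y :
  \sum_x (if x == y then F x else 0) = F y.
Proof. by rewrite -big_mkcond big_pred1_eq. Qed.

Lemma path_words_seq1 (Z : nmodType) (phi : seq B -> Z) x y M :
  \sum_(m <- path_words x y [:: M]) phi m = phi [:: M x y].
Proof.
rewrite path_words_cons; under eq_bigr do rewrite path_words_nil.
exact: (sum_if_eq (fun z => phi [:: M x z])).
Qed.

Lemma path_words_cat (Z : nmodType) (phi : seq B -> Z) x y Ms1 Ms2 :
  \sum_(m <- path_words x y (Ms1 ++ Ms2)) phi m =
  \sum_z \sum_(m1 <- path_words x z Ms1)
    \sum_(m2 <- path_words z y Ms2) phi (m1 ++ m2).
Proof.
elim: Ms1 x phi => [|M Ms1 IH] x phi.
  under [RHS]eq_bigr do rewrite path_words_nil eq_sym.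
  by rewrite (sum_if_eq (fun z => \sum_(m2 <- path_words z y Ms2) phi m2)).
rewrite cat_cons path_words_cons.
under [RHS]eq_bigr do rewrite path_words_cons.
rewrite exchange_big; apply: eq_bigr => z _.
exact: IH.
Qed.

Lemma path_words_size m x y Ms : m \in path_words x y Ms -> size m = size Ms.
Proof.
elim: Ms x m => [|M Ms IH] x m /=; first by case: ifP; rewrite // inE => _ /eqP ->.
by case/flatten_mapP => z _ /mapP[m' /IH e ->] /=; rewrite e.
Qed.

Arguments path_words : simpl never.

Definition matmul M N : X -> X -> B := fun x y => \sum_z M x z * N z y.
Definition matactl M sg : X -> X -> V := fun x y => \sum_z plact (M x z) (sg z y).
Definition matactr sg M : X -> X -> V := fun x y => \sum_z pract (sg x z) (M z y).
Definition mx_lin (U : lmodType K) k (M N : X -> X -> U) : X -> X -> U :=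
  fun x y => k *: M x y + N x y.

(** Σ σ(x_0, x_1) ⊗ M_1(x_1, x_2) ⊗ ... ⊗ M_n(x_n, x_0), over all closed index
    paths. *)
Definition gtrace sg Ms : chain B V :=
  \sum_x \sum_y \sum_(m <- path_words y x Ms) pure (sg x y) m.

Lemma gtrace_homog sg Ms : homog (size Ms) (gtrace sg Ms).
Proof.
do 2![apply: homog_sum => ? _]; rewrite /homog linear_sum.
apply: eq_big_seq => m /path_words_size <-; exact: homog_pure.
Qed.

Lemma gtrace_linl k sg sg' Ms : gtrace (mx_lin k sg sg') Ms = k *: gtrace sg Ms +
  gtrace sg' Ms.
Proof.
rewrite /gtrace; do 3![rewrite scaler_sumr -big_split; apply: eq_bigr => ? _ /=].
exact: pureV.
Qed.

Lemma gtrace_linr sg Ms1 Ms2 k M N : gtrace sg (Ms1 ++ mx_lin k M N :: Ms2) =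
  k *: gtrace sg (Ms1 ++ M :: Ms2) + gtrace sg (Ms1 ++ N :: Ms2).
Proof.
rewrite /gtrace; do 2![rewrite scaler_sumr -big_split; apply: eq_bigr => ? _ /=].
rewrite !path_words_cat; do 2![rewrite scaler_sumr -big_split;
  apply: eq_bigr => ? _ /=].
rewrite !path_words_cons; do 2![rewrite scaler_sumr -big_split;
  apply: eq_bigr => ? _ /=].
exact: pureA.
Qed.

(** Faces of a trace are traces: multiplying two adjacent tensor factors and
    summing over the index between them is a matrix product. For the last face
    the index in question is the one at which the path closes up. *)
Lemma gtrace_first sg M Ms : dface 0 (gtrace sg (M :: Ms)) =
  gtrace (matactr sg M) Ms.
Proof.
rewrite linear_sum; apply: eq_bigr => x _; rewrite linear_sum /=.
under eq_bigr => y _ do [rewrite path_words_cons linear_sum /=;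
  under eq_bigr => z _ do [rewrite linear_sum /=;
    under eq_bigr => m _ do rewrite dface_first]].
rewrite exchange_big; apply: eq_bigr => y _; rewrite exchange_big.
by apply: eq_bigr => m _; rewrite pure_sum.
Qed.

Lemma gtrace_mid sg Ms1 M N Ms2 n : n = (size Ms1).+1 ->
  dface n (gtrace sg (Ms1 ++ M :: N :: Ms2)) = gtrace sg (Ms1 ++ matmul M N :: Ms2).
Proof.
move=> nE; rewrite linear_sum; apply: eq_bigr => x _.
rewrite linear_sum; apply: eq_bigr => y _ /=.
rewrite !path_words_cat linear_sum; apply: eq_bigr => z _.
rewrite linear_sum; apply: eq_big_seq => m1 m1P /=.
rewrite !path_words_cons linear_sum /=.
under eq_bigr => t _ do rewrite path_words_cons linear_sum /=.
rewrite exchange_big; apply: eq_bigr => t _ /=.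
under eq_bigr => t' _ do rewrite linear_sum /=.
rewrite exchange_big; apply: eq_bigr => m2 _.
rewrite pureA_sum; apply: eq_bigr => t' _.
by rewrite dface_mid // nE (path_words_size m1P).
Qed.

Lemma gtrace_last sg Ms M n : n = (size Ms).+1 ->
  dface n (gtrace sg (rcons Ms M)) = gtrace (matactl M sg) Ms.
Proof.
move=> nE; rewrite linear_sum /=.
transitivity (\sum_x \sum_y \sum_z \sum_(m <- path_words y z Ms)
    pure (plact (M z x) (sg x y)) m).
  apply: eq_bigr => x _; rewrite linear_sum; apply: eq_bigr => y _ /=.
  rewrite -cats1 path_words_cat linear_sum; apply: eq_bigr => z _ /=.
  rewrite linear_sum; apply: eq_big_seq => m mP /=.
  by rewrite path_words_seq1 cats1 dface_last // nE (path_words_size mP).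
under eq_bigr do rewrite exchange_big.
rewrite exchange_big; apply: eq_bigr => z _.
rewrite exchange_big; apply: eq_bigr => y _ /=.
rewrite exchange_big; apply: eq_bigr => m _ /=.
by rewrite pure_sum.
Qed.

End GeneralizedTrace.

Arguments path_words {K B X} x y Ms : simpl never.

(** A representation by matrices, with rho(1) only an idempotent: a projective
    module is the image of such an idempotent. *)
Record matrep (K : comNzRingType) (A B : algType K) (X : finType) := Matrep {
  matrep_fun :> A -> X -> X -> B;
  matrepP : forall k a a', matrep_fun (k *: a + a') =
    mx_lin k (matrep_fun a) (matrep_fun a');
  matrepM : forall a b, matrep_fun (a * b) = matmul (matrep_fun a) (matrep_fun b) }.

Section TraceMap.
Variables (K : comNzRingType) (A B : algType K) (X : finType).
Variables (W : prebimod A) (V : prebimod B) (rho : matrep A B X).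

Record equivariant (tau : W -> X -> X -> V) : Prop := Equivariant {
  equivP : forall k w w', tau (k *: w + w') = mx_lin k (tau w) (tau w');
  equivl : forall a w, tau (plact a w) = matactl (rho a) (tau w);
  equivr : forall w a, tau (pract w a) = matactr (tau w) (rho a) }.

Variables (tau : W -> X -> X -> V) (tauP : equivariant tau).

Fact trace_map_multilin : multilin
  (fun w (s : seq A) => gtrace (tau w) (map rho s)).
Proof.
split=> [s k w w'|w s1 s2 k a a']; first by rewrite (equivP tauP) gtrace_linl.
by rewrite !map_cat /= matrepP gtrace_linr.
Qed.

Definition trace_map : {linear chain A W -> chain B V} :=
  chain_lift trace_map_multilin.

Lemma trace_map_pure w s : trace_map (pure w s) = gtrace (tau w) (map rho s).
Proof. exact: chain_liftE. Qed.

Lemma dface_nil (C : algType K) (U : prebimod C) i (u : U) : dface i (pure u [::]) =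
  0.
Proof. by rewrite dface_pure; case: i. Qed.

Lemma dface_homog0 (C : algType K) (U : prebimod C) i (x : chain C U) : homog 0 x ->
  dface i x = 0.
Proof.
elim/homog_ind: x / => [|v s|x y IHx IHy]; first exact: linear0.
- by case: s => // _; rewrite dface_nil.
- by rewrite linearD IHx IHy addr0.
Qed.

Lemma trace_map_dface i w s : (i <= size s)%N ->
  dface i (trace_map (pure w s)) = trace_map (dface i (pure w s)).
Proof.
move=> ile; rewrite trace_map_pure; case: (posnP (size s)) => [/size0nil ->|s_gt0].
  by rewrite dface_nil dface_homog0 ?linear0 //; apply: gtrace_homog.
have iv := faceP ile s_gt0; case: i s / iv {ile s_gt0} => [a s|s1 a b s2|s z].
- by rewrite dface_first trace_map_pure /= gtrace_first (equivr tauP).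
- by rewrite dface_mid // trace_map_pure !map_cat /= gtrace_mid ?size_map //
    matrepM.
- by rewrite dface_last // trace_map_pure map_rcons gtrace_last ?size_map //
    (equivl tauP).
Qed.

Lemma trace_map_homog n x : homog n x -> homog n (trace_map x).
Proof.
elim/homog_ind: x / => [|v s <-|x y IHx IHy].
- by rewrite linear0; apply: homog0.
- by rewrite trace_map_pure -(size_map rho); apply: gtrace_homog.
- by rewrite linearD; apply: homogD.
Qed.

Lemma trace_map_bnd x : trace_map (bnd x) = bnd (trace_map x).
Proof.
apply: (chain_ext (f := trace_map \o bnd) (g := bnd \o trace_map)) => w s /=.
have gd := homog_pure w s; rewrite (bndE gd) (bndE (trace_map_homog gd)) linear_sum.
by apply: eq_bigr => i _; rewrite linearZ trace_map_dface // -ltnS.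
Qed.

Lemma trace_map_cycles n x : cycles n x -> cycles n (trace_map x).
Proof.
case=> xd bx; split; first exact: trace_map_homog.
by rewrite -trace_map_bnd bx linear0.
Qed.

Lemma trace_map_boundaries n x : boundaries n x -> boundaries n (trace_map x).
Proof.
case=> y yd <-; exists (trace_map y); rewrite ?trace_map_bnd //.
exact: trace_map_homog.
Qed.

End TraceMap.

(** * Homotopy invariance of the trace *)

(** The combinatorics of a presimplicial homotopy, with G i k for d_i h_k and
    L i k for h_k d_i. Off the diagonal the two families cancel; the terms
    d_k h_k and d_{k+1} h_k telescope, and only the two extreme ones are left. *)
Lemma alt_sum_htpy (K : comNzRingType) (Z : lmodType K) (G L : nat -> nat -> Z) n :
  (forall i k, (i < k)%N -> (k <= n)%N -> G i k = L i k.-1) ->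
  (forall i k, (k.+1 < i)%N -> (i <= n.+1)%N -> G i k = L i.-1 k) ->
  (forall k, (k < n)%N -> G k.+1 k = G k.+1 k.+1) ->
  \sum_(i < n.+2) \sum_(k < n.+1) ((-1) ^+ i * (-1) ^+ k : K) *: G i k +
  \sum_(i < n.+1) \sum_(k < n) ((-1) ^+ i * (-1) ^+ k : K) *: L i k =
  G 0 0 - G n.+1 n.
Proof.
elim: n => [|n IH] Glt Ggt Gdiag.
  rewrite [X in _ + X]big1 ?addr0 => [|i _]; last by rewrite big_ord0.
  by rewrite !big_ord_recr !big_ord0 /= !mulr1 !add0r expr1 scale1r scaleN1r.
have {}IH := IH (fun i k ik kn => Glt i k ik (leqW kn))
  (fun i k ki ni => Ggt i k ki (leqW ni)) (fun k kn => Gdiag k (leqW kn)).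
rewrite big_ord_recr /=; under eq_bigr do rewrite big_ord_recr /=.
rewrite big_split /=.
rewrite [X in _ + X = _]big_ord_recr /=.
under [X in _ + (X + _) = _]eq_bigr do rewrite big_ord_recr /=.
rewrite [X in _ + (X + _) = _]big_split /=.
rewrite [X in _ + X + _ + _ = _]big_ord_recr.
rewrite [X in _ + X + (_ + _ + _) = _]big_ord_recr /=.
(* X and Y are the sums of the previous rank. Of the new terms, the column
   k = n + 1 of G cancels Q, the row i = n + 2 cancels P, the entry at
   (n + 1, n + 1) cancels the end of the previous telescope, and the entry at
   (n + 2, n + 1) is the new end. *)
set X := \sum_(i < n.+2) _ in IH *; set Y := \sum_(i < n.+1) \sum_(k < n) _ in IH *.
set Q := \sum_(i < n.+1) _ *: L i n; set P := \sum_(k < n.+1) _ *: L _ k.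
have -> : \sum_(i < n.+1) ((-1) ^+ i * (-1) ^+ n.+1 : K) *: G i n.+1 = - Q.
  rewrite -sumrN; apply: eq_bigr => i _.
  by rewrite (Glt i n.+1) //= exprSr mulrA mulrN1 scaleNr.
have -> : \sum_(k < n.+1) ((-1) ^+ n.+2 * (-1) ^+ k : K) *: G n.+2 k = - P.
  rewrite -sumrN; apply: eq_bigr => k _.
  by rewrite exprSr (Ggt n.+2 k (ltn_ord k) (leqnn _)) mulrN1 mulNr scaleNr.
rewrite -(Gdiag n) //.
have -> : ((-1) ^+ n.+1 * (-1) ^+ n.+1 : K) = 1.
  by rewrite -exprMn mulrN1 opprK expr1n.
have -> : ((-1) ^+ n.+2 * (-1) ^+ n.+1 : K) = -1.
  by rewrite exprSr mulrN1 mulNr -exprMn mulrN1 opprK expr1n.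
rewrite scale1r scaleN1r.
set g := G n.+1 n; set h := G n.+2 n.+1.
have -> : X + (- Q + g) + (- P - h) + (Y + Q + P) = X + Y + g - h.
  by rewrite !addrA (ACl (1*6*3*5*(2*7)*(4*8))%AC) /= !addNr !addr0.
by rewrite IH subrK.
Qed.

Section TraceHomotopy.
Variables (K : comNzRingType) (A B : algType K) (X : finType).
Variables (W : prebimod A) (V : prebimod B) (rho : matrep A B X).
Variables (u : X -> X -> B) (sg : W -> X -> X -> V).
Hypothesis rho_u : forall a, matmul (rho a) u = matmul u (rho a).
Hypothesis sgP : equivariant rho sg.

Fact insert_multilin k : multilin (fun w (s : seq A) =>
  gtrace (sg w) (map rho (take k s) ++ u :: map rho (drop k s))).
Proof.
split=> [s c w w'|w s1 s2 c a a']; first by rewrite (equivP sgP) gtrace_linl.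
rewrite !take_cat !drop_cat; case: ltnP => _.
  by rewrite !map_cat /= matrepP -!cat_cons !catA gtrace_linr.
case: (k - size s1)%N => [|d] /=;
  first by rewrite matrepP -!(cat_rcons u) gtrace_linr.
by rewrite !map_cat /= matrepP -!catA /= gtrace_linr.
Qed.

(** The operator h_k of the homotopy between tr(σu) and tr(uσ). *)
Definition insert k : {linear chain A W -> chain B V} :=
  chain_lift (insert_multilin k).

Lemma insert_pure k w s1 s2 : k = size s1 ->
  insert k (pure w (s1 ++ s2)) = gtrace (sg w) (map rho s1 ++ u :: map rho s2).
Proof.
by move=> ->; rewrite /insert chain_liftE take_size_cat // drop_size_cat.
Qed.

Variables (tau1 tau2 : W -> X -> X -> V).
Hypotheses (tau1P : equivariant rho tau1) (tau2P : equivariant rho tau2).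
Hypothesis tau1E : forall w, tau1 w = matactr (sg w) u.
Hypothesis tau2E : forall w, tau2 w = matactl u (sg w).

Lemma dface_insert_lt i k w s : (i < k)%N -> (k <= size s)%N ->
  dface i (insert k (pure w s)) = insert k.-1 (dface i (pure w s)).
Proof.
move=> ik ks; rewrite -(cat_take_drop k s).
have := size_takel ks; move: (take k s) (drop k s) => s1 s2 sz.
rewrite -sz in ik *; rewrite insert_pure // {k ks sz s}.
have iv := faceP (ltnW ik) (leq_ltn_trans (leq0n i) ik).
case: i s1 / iv ik => [a s _|p a b q _|p z].
- by rewrite dface_first /= gtrace_first -(equivr sgP) insert_pure.
- rewrite -catA /= dface_mid // map_cat /= -catA /= gtrace_mid ?size_map //.
  rewrite -[in RHS]cat_cons [in RHS]catA insert_pure ?size_cat /= ?addnS //.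
  by rewrite map_cat /= matrepM -catA.
- by rewrite size_rcons ltnn.
Qed.

Lemma dface_insert_gt i k w s : (k.+1 < i)%N -> (i <= (size s).+1)%N ->
  dface i (insert k (pure w s)) = insert k (dface i.-1 (pure w s)).
Proof.
move=> ki isz; have ks : (k <= size s)%N.
  by rewrite -ltnS (leq_trans (ltnW ki)).
rewrite -(cat_take_drop k s); rewrite -(size_takel ks) in ki.
have := size_takel ks; have := size_drop k s.
move: (take k s) (drop k s) ki => s1 s2 ki sz2 sz1.
have [j iE] : exists j, i = (j + (size s1).+2)%N.
  by exists (i - (size s1).+2)%N; rewrite subnK.
have jle : (j.+1 <= size s2)%N.
  by lia.
rewrite -sz1 {sz1 sz2 ks isz ki} iE addnS /= insert_pure //.
have jv := faceP jle (leq_trans (ltn0Sn j) jle).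
move: jv {jle}; move E : j.+1 => j1 jv.
case: j1 s2 / jv E => [//|p a b q|p z] [->].
- rewrite addnS catA dface_mid ?size_cat 1?addnC //.
  rewrite -catA insert_pure // !map_cat /= -cat_cons catA.
  rewrite gtrace_mid ?size_cat /= ?size_map ?addnS 1?addnC ?addSn //.
  by rewrite -catA /= matrepM.
- rewrite addnS -rcons_cat dface_last ?size_cat 1?addnC // insert_pure //.
  rewrite map_rcons -rcons_cons -rcons_cat gtrace_last;
    first by rewrite (equivl sgP).
  by rewrite size_cat /= !size_map; lia.
Qed.

(** The face between u and its neighbour sees rho(a) u on one side and u rho(a)
    on the other, and these are equal. *)
Lemma dface_insert_diag k w s : (k < size s)%N ->
  dface k.+1 (insert k (pure w s)) = dface k.+1 (insert k.+1 (pure w s)).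
Proof.
move=> ks; rewrite -(cat_take_drop k s) (drop_nth 0 ks).
have := size_takel (ltnW ks).
move: (take k s) (nth 0 s k) (drop k.+1 s) => s1 a s2 <- {k ks s}.
rewrite (insert_pure _ (a :: s2)) // gtrace_mid ?size_map //=.
rewrite -(cat_rcons a s1) insert_pure ?size_rcons // map_rcons cat_rcons.
by rewrite gtrace_mid ?size_map // rho_u.
Qed.

Lemma dface_insert_first w s : dface 0 (insert 0 (pure w s)) =
  trace_map tau1P (pure w s).
Proof.
by rewrite (insert_pure w (s1 := [::]) s) // gtrace_first trace_map_pure tau1E.
Qed.

Lemma dface_insert_last n w s : size s = n ->
  dface n.+1 (insert n (pure w s)) = trace_map tau2P (pure w s).
Proof.
move=> sz; rewrite -{1}(cats0 s) insert_pure //= cats1 gtrace_last ?size_map ?sz //.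
by rewrite trace_map_pure tau2E.
Qed.

Definition trace_htpy n (x : chain A W) : chain B V :=
  \sum_(k < n.+1) (-1) ^+ k *: insert k x.

Lemma insert_homog n k x : homog n x -> homog n.+1 (insert k x).
Proof.
elim/homog_ind: x / => [|v s <-|x y IHx IHy].
- by rewrite linear0; apply: homog0.
- rewrite /insert chain_liftE; set Ms := _ ++ _.
  have <- : size Ms = (size s).+1; last exact: gtrace_homog.
  by rewrite size_cat /= !size_map addnS -size_cat cat_take_drop.
- by rewrite linearD; apply: homogD.
Qed.

Lemma bnd_htpy n x : homog n x ->
  bnd (trace_htpy n x) + \sum_(k < n) (-1) ^+ k *: insert k (bnd x) =
  trace_map tau1P x - trace_map tau2P x.
Proof.
move=> xd; elim/homog_ind: x / xd => [|w s sz|x y IHx IHy].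
- have h0 : trace_htpy n 0 = 0 by apply: big1 => k _; rewrite linear0 scaler0.
  rewrite h0 !linear0 !add0r.
  by apply: big1 => k _; rewrite linear0 scaler0.
- have gd := homog_pure w s; rewrite sz in gd.
  have hd : homog n.+1 (trace_htpy n (pure w s)).
    by apply: homog_sum => k _; apply: homogZ; apply: insert_homog.
  rewrite (bndE hd) (bndE gd).
  under eq_bigr do rewrite linear_sum scaler_sumr.
  under [X in _ + X]eq_bigr do rewrite linear_sum scaler_sumr.
  rewrite [X in _ + X]exchange_big {hd} /=.
  rewrite -dface_insert_first -(dface_insert_last w sz).
  rewrite -(alt_sum_htpy (G := fun i k => dface i (insert k (pure w s)))
    (L := fun i k => insert k (dface i (pure w s)))).
  + congr (_ + _).
      apply: eq_bigr => i _; apply: eq_bigr => k _.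
      by rewrite linearZ scalerA.
    apply: eq_bigr => i _; apply: eq_bigr => k _.
    by rewrite linearZ scalerA [X in X *: _ = _]mulrC.
  + by move=> i k ik kn; rewrite dface_insert_lt ?sz.
  + by move=> i k ik kn; rewrite dface_insert_gt ?sz.
  + by move=> k kn; rewrite dface_insert_diag ?sz.
- have hD : trace_htpy n (x + y) = trace_htpy n x + trace_htpy n y.
    by rewrite /trace_htpy -big_split; apply: eq_bigr => k _;
      rewrite linearD scalerDr.
  rewrite hD !linearD /= addrACA -IHx -IHy [RHS]addrACA; congr (_ + _).
  by rewrite -big_split; apply: eq_bigr => k _; rewrite linearD scalerDr.
Qed.

(** The trace property tr(σu) = tr(uσ), up to homotopy: the first face of h_0
    multiplies u into σ from the right, the last face of h_n from the left. *)
Theorem trace_map_cyclic n x : cycles n x ->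
  boundaries n (trace_map tau1P x - trace_map tau2P x).
Proof.
case=> xd bx; exists (trace_htpy n x).
  by apply: homog_sum => k _; apply: homogZ; apply: insert_homog.
rewrite -(bnd_htpy xd) big1 ?addr0 // => k _.
by rewrite bx linear0 scaler0.
Qed.

End TraceHomotopy.

(** * Transfers along matrix representations *)
Section BimodChains.
Variables (K : comNzRingType) (A : algType K) (M : bimod A A).

Definition bimod_pb : prebimod A.
Proof.
exists (M : lmodType K) (@lact _ _ _ M) (@ract _ _ _ M).
- by move=> k a a' v; rewrite lactDl lactZl.
- by move=> a k v v'; rewrite lactDr lactZr.
- by move=> v k a a'; rewrite ractDr ractZr.
- by move=> k v v' a; rewrite ractDl ractZl.
- exact: lactM.
- exact: ractM.
- exact: lractA.
Defined.

End BimodChains.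

Notation regular_pb A := (bimod_pb (regular_bimod A)).

Section Transfer.
Variables (K : comNzRingType) (A B : algType K) (X : finType) (rho : matrep A B X).

Lemma matrep_bigsum (U : Type) (r : seq U) (F : U -> A) x y :
  rho (\sum_(i <- r) F i) x y = \sum_(i <- r) rho (F i) x y.
Proof.
have rho0 : rho 0 x y = 0.
  by have := congr1 (fun f => f x y) (matrepP rho (-1) 0 0);
    rewrite /mx_lin !scaleN1r !addNr.
elim: r => [|i r IH]; rewrite ?big_nil // !big_cons -IH.
have := congr1 (fun f => f x y) (matrepP rho 1 (F i) (\sum_(j <- r) F j)).
by rewrite /mx_lin !scale1r.
Qed.

Fact matrep_equivariant : @equivariant _ _ _ _ (regular_pb A)
  (regular_pb B) rho rho.
Proof. by split=> [*|*|*]; rewrite ?matrepP ?matrepM. Qed.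

Definition transfer : {linear chain A (regular_pb A) -> chain B (regular_pb B)} :=
  trace_map matrep_equivariant.

Lemma transfer_gen a s :
  transfer (pure a s) = gtrace (rho a : X -> X -> regular_pb B) (map rho s).
Proof. exact: trace_map_pure. Qed.

End Transfer.

(** Transfers compose strictly: a path in I × J is a path in I together with a
    path in J above it. *)
Section Composition.
Variables (K : comNzRingType) (A B C : algType K) (I J : finType).
Variables (rho : matrep A B I) (rho' : matrep B C J).

Definition matrep_comp : matrep A C (I * J)%type.
Proof.
exists (fun a p q => rho' (rho a p.1 q.1) p.2 q.2).
- move=> k a a'; apply/funext => p; apply/funext => q.
  by rewrite matrepP /mx_lin matrepP.
- move=> a b; apply/funext => p; apply/funext => q.
  rewrite matrepM /matmul matrep_bigsum.
  under eq_bigr do rewrite matrepM /matmul.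
  by rewrite pair_bigA.
Defined.

Lemma path_words_comp (Z : nmodType) (phi : seq C -> Z) x x' z z' s :
  \sum_(m <- path_words x x' (map rho s))
    \sum_(m' <- path_words z z' (map rho' m)) phi m' =
  \sum_(m' <- path_words (x, z) (x', z') (map matrep_comp s)) phi m'.
Proof.
elim: s x z phi => [|a s IH] x z phi /=.
  by rewrite !path_words_nil xpair_eqE; case: eqP => //= _; rewrite path_words_nil.
rewrite !path_words_cons.
transitivity (\sum_y \sum_t \sum_(m <- path_words y x' (map rho s))
    \sum_(m' <- path_words t z' (map rho' m)) phi (rho' (rho a x y) z t :: m')).
  apply: eq_bigr => y _; rewrite exchange_big; apply: eq_bigr => m _.
  by rewrite path_words_cons.
by rewrite pair_bigA; apply: eq_bigr => -[y t] _; rewrite IH.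
Qed.

Lemma transfer_comp x :
  transfer matrep_comp x = transfer rho' (transfer rho x).
Proof.
apply: (chain_ext (f := transfer matrep_comp) (g := transfer rho' \o transfer rho)).
move=> a s /=; rewrite !transfer_gen /gtrace linear_sum.
transitivity (\sum_x \sum_z \sum_q
  \sum_(m <- path_words q (x, z) (map matrep_comp s))
     pure (matrep_comp a (x, z) q : regular_pb C) m).
  by rewrite [RHS]pair_bigA; apply: eq_bigr => -[].
apply: eq_bigr => {}x _ /=.
rewrite linear_sum.
transitivity (\sum_y \sum_z \sum_t
  \sum_(m <- path_words (y, t) (x, z) (map matrep_comp s))
     pure (matrep_comp a (x, z) (y, t) : regular_pb C) m).
  rewrite [RHS]exchange_big; apply: eq_bigr => z _ /=.
  by rewrite [RHS]pair_bigA; apply: eq_bigr => -[].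
apply: eq_bigr => y _; rewrite linear_sum /=.
transitivity (\sum_(m <- path_words y x (map rho s)) \sum_z \sum_t
    \sum_(m' <- path_words t z (map rho' m))
      pure (rho' (rho a x y) z t : regular_pb C) m').
  rewrite [RHS]exchange_big; apply: eq_bigr => z _ /=.
  rewrite [RHS]exchange_big; apply: eq_bigr => t _ /=.
  by rewrite -path_words_comp.
by apply: eq_bigr => m _; rewrite transfer_gen.
Qed.

End Composition.

(** For a block triangular representation a closed path never leaves its
    diagonal block, since it could not come back. So the trace is the sum of the
    traces of the diagonal blocks, on chains and not just up to homotopy. *)
Section Blocks.
Variables (K : comNzRingType) (A B : algType K) (I J : finType).
Variables (V : prebimod B) (rho : matrep A B (I + J)%type).
Variables (rho1 : matrep A B I) (rho2 : matrep A B J).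
Hypothesis rho11 : forall a i i', rho a (inl i) (inl i') = rho1 a i i'.
Hypothesis rho22 : forall a j j', rho a (inr j) (inr j') = rho2 a j j'.
Hypothesis rho21 : forall a j i, rho a (inr j) (inl i) = 0.

Section Paths.
Variables (Z : zmodType).

Lemma path_words_block21 (phi : seq B -> Z) s j i :
  (forall m1 m2, phi (m1 ++ 0 :: m2) = 0) ->
  \sum_(m <- path_words (inr j) (inl i) (map rho s)) phi m = 0.
Proof.
elim: s phi j => [|a s IH] phi j phi0; first by rewrite path_words_nil.
rewrite path_words_cons big_sumType /= big1 ?add0r => [|z _].
  by rewrite big1 // => z _; apply: IH => m1 m2; apply: (phi0 (_ :: _)).
by rewrite rho21 big1 // => m _; apply: (phi0 [::]).
Qed.

Lemma path_words_block11 (phi : seq B -> Z) s i i' :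
  (forall m1 m2, phi (m1 ++ 0 :: m2) = 0) ->
  \sum_(m <- path_words (inl i) (inl i') (map rho s)) phi m =
  \sum_(m <- path_words i i' (map rho1 s)) phi m.
Proof.
elim: s phi i => [|a s IH] phi i phi0; first by rewrite !path_words_nil.
have phi0' b m1 m2 : phi (b :: m1 ++ 0 :: m2) = 0 by apply: (phi0 (_ :: _)).
rewrite !path_words_cons big_sumType /= [X in _ + X]big1 ?addr0 => [|z _].
  by apply: eq_bigr => z _; rewrite rho11; apply: IH => m1 m2; apply: phi0'.
by apply: path_words_block21 => m1 m2; apply: phi0'.
Qed.

Lemma path_words_block22 (phi : seq B -> Z) s j j' :
  (forall m1 m2, phi (m1 ++ 0 :: m2) = 0) ->
  \sum_(m <- path_words (inr j) (inr j') (map rho s)) phi m =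
  \sum_(m <- path_words j j' (map rho2 s)) phi m.
Proof.
elim: s phi j => [|a s IH] phi j phi0; first by rewrite !path_words_nil.
have phi0' b m1 m2 : phi (b :: m1 ++ 0 :: m2) = 0 by apply: (phi0 (_ :: _)).
rewrite !path_words_cons big_sumType /= big1 ?add0r => [|z _].
  by apply: eq_bigr => z _; rewrite rho22; apply: IH => m1 m2; apply: phi0'.
by rewrite rho21 big1 // => m _; apply: (phi0 [::]).
Qed.

End Paths.

Lemma gtrace_block (sg : I + J -> I + J -> V) s :
  (forall j i, sg (inr j) (inl i) = 0) ->
  gtrace sg (map rho s) =
  gtrace (fun i i' => sg (inl i) (inl i')) (map rho1 s) +
  gtrace (fun j j' => sg (inr j) (inr j')) (map rho2 s).
Proof.
move=> sg21; rewrite /gtrace big_sumType /=; congr (_ + _).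
  apply: eq_bigr => i _; rewrite big_sumType /= [X in _ + X]big1 ?addr0 => [|j _].
    by apply: eq_bigr => i' _; apply: path_words_block11 => *; apply: pureA0.
  by apply: path_words_block21 => *; apply: pureA0.
apply: eq_bigr => j _; rewrite big_sumType /= big1 ?add0r => [|i _].
  by apply: eq_bigr => i' _; apply: path_words_block22 => *; apply: pureA0.
by rewrite sg21 big1 // => m _; apply: pure0.
Qed.

End Blocks.

Lemma transfer_block (K : comNzRingType) (A B : algType K) (I J : finType)
    (rho : matrep A B (I + J)%type) (rho1 : matrep A B I) (rho2 : matrep A B J) :
  (forall a i i', rho a (inl i) (inl i') = rho1 a i i') ->
  (forall a j j', rho a (inr j) (inr j') = rho2 a j j') ->
  (forall a j i, rho a (inr j) (inl i) = 0) ->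
  forall x, transfer rho x = transfer rho1 x + transfer rho2 x.
Proof.
move=> r11 r22 r21; elim/chain_ind=> [|a s|x y IHx IHy].
- by rewrite !linear0 addr0.
- rewrite !transfer_gen (gtrace_block (V := regular_pb B) r11 r22 r21 _ (r21 a)).
  have e1 : (fun i i' => rho a (inl i) (inl i')) = rho1 a.
    by apply/funext => i; apply/funext => i'; rewrite r11.
  have e2 : (fun j j' => rho a (inr j) (inr j')) = rho2 a.
    by apply/funext => j; apply/funext => j'; rewrite r22.
  by rewrite e1 e2.
- by rewrite !linearD IHx IHy addrACA.
Qed.

(** Here u and v intertwine rho and rho', and are inverse to each other up to
    the idempotents rho(1) and rho'(1). On I + J let U be the matrix with the
    single block u and S(w) the one with the single block v rho(w). Then
    U S(w) = rho(w), S(w) U = rho'(w) blockwise, and U commutes with the diagonal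
    representation: the trace property gives that the two transfers agree. *)
Section Conjugation.
Variables (K : comNzRingType) (A B : algType K) (I J : finType).
Variables (rho : matrep A B I) (rho' : matrep A B J).
Variables (u : I -> J -> B) (v : J -> I -> B).
Hypothesis rho_u : forall a i j,
  \sum_k rho a i k * u k j = \sum_l u i l * rho' a l j.
Hypothesis v_rho : forall a j k,
  \sum_i v j i * rho a i k = \sum_l rho' a j l * v l k.
Hypothesis v_rho_u : forall a j j',
  \sum_k (\sum_i v j i * rho a i k) * u k j' = rho' a j j'.
Hypothesis u_v_rho : forall a i k,
  \sum_j u i j * (\sum_l v j l * rho a l k) = rho a i k.

Definition bdiag (M : I -> I -> B) (N : J -> J -> B) (x y : I + J) : B :=
  match x, y with
  | inl i, inl i' => M i i'
  | inr j, inr j' => N j j'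
  | _, _ => 0
  end.

Definition matrep_diag : matrep A B (I + J)%type.
Proof.
exists (fun a => bdiag (rho a) (rho' a)).
- move=> k a a'; apply/funext => -[x|x]; apply/funext => -[y|y];
  by rewrite /mx_lin /= ?matrepP // scaler0 addr0.
- move=> a b; apply/funext => -[x|x]; apply/funext => -[y|y];
  rewrite /matmul big_sumType /= ?matrepM.
  + by rewrite [X in _ + X]big1 ?addr0 // => j _; rewrite mul0r.
  + by rewrite !big1 ?addr0 // => i _; rewrite ?mul0r ?mulr0.
  + by rewrite !big1 ?addr0 // => i _; rewrite ?mul0r ?mulr0.
  + by rewrite big1 ?add0r // => j _; rewrite mul0r.
Defined.

Let U (x y : I + J) : B :=
  match x, y with inl i, inr j => u i j | _, _ => 0 end.
Let S (w : A) (x y : I + J) : B :=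
  match x, y with inr j, inl k => \sum_i v j i * rho w i k | _, _ => 0 end.

Let sum0 (X : finType) (F : X -> B) : (forall x, F x = 0) -> \sum_x F x = 0.
Proof. by move=> F0; apply: big1. Qed.

Let RU a : matmul (matrep_diag a) U = matmul U (matrep_diag a).
Proof.
apply/funext => -[x|x]; apply/funext => -[y|y]; rewrite /matmul !big_sumType /=.
- by rewrite !sum0 // => z; rewrite ?mulr0 ?mul0r.
- rewrite [X in _ + X]sum0 => [|z]; last by rewrite mulr0.
  rewrite [X in _ = X + _]sum0 => [|z]; last by rewrite mul0r.
  by rewrite addr0 add0r.
- by rewrite !sum0 // => z; rewrite ?mulr0 ?mul0r.
- by rewrite !sum0 // => z; rewrite ?mulr0 ?mul0r.
Qed.

Let sum_mulA (X Y : finType) (f : X -> B) (g : X -> Y -> B) (h : Y -> B) :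
  \sum_x f x * (\sum_y g x y * h y) = \sum_y (\sum_x f x * g x y) * h y.
Proof.
under eq_bigr do rewrite mulr_sumr.
rewrite exchange_big; apply: eq_bigr => y _ /=; rewrite mulr_suml.
by apply: eq_bigr => x _; rewrite mulrA.
Qed.

Let SP : @equivariant _ _ _ _ (regular_pb A) (regular_pb B) matrep_diag S.
Proof.
split=> [k w w'|a w|w a]; apply/funext => -[x|x]; apply/funext => -[y|y];
  rewrite /mx_lin /matactl /matactr ?big_sumType /=.
- by rewrite scaler0 addr0.
- by rewrite scaler0 addr0.
- rewrite scaler_sumr -big_split; apply: eq_bigr => i _ /=.
  by rewrite matrepP mulrDr scalerAr.
- by rewrite scaler0 addr0.
- by rewrite !sum0 ?addr0 // => z; rewrite ?mulr0 ?mul0r.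
- by rewrite !sum0 ?addr0 // => z; rewrite ?mulr0 ?mul0r.
- rewrite [X in _ = X + _]sum0 ?add0r => [|z]; last by rewrite mul0r.
  rewrite [RHS]sum_mulA; under [RHS]eq_bigr do rewrite -v_rho.
  by rewrite -sum_mulA; apply: eq_bigr => i _; rewrite matrepM.
- by rewrite !sum0 ?addr0 // => z; rewrite ?mulr0 ?mul0r.
- by rewrite !sum0 ?addr0 // => z; rewrite ?mulr0 ?mul0r.
- by rewrite !sum0 ?addr0 // => z; rewrite ?mulr0 ?mul0r.
- rewrite [X in _ + X]sum0 ?addr0 => [|z]; last by rewrite mulr0.
  by rewrite -sum_mulA; apply: eq_bigr => i _; rewrite matrepM.
- by rewrite !sum0 ?addr0 // => z; rewrite ?mulr0 ?mul0r.
Qed.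

Let zero_equivariant1 :
  @equivariant _ _ _ _ (regular_pb A) (regular_pb B) matrep_diag
    (fun w => bdiag (rho w) (fun _ _ => 0)).
Proof.
split=> [k w w'|a w|w a]; apply/funext => -[x|x]; apply/funext => -[y|y];
  rewrite /mx_lin /matactl /matactr ?big_sumType /= ?scaler0 ?addr0 ?matrepP
    ?matrepM //=.
- by rewrite [X in _ + X]sum0 ?addr0 // => z; rewrite mul0r.
- by rewrite !sum0 ?addr0 // => z; rewrite ?mulr0 ?mul0r.
- by rewrite !sum0 ?addr0 // => z; rewrite ?mulr0 ?mul0r.
- by rewrite !sum0 ?addr0 // => z; rewrite ?mulr0 ?mul0r.
- by rewrite [X in _ + X]sum0 ?addr0 // => z; rewrite mul0r.
- by rewrite !sum0 ?addr0 // => z; rewrite ?mulr0 ?mul0r.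
- by rewrite !sum0 ?addr0 // => z; rewrite ?mulr0 ?mul0r.
- by rewrite !sum0 ?addr0 // => z; rewrite ?mulr0 ?mul0r.
Qed.

Let zero_equivariant2 :
  @equivariant _ _ _ _ (regular_pb A) (regular_pb B) matrep_diag
    (fun w => bdiag (fun _ _ => 0) (rho' w)).
Proof.
split=> [k w w'|a w|w a]; apply/funext => -[x|x]; apply/funext => -[y|y];
  rewrite /mx_lin /matactl /matactr ?big_sumType /= ?scaler0 ?addr0 ?matrepP
    ?matrepM //=.
- by rewrite !sum0 ?addr0 // => z; rewrite ?mulr0 ?mul0r.
- by rewrite !sum0 ?addr0 // => z; rewrite ?mulr0 ?mul0r.
- by rewrite !sum0 ?addr0 // => z; rewrite ?mulr0 ?mul0r.
- by rewrite sum0 ?add0r // => z; rewrite mul0r.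
- by rewrite !sum0 ?addr0 // => z; rewrite ?mulr0 ?mul0r.
- by rewrite !sum0 ?addr0 // => z; rewrite ?mulr0 ?mul0r.
- by rewrite !sum0 ?addr0 // => z; rewrite ?mulr0 ?mul0r.
- by rewrite sum0 ?add0r // => z; rewrite mul0r.
Qed.

Let gtrace_zero (X : finType) (s : seq (X -> X -> B)) :
  gtrace (fun _ _ => 0 : regular_pb B) s = 0.
Proof. by do 3![apply: big1 => ? _]; rewrite pure0. Qed.

Theorem transfer_conj n x : cycles n x ->
  boundaries n (transfer rho x - transfer rho' x).
Proof.
move=> Zx; have E1 w : bdiag (rho w) (fun _ _ => 0) =
  matactl (V := regular_pb B) U (S w).
  apply/funext => -[y|y]; apply/funext => -[z|z]; rewrite /matactl !big_sumType /=.
  - rewrite sum0 ?add0r ?u_v_rho // => i; exact: mul0r.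
  - by rewrite !sum0 ?addr0 // => i; rewrite ?mulr0 ?mul0r.
  - by rewrite !sum0 ?addr0 // => i; rewrite ?mulr0 ?mul0r.
  - by rewrite !sum0 ?addr0 // => i; rewrite ?mulr0 ?mul0r.
have E2 w : bdiag (fun _ _ => 0) (rho' w) = matactr (V := regular_pb B) (S w) U.
  apply/funext => -[y|y]; apply/funext => -[z|z]; rewrite /matactr !big_sumType /=.
  - by rewrite !sum0 ?addr0 // => i; rewrite ?mulr0 ?mul0r.
  - by rewrite !sum0 ?addr0 // => i; rewrite ?mulr0 ?mul0r.
  - by rewrite !sum0 ?addr0 // => i; rewrite ?mulr0 ?mul0r.
  - rewrite [X in _ + X]sum0 ?addr0 ?v_rho_u // => i; exact: mulr0.
have T1 y : trace_map zero_equivariant1 y = transfer rho y.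
  apply: chain_ext y => a s; rewrite trace_map_pure transfer_gen.
  rewrite (gtrace_block (V := regular_pb B) (rho1 := rho) (rho2 := rho')) //=.
  by rewrite gtrace_zero addr0.
have T2 y : trace_map zero_equivariant2 y = transfer rho' y.
  apply: chain_ext y => a s; rewrite trace_map_pure transfer_gen.
  rewrite (gtrace_block (V := regular_pb B) (rho1 := rho) (rho2 := rho')) //=.
  by rewrite gtrace_zero add0r.
have := trace_map_cyclic RU SP zero_equivariant2 zero_equivariant1 E2 E1 Zx.
by rewrite T1 T2 => /(boundariesB (boundaries0 _ _)); rewrite sub0r opprB.
Qed.

End Conjugation.

(** * Dual bases and the transfer of a bimodule *)
Section TensorMaps.
Variables (K : comNzRingType) (M N : lmodType K) (R : Type).
Variables (rho : M -> R -> M) (lam : R -> N -> N).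

Lemma tens_lin_exists (Z : lmodType K) (b : M -> N -> Z) :
  balanced rho lam b ->
  {h : {linear tens rho lam -> Z} | forall x y, h (tmk rho lam x y) = b x y}.
Proof.
move=> bal; pose h : tens rho lam -> Z := tens_lift b.
pose hl := GRing.isLinear.Build K (tens rho lam) Z _ h (tens_lift_linear bal).
exists (HB.pack_for {linear tens rho lam -> Z} h hl) => x y.
exact: tens_liftE.
Qed.

Definition tens_lin (Z : lmodType K) (b : M -> N -> Z) (bal : balanced rho lam b) :
  {linear tens rho lam -> Z} := sval (tens_lin_exists bal).

Lemma tens_linE (Z : lmodType K) (b : M -> N -> Z) (bal : balanced rho lam b) x y :
  tens_lin bal (tmk rho lam x y) = b x y.
Proof. exact: (svalP (tens_lin_exists bal)). Qed.

Lemma tmk_sumr (U : Type) (r : seq U) (F : U -> N) x :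
  tmk rho lam x (\sum_(i <- r) F i) = \sum_(i <- r) tmk rho lam x (F i).
Proof.
elim: r => [|i r IH]; rewrite ?big_nil ?big_cons -?IH ?tmkDr //.
by have := tmkZr rho lam 0 x 0; rewrite !scale0r.
Qed.

Lemma tmk_suml (U : Type) (r : seq U) (F : U -> M) y :
  tmk rho lam (\sum_(i <- r) F i) y = \sum_(i <- r) tmk rho lam (F i) y.
Proof.
elim: r => [|i r IH]; rewrite ?big_nil ?big_cons -?IH ?tmkDl //.
by have := tmkZl rho lam 0 0 y; rewrite !scale0r.
Qed.

End TensorMaps.

Section BimodSums.
Variables (K : comNzRingType) (A B : algType K) (M : bimod A B).

Lemma lact_sum (U : Type) (r : seq U) (F : U -> M) a :
  lact a (\sum_(i <- r) F i) = \sum_(i <- r) lact a (F i).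
Proof.
elim: r => [|i r IH]; rewrite ?big_nil ?big_cons ?lactDr ?IH //.
by have := lactZr 0 a (0 : M); rewrite !scale0r.
Qed.

Lemma ract_sum (U : Type) (r : seq U) (F : U -> M) b :
  ract (\sum_(i <- r) F i) b = \sum_(i <- r) ract (F i) b.
Proof.
elim: r => [|i r IH]; rewrite ?big_nil ?big_cons ?ractDl ?IH //.
by have := ractZl 0 (0 : M) b; rewrite !scale0r.
Qed.

Lemma ract0 x : ract x 0 = 0 :> M.
Proof. by have := ractZr 0 x (0 : B); rewrite !scale0r. Qed.
Lemma lact_0 a : lact a 0 = 0 :> M.
Proof. by have := lactZr 0 a (0 : M); rewrite !scale0r. Qed.
Lemma ract_0 b : ract 0 b = 0 :> M.
Proof. by have := ractZl 0 (0 : M) b; rewrite !scale0r. Qed.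

Lemma ract_sumr (U : Type) (r : seq U) (F : U -> B) x :
  ract x (\sum_(i <- r) F i) = \sum_(i <- r) ract x (F i) :> M.
Proof.
by elim: r => [|i r IH]; rewrite ?big_nil ?ract0 // !big_cons ractDr IH.
Qed.

End BimodSums.

(** A finite dual basis of M as a right B-module. *)
Record dual_basis (K : comNzRingType) (A B : algType K) (M : bimod A B)
  (I : finType) :=
  DualBasis {
  db_vec : I -> M;
  db_coord : I -> {linear M -> B};
  db_coordR : forall i x b, db_coord i (ract x b) = db_coord i x * b;
  db_sum : forall x, \sum_i ract (db_vec i) (db_coord i x) = x }.

Section DualBasis.
Variables (K : comNzRingType) (A B : algType K) (M : bimod A B) (I : finType).
Variable d : dual_basis M I.

Lemma db_expand i a x :
  \sum_k db_coord d i (lact a (db_vec d k)) * db_coord d k x =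
    db_coord d i (lact a x).
Proof.
rewrite -[in RHS](db_sum d x) lact_sum linear_sum; apply: eq_bigr => k _.
by rewrite lractA db_coordR.
Qed.

Definition db_rep : matrep A B I.
Proof.
exists (fun a i j => db_coord d i (lact a (db_vec d j))).
- move=> k a a'; apply/funext => i; apply/funext => j.
  by rewrite lactDl lactZl linearP.
- move=> a b; apply/funext => i; apply/funext => j.
  by rewrite lactM -db_expand.
Defined.

End DualBasis.

Section TransferIso.
Variables (K : comNzRingType) (A B : algType K) (M M' : bimod A B) (I J : finType).
Variables (d : dual_basis M I) (d' : dual_basis M' J).

(** Base change between two dual bases: u_ij = f_i(g^{-1} x'_j) and
    v_ji = f'_j(g x_i) satisfy the hypotheses of [transfer_conj]. *)
Lemma transfer_dual_basis n x : bimod_iso M M' -> cycles n x ->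
  boundaries n (transfer (db_rep d) x - transfer (db_rep d') x).
Proof.
case=> g [[g' gK g'K] gl gr].
have g'P k y z : g' (k *: y + z) = k *: g' y + g' z.
  by apply: (can_inj gK); rewrite linearP !g'K.
have g'l a y : g' (lact a y) = lact a (g' y).
  by apply: (can_inj gK); rewrite gl !g'K.
have g'r y b : g' (ract y b) = ract (g' y) b.
  by apply: (can_inj gK); rewrite gr !g'K.
have g'S (F : J -> M') : g' (\sum_j F j) = \sum_j g' (F j).
  apply: (can_inj gK); rewrite g'K linear_sum; apply: eq_bigr => j _.
  by rewrite g'K.
pose u i j := db_coord d i (g' (db_vec d' j)).
pose v j i := db_coord d' j (g (db_vec d i)).
have h1 a i j : \sum_k db_rep d a i k * u k j = \sum_l u i l * db_rep d' a l j.
  rewrite db_expand -g'l -[in LHS](db_sum d' (lact a _)) g'S linear_sum.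
  by apply: eq_bigr => l _; rewrite g'r db_coordR.
have h2 a j k : \sum_i v j i * db_rep d a i k = \sum_l db_rep d' a j l * v l k.
  rewrite db_expand -gl -[in RHS](db_sum d (lact a _)) !linear_sum /=.
  by apply: eq_bigr => l _; rewrite gr db_coordR.
have v_exp j y : \sum_i v j i * db_coord d i y = db_coord d' j (g y).
  rewrite -[in RHS](db_sum d y) !linear_sum; apply: eq_bigr => i _ /=.
  by rewrite gr db_coordR.
have u_exp i y : \sum_j u i j * db_coord d' j y = db_coord d i (g' y).
  rewrite -[in RHS](db_sum d' y) g'S linear_sum; apply: eq_bigr => j _ /=.
  by rewrite g'r db_coordR.
apply: (@transfer_conj _ _ _ _ _ _ _ u v h1 h2) => [a j j'|a i k].
  under eq_bigr do rewrite v_exp gl.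
  under eq_bigr do rewrite /u.
  have E y : \sum_k db_coord d' j (lact a (g (db_vec d k))) * db_coord d k y =
    db_coord d' j (lact a (g y)).
    rewrite -[in RHS](db_sum d y) !linear_sum lact_sum linear_sum.
    by apply: eq_bigr => k _; rewrite gr lractA db_coordR.
  by rewrite E g'K.
under eq_bigr do rewrite v_exp.
by rewrite u_exp gK.
Qed.

End TransferIso.

(** When rho comes from a dual basis (x_i, f_i) of a bimodule X, the family
    (v_i) stands for Σ v_i ⊗ f_i in V ⊗_A X^*. The right action is
    f_i a = Σ_j rho(a)_ij f_j, which explains the formula below. *)
Section Power.
Variables (K : comNzRingType) (A : algType K) (I : finType) (rho : matrep A A I).
Variable (V : bimod A A).

Definition power : prebimod A.
Proof.
exists ({ffun I -> V} : lmodType K)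
  (fun a (y : {ffun I -> V}) => [ffun i => lact a (y i)] : {ffun I -> V})
  (fun (y : {ffun I -> V}) a =>
     [ffun j => \sum_i ract (y i) (rho a i j)] : {ffun I -> V}).
- by move=> k a a' y; apply/ffunP => i; rewrite !ffunE lactDl lactZl.
- by move=> a k y y'; apply/ffunP => i; rewrite !ffunE lactDr lactZr.
- move=> y k a a'; apply/ffunP => j; rewrite !ffunE scaler_sumr -big_split.
  by apply: eq_bigr => i _; rewrite matrepP ractDr ractZr.
- move=> k y y' a; apply/ffunP => j; rewrite !ffunE scaler_sumr -big_split.
  by apply: eq_bigr => i _; rewrite !ffunE ractDl ractZl.
- by move=> a b y; apply/ffunP => i; rewrite !ffunE lactM.
- move=> y a b; apply/ffunP => j; rewrite !ffunE.
  under eq_bigr => i _ do rewrite matrepM ract_sumr.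
  rewrite exchange_big; apply: eq_bigr => k _; rewrite ffunE ract_sum.
  by apply: eq_bigr => i _; rewrite ractM.
- move=> a y b; apply/ffunP => j; rewrite !ffunE lact_sum.
  by apply: eq_bigr => i _; rewrite !ffunE lractA.
Defined.

End Power.

Section PowerMap.
Variables (K : comNzRingType) (A : algType K) (I : finType) (rho : matrep A A I).
Variables (V W : bimod A A) (f : {linear V -> W}).
Hypothesis fl : forall a x, f (lact a x) = lact a (f x).
Hypothesis fr : forall x a, f (ract x a) = ract (f x) a.

Definition power_map (y : power rho V) : power rho W := [ffun i => f (y i)].
Fact power_map_linear : linear power_map.
Proof. by move=> k y z; apply/ffunP => i; rewrite !ffunE linearP. Qed.
HB.instance Definition _ := GRing.isLinear.Build K (power rho V) (power rho W) _
  power_map power_map_linear.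

Lemma power_map_pb_hom : pb_hom power_map.
Proof.
split=> [a y|y a]; apply/ffunP => i; rewrite !ffunE ?fl // linear_sum.
by apply: eq_bigr => j _; rewrite ffunE fr.
Qed.

End PowerMap.

Arguments power_map {K A I} rho {V W} f _.

Section TransferFactor.
Variables (K : comNzRingType) (A : algType K) (I : finType) (M : bimod A A).
Variable d : dual_basis M I.

Let P : prebimod A := power (db_rep d) M.

Let coev (a : regular_pb A) : P := [ffun i => lact a (db_vec d i)].
Fact coev_linear : linear coev.
Proof. by move=> k a a'; apply/ffunP => i; rewrite !ffunE lactDl lactZl. Qed.
HB.instance Definition _ := GRing.isLinear.Build K
  (regular_pb A) P _ coev coev_linear.

Let coev_pb_hom : pb_hom coev.
Proof.
split=> [a a'|a a']; apply/ffunP => i; rewrite !ffunE ?lactM //.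
rewrite -[in LHS](db_sum d (lact a' _)) lact_sum.
by apply: eq_bigr => j _; rewrite ffunE lractA.
Qed.

Let eval (y : P) (i k : I) : regular_pb A := db_coord d i (y k).

Let eval_equivariant : equivariant (db_rep d) eval.
Proof.
split=> [k y z|a y|y a]; apply/funext => i; apply/funext => j;
  rewrite /eval /mx_lin /matactl /matactr ffunE.
- by rewrite ffunE linearP.
- by rewrite -db_expand.
- by rewrite linear_sum; apply: eq_bigr => k _; rewrite db_coordR.
Qed.

(** The transfer of M is the composite of the coevaluation A → M ⊗_A M^*, which
    maps a to Σ a x_i ⊗ f_i, and of the trace of the evaluation. A cycle that
    becomes a boundary in the middle has a boundary as its transfer. *)
Lemma transfer_factor n : acyclic P n ->
  forall x, cycles n x -> boundaries n (transfer (db_rep d) x).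
Proof.
move=> aP x Zx.
have -> : transfer (db_rep d) x = trace_map eval_equivariant (chain_map A coev x).
  apply: (chain_ext (g := trace_map eval_equivariant \o chain_map A coev)) => a s.
  rewrite transfer_gen /= chain_mapE trace_map_pure.
  have -> : eval (coev a) = db_rep d a :> (I -> I -> regular_pb A).
    by apply/funext => i; apply/funext => j; rewrite /eval ffunE.
  by [].
by apply: trace_map_boundaries; apply: aP; apply: chain_map_cycles.
Qed.

End TransferFactor.

(** * Induced bimodules and their contraction *)
Section InducedBimod.
Variables (K : comNzRingType) (A : algType K).

Definition scal_right : bimod A K^o.
Proof.
exists (A : lmodType K) (fun a x => a * x) (fun x (k : K^o) => (k : K) *: x).
- exact: mulrDl.
- exact: mulrDr.
- by move=> k a x; rewrite scalerAl.
- by move=> k a x; rewrite scalerAr.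
- exact: mul1r.
- by move=> a a' x; rewrite mulrA.
- by move=> x x' b; rewrite scalerDr.
- by move=> x b b'; rewrite scalerDl.
- by move=> k x b; rewrite !scalerA mulrC.
- by move=> k x b; rewrite scalerA.
- exact: scale1r.
- by move=> x b b'; rewrite scalerA mulrC.
- by move=> a x b; rewrite scalerAr.
Defined.

Variable U : bimod A A.

Definition scal_left : bimod K^o A.
Proof.
exists (U : lmodType K) (fun (k : K^o) x => (k : K) *: x) (@ract _ _ _ U).
- by move=> a a' x; rewrite scalerDl.
- by move=> a x x'; rewrite scalerDr.
- by move=> k a x; rewrite scalerA.
- by move=> k a x; rewrite !scalerA mulrC.
- exact: scale1r.
- by move=> a a' x; rewrite scalerA.
- exact: ractDl.
- exact: ractDr.
- exact: ractZl.
- exact: ractZr.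
- exact: ract1.
- exact: ractM.
- by move=> a x b; rewrite ractZl.
Defined.

(** What is used of A ⊗_K U, with A acting on the left factor and on the right
    of U. The record hides the construction as a quotient, so that conversion
    does not enter it. *)
Record induced_bimod := InducedBimod {
  ind_sort :> bimod A A;
  itens : A -> U -> ind_sort;
  lact_itens : forall b a x, lact b (itens a x) = itens (b * a) x;
  ract_itens : forall a x b, ract (itens a x) b = itens a (ract x b);
  itensPl : forall k a a' x, itens (k *: a + a') x = k *: itens a x + itens a' x;
  itensPr : forall a k x x', itens a (k *: x + x') = k *: itens a x + itens a x';
  ind_ind : forall Q : ind_sort -> Prop,
    Q 0 -> (forall a x, Q (itens a x)) ->
    (forall s t, Q s -> Q t -> Q (s + t)) -> forall t, Q t;
  ind_lin_exists : forall (Z : lmodType K) (b : A -> U -> Z),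
    (forall k a a' x, b (k *: a + a') x = k *: b a x + b a' x) ->
    (forall a k x x', b a (k *: x + x') = k *: b a x + b a x') ->
    {h : {linear ind_sort -> Z} | forall a x, h (itens a x) = b a x} }.

Fact induced_exists : induced_bimod.
Proof.
exists (tens_bimod scal_right scal_left)
  (fun (a : scal_right) (x : scal_left) => tmk _ _ a x).
- by move=> b a x; apply: tens_lactE.
- by move=> a x b; apply: tens_ractE.
- by move=> k a a' x; rewrite tmkDl tmkZl.
- by move=> a k x x'; rewrite tmkDr tmkZr.
- exact: tens_ind.
move=> Z b ba_left ba_right.
have b0 x : b 0 x = 0 by have := ba_left (-1) 0 0 x; rewrite !scaleN1r !addNr.
have b_0 a : b a 0 = 0 by have := ba_right a (-1) 0 0; rewrite !scaleN1r !addNr.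
have bZl k a x : b (k *: a) x = k *: b a x by have := ba_left k a 0 x;
  rewrite b0 !addr0.
have bZr k a x : b a (k *: x) = k *: b a x by have := ba_right a k x 0;
  rewrite b_0 !addr0.
have bal : balanced (@ract _ _ _ scal_right) (@lact _ _ _ scal_left) b.
  split=> [a a' x|a x x'|||a r x] //.
  - by have := ba_left 1 a a' x; rewrite !scale1r.
  - by have := ba_right a 1 x x'; rewrite !scale1r.
  - by rewrite /= bZl bZr.
by exists (tens_lin bal) => a x; rewrite tens_linE.
Qed.

Definition ind : induced_bimod := induced_exists.

Lemma itens_suml (T : Type) (r : seq T) (F : T -> A) x :
  itens ind (\sum_(i <- r) F i) x = \sum_(i <- r) itens ind (F i) x.
Proof.
elim: r => [|i r IH]; rewrite ?big_nil ?big_cons -?IH.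
  by have := itensPl ind (-1) 0 0 x; rewrite !scaleN1r !addNr.
by have := itensPl ind 1 (F i) (\sum_(j <- r) F j) x; rewrite !scale1r.
Qed.

Lemma itens_sumr (T : Type) (r : seq T) (F : T -> U) a :
  itens ind a (\sum_(i <- r) F i) = \sum_(i <- r) itens ind a (F i).
Proof.
elim: r => [|i r IH]; rewrite ?big_nil ?big_cons -?IH.
  by have := itensPr ind a (-1) 0 0; rewrite !scaleN1r !addNr.
by have := itensPr ind a 1 (F i) (\sum_(j <- r) F j); rewrite !scale1r.
Qed.

Lemma itensZ k a x : itens ind (k *: a) x = itens ind a (k *: x).
Proof.
have r0 : itens ind a 0 = 0 by have := itensPr ind a (-1) 0 0;
  rewrite !scaleN1r !addNr.
have l0 : itens ind 0 x = 0 by have := itensPl ind (-1) 0 0 x;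
  rewrite !scaleN1r !addNr.
by have := itensPl ind k a 0 x; have := itensPr ind a k x 0;
  rewrite l0 r0 !addr0 => -> ->.
Qed.

Definition ind_mul : {linear ind -> U}.
Proof.
apply: (sval (@ind_lin_exists ind U (fun a x => lact a x) _ _)).
- by move=> k a a' x; rewrite lactDl lactZl.
- by move=> a k x x'; rewrite lactDr lactZr.
Defined.

Lemma ind_mulE a x : ind_mul (itens ind a x) = lact a x.
Proof. exact: (svalP (@ind_lin_exists _ _ _ _ _)). Qed.

Lemma ind_mul_lact b t : ind_mul (lact b t) = lact b (ind_mul t).
Proof.
elim/(@ind_ind ind): t => [|a x|s t IHs IHt].
- by rewrite lact_0 !linear0 lact_0.
- by rewrite lact_itens !ind_mulE lactM.
- by rewrite lactDr !linearD lactDr IHs IHt.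
Qed.

Lemma ind_mul_ract t b : ind_mul (ract t b) = ract (ind_mul t) b.
Proof.
elim/(@ind_ind ind): t => [|a x|s t IHs IHt].
- by rewrite ract_0 !linear0 ract_0.
- by rewrite ract_itens !ind_mulE lractA.
- by rewrite ractDl !linearD ractDl IHs IHt.
Qed.

Lemma ind_mul_sect x : ind_mul (itens ind 1 x) = x.
Proof. by rewrite ind_mulE lact1. Qed.

End InducedBimod.

Section Contraction.
Variables (K : comNzRingType) (A : algType K) (I : finType) (rho : matrep A A I).
Variable U : bimod A A.
Local Notation IU := (ind U).
Local Notation P := (power rho IU).

Definition delta (i : I) (t : IU) : P := [ffun j => if j == i then t else 0].

Lemma deltaP i k s t : delta i (k *: s + t) = k *: delta i s + delta i t.
Proof.
by apply/ffunP => j; rewrite !ffunE; case: eqP => // _; rewrite scaler0 addr0.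
Qed.

Lemma delta_sum (y : P) : y = \sum_i delta i (y i).
Proof.
apply/ffunP => j; rewrite sum_ffunE.
under eq_bigr do rewrite ffunE eq_sym.
by rewrite (sum_if_eq (fun i => y i)).
Qed.

Lemma plact_delta a i t : plact a (delta i t) = delta i (lact a t).
Proof. by apply/ffunP => j; rewrite !ffunE; case: eqP => // _; apply: lact_0. Qed.

Lemma pract_delta i t a : pract (delta i t) a = \sum_j delta j (ract t (rho a i j)).
Proof.
rewrite [LHS]delta_sum; apply: eq_bigr => j _; congr delta; rewrite ffunE.
rewrite (bigD1 i) //= big1 ?addr0 => [|k /negPf ki]; first by rewrite ffunE eqxx.
by rewrite ffunE ki ract_0.
Qed.

Lemma power_ind (Q : P -> Prop) :
  Q 0 -> (forall i a x, Q (delta i (itens IU a x))) ->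
  (forall y z, Q y -> Q z -> Q (y + z)) -> forall y, Q y.
Proof.
move=> Q0 Qd QD y; rewrite (delta_sum y); elim/big_rec: _ => // i z _ Qz.
apply: (QD) => //; elim/(@ind_ind _ _ _ IU): (y i) => [|a x|s t Qs Qt].
- by have := deltaP i (-1) 0 0; rewrite !scaleN1r !addNr => ->.
- exact: Qd.
- by have := deltaP i 1 s t; rewrite !scale1r => ->; apply: QD.
Qed.

Fact contract_lin_exists i (s : seq A) :
  {h : {linear IU -> chain A P} |
    forall a x, h (itens IU a x) = pure (delta i (itens IU 1 x)) (rcons s a)}.
Proof.
apply: ind_lin_exists => [k a a' x|a k x x'].
  by rewrite -!cats1 pureA.
by rewrite itensPr deltaP pureV.
Qed.

Definition contract_lin i s : {linear IU -> chain A P} :=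
  sval (contract_lin_exists i s).

Lemma contract_linE i s a x :
  contract_lin i s (itens IU a x) = pure (delta i (itens IU 1 x)) (rcons s a).
Proof. exact: (svalP (contract_lin_exists i s)). Qed.

Fact contract_multilin : multilin (fun (y : P) s => \sum_i contract_lin i s (y i)).
Proof.
split=> [s k y z|y s1 s2 k a a'].
  rewrite scaler_sumr -big_split; apply: eq_bigr => i _ /=.
  by rewrite !ffunE linearP.
rewrite scaler_sumr -big_split; apply: eq_bigr => i _ /=.
elim/(@ind_ind _ _ _ IU): (y i) => [|b x|s t IHs IHt].
- by rewrite !(linear0 (contract_lin _ _)) scaler0 addr0.
- by rewrite !contract_linE !rcons_cat pureA.
- by rewrite !(linearD (contract_lin _ _)) IHs IHt scalerDr addrACA.
Qed.

(** (a ⊗ u) ⊗ a_1 ⊗ ... ⊗ a_n ↦ (1 ⊗ u) ⊗ a_1 ⊗ ... ⊗ a_n ⊗ a. The left action is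
    free, so a can be moved to the end of the word, from where the cyclic face
    brings it back. *)
Definition contract : {linear chain A P -> chain A P} :=
  chain_lift contract_multilin.

Lemma contract_pure i a x s :
  contract (pure (delta i (itens IU a x)) s) =
    pure (delta i (itens IU 1 x)) (rcons s a).
Proof.
rewrite /contract chain_liftE (bigD1 i) //= big1 ?addr0 => [|j /negPf ji].
  by rewrite ffunE eqxx contract_linE.
by rewrite ffunE ji linear0.
Qed.

Lemma contract_ext n (Z : lmodType K) (f g : {linear chain A P -> Z}) :
  (forall i a x s, size s = n ->
     f (pure (delta i (itens IU a x)) s) = g (pure (delta i (itens IU a x)) s)) ->
  forall y, homog n y -> f y = g y.
Proof.
move=> fg; apply: homog_ext => y s sz; elim/power_ind: y => [|i a x|y z IHy IHz].
- by rewrite pure0 !linear0.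
- exact: fg.
- by rewrite pureD !linearD IHy IHz.
Qed.

Lemma contract_homog n y : homog n y -> homog n.+1 (contract y).
Proof.
move=> yd.
apply: (contract_ext (f := deg_part n.+1 \o contract) (g := contract) _ yd).
move=> i a x s sz /=; rewrite contract_pure deg_part_pure.
by rewrite size_rcons sz eqxx.
Qed.

Lemma dface_contract n i y : (i <= n)%N -> (0 < n)%N -> homog n y ->
  dface i (contract y) = contract (dface i y).
Proof.
move=> ile n0;
  apply: (contract_ext (f := dface i \o contract) (g := contract \o dface i)).
move=> j a x s sz /=; rewrite contract_pure; rewrite -sz in ile n0.
have iv := faceP ile n0; case: i s / iv {ile n0 sz} => [b s|p b c q|p z].
- rewrite !dface_first !pract_delta !pure_sum linear_sum.
  by apply: eq_bigr => k _; rewrite !ract_itens contract_pure.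
- by rewrite rcons_cat /= !dface_mid // contract_pure rcons_cat.
- rewrite -(cats1 (rcons p z)) cat_rcons dface_mid // dface_last // plact_delta
    lact_itens contract_pure.
  by rewrite cats1.
Qed.

Lemma dface_contract_last n y : homog n y -> dface n.+1 (contract y) = y.
Proof.
apply: (contract_ext (f := dface n.+1 \o contract) (g := idfun)) => i a x s sz /=.
by rewrite contract_pure dface_last ?sz // plact_delta lact_itens mulr1.
Qed.

(** All faces commute with the contraction but the last one, which inverts it;
    hence ∂ s = s ∂ ± id. In degree 0 this fails: there the first face of s y is
    not s of a face. *)
Lemma acyclic_ind n : (0 < n)%N -> acyclic P n.
Proof.
move=> n0 y [yd by0]; exists ((-1) ^+ n.+1 *: contract y).
  by apply: homogZ; apply: contract_homog.
have E : bnd (contract y) = contract (bnd y) + (-1) ^+ n.+1 *: y.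
  rewrite (bndE (contract_homog yd)) (bndE yd) big_ord_recr /=.
  rewrite dface_contract_last // linear_sum.
  congr (_ + _); apply: eq_bigr => i _.
  by rewrite linearZ (dface_contract _ n0 yd) // -ltnS.
by rewrite linearZ /= E by0 linear0 add0r scalerA -exprMn mulrN1 opprK expr1n
  scale1r.
Qed.

End Contraction.

Section KernelBimod.
Variables (K : comNzRingType) (A : algType K) (U W : bimod A A)
  (f : {linear U -> W}).
Hypothesis fl : forall a x, f (lact a x) = lact a (f x).
Hypothesis fr : forall x a, f (ract x a) = ract (f x) a.

Fact ker_bimod_lact_proof a (x : kermod f) : lact a (val x) \in ker_pred f.
Proof. by have /eqP := valP x; rewrite unfold_in fl => ->; rewrite lact_0. Qed.
Fact ker_bimod_ract_proof (x : kermod f) a : ract (val x) a \in ker_pred f.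
Proof. by have /eqP := valP x; rewrite unfold_in fr => ->; rewrite ract_0. Qed.

Definition ker_bimod : bimod A A.
Proof.
exists (kermod f : lmodType K) (fun a x => KerMod (ker_bimod_lact_proof a x))
  (fun x a => KerMod (ker_bimod_ract_proof x a)) => *; apply: val_inj;
  rewrite ?linearD ?linearZ /=.
- exact: lactDl.
- exact: lactDr.
- exact: lactZl.
- exact: lactZr.
- exact: lact1.
- exact: lactM.
- exact: ractDl.
- exact: ractDr.
- exact: ractZl.
- exact: ractZr.
- exact: ract1.
- exact: ractM.
- exact: lractA.
Defined.

Definition ker_bimod_val : {linear ker_bimod -> U} := val : {linear kermod f -> U}.

End KernelBimod.

Fact mk_linear_exists (R : nzRingType) (U V : lmodType R) (f : U -> V) :
  linear f -> {h : {linear U -> V} | h =1 f}.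
Proof.
by move=> fP;
  exists (HB.pack_for {linear U -> V} f (GRing.isLinear.Build R U V _ f fP)).
Qed.

Definition mk_linear (R : nzRingType) (U V : lmodType R) (f : U -> V)
  (fP : linear f) : {linear U -> V} := sval (mk_linear_exists fP).

Lemma mk_linearE (R : nzRingType) (U V : lmodType R) (f : U -> V) (fP : linear f) :
  mk_linear fP =1 f.
Proof. exact: (svalP (mk_linear_exists fP)). Qed.

Section PowerExact.
Variables (K : comNzRingType) (A : algType K) (I : finType) (rho : matrep A A I).

Lemma power_map_inj (V W : bimod A A) (f : {linear V -> W}) :
  injective f -> injective (power_map rho f : power rho V -> power rho W).
Proof.
move=> fI y z yz; apply/ffunP => i; apply: fI.
by have := congr1 (fun g : {ffun I -> W} => g i) yz; rewrite !ffunE.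
Qed.

Lemma power_map_surj (V W : bimod A A) (f : {linear V -> W}) :
  (forall w, exists v, f v = w) -> forall w : power rho W, exists v,
    power_map rho f v = w.
Proof.
move=> /choice[g gP] w; exists ([ffun i => g (w i)] : {ffun I -> V}).
by apply/ffunP => i; rewrite !ffunE gP.
Qed.

Lemma power_map_exact (U V W : bimod A A) (f : {linear U -> V})
  (g : {linear V -> W}) :
  (forall v, g v = 0 <-> exists u, f u = v) ->
  forall v : power rho V, power_map rho g v = 0 <-> exists u, power_map rho f u = v.
Proof.
move=> ex v; split=> [gv|[u <-]]; last first.
  by apply/ffunP => i; rewrite !ffunE; apply/ex; exists (u i).
have H i : exists u, f u = v i.
  by apply/ex; have := congr1 (fun h : {ffun I -> W} => h i) gv; rewrite !ffunE.
have [u uP] := choice H; exists ([ffun i => u i] : {ffun I -> U}).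
by apply/ffunP => i; rewrite !ffunE uP.
Qed.

End PowerExact.

(** The condition is on all V ⊗_A X^* at once, since the recursion in
    [transfer_vanish] changes the bimodule and its dual basis. *)
Definition acyclic_from (K : comNzRingType) (A : algType K) n (U : bimod A A) :=
  forall (I : finType) (rho : matrep A A I) k, (n <= k)%N ->
    acyclic (power rho U) k.

Section UnitPower.
Variables (K : comNzRingType) (A : algType K) (V : bimod A A).

Definition unit_rep : matrep A A unit.
Proof.
exists (fun a _ _ => a) => // a b; apply/funext => i; apply/funext => j.
by rewrite /matmul (bigD1 tt) //= big1 ?addr0 // => -[].
Defined.

Let in_pw (v : bimod_pb V) : power unit_rep V := [ffun _ => v].
Let in_pw_linear : linear in_pw.
Proof. by move=> c x y; apply/ffunP => i; rewrite !ffunE. Qed.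
Let out_pw (y : power unit_rep V) : bimod_pb V := (y : {ffun unit -> V}) tt.
Let out_pw_linear : linear out_pw.
Proof. by move=> c x y; rewrite /out_pw !ffunE. Qed.

Lemma acyclic_from_pb n k : acyclic_from n V -> (n <= k)%N ->
  acyclic (bimod_pb V) k.
Proof.
move=> aV nk.
apply: (@acyclic_retract _ _ _ _ (mk_linear in_pw_linear) _
  (mk_linear out_pw_linear)).
- split=> [a w|w a]; rewrite !mk_linearE; apply/ffunP => i; rewrite !ffunE //.
  by rewrite (bigD1 tt) //= big1 ?addr0 ?ffunE // => -[].
- split=> [a y|y a]; rewrite !mk_linearE /out_pw !ffunE //.
  by rewrite (bigD1 tt) //= big1 ?addr0 // => -[].
- by move=> w; rewrite !mk_linearE /out_pw ffunE.
- exact: aV.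
Qed.

End UnitPower.

(** * Vanishing of transfers over a finite projective algebra *)

(** Here (aQ, pQ) is a dual basis of A over K, and U' denotes the kernel of the
    multiplication A ⊗_K U → U. *)
Section FiniteAlgebra.
Variables (K : comNzRingType) (A : algType K) (Q : finType).
Variables (aQ : Q -> A) (pQ : Q -> {linear A -> K^o}).
Hypothesis aQP : forall a, \sum_q pQ q a *: aQ q = a.
Hypothesis projA : projective (A : lmodType K).
Variable U : bimod A A.
Local Notation IU := (ind U).
Local Notation mu := (ind_mul U).
Local Notation KU := (ker_bimod (@ind_mul_lact _ _ U) (@ind_mul_ract _ _ U)).
Local Notation kv := (ker_bimod_val (@ind_mul_lact _ _ U) (@ind_mul_ract _ _ U)).

Section Basis.
Variables (I : finType) (d : dual_basis U I).

Fact ind_db_exists (p : Q * I) :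
  {h : {linear IU -> A} |
    forall a x, h (itens IU a x) = (pQ p.1 a : K) *: db_coord d p.2 x}.
Proof.
apply: ind_lin_exists.
  by move=> k a a' x; rewrite linearP scalerDl scalerA.
by move=> a k x x'; rewrite linearP scalerDr !scalerA mulrC.
Qed.

Definition ind_db p : {linear IU -> A} := sval (ind_db_exists p).

Lemma ind_dbE p a x : ind_db p (itens IU a x) = (pQ p.1 a : K) *: db_coord d p.2 x.
Proof. exact: (svalP (ind_db_exists p)). Qed.

Lemma ind_dbR p t b : ind_db p (ract t b) = ind_db p t * b.
Proof.
elim/(@ind_ind _ _ _ IU): t => [|a x|s t IHs IHt].
- by rewrite ract_0 linear0 mul0r.
- by rewrite ract_itens !ind_dbE db_coordR scalerAl.
- by rewrite ractDl !linearD IHs IHt mulrDl.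
Qed.

Lemma ind_db_sum t :
  \sum_p ract (itens IU (aQ p.1) (db_vec d p.2)) (ind_db p t) = t.
Proof.
elim/(@ind_ind _ _ _ IU): t => [|a x|s t IHs IHt].
- by apply: big1 => p _; rewrite linear0 ract0.
- transitivity (
    \sum_q \sum_i itens IU (pQ q a *: aQ q) (ract (db_vec d i) (db_coord d i x))).
    rewrite pair_bigA; apply: eq_bigr => -[q i] _ /=.
    by rewrite ind_dbE ract_itens ractZr itensZ.
  under eq_bigr do rewrite -itens_sumr db_sum.
  by rewrite -itens_suml aQP.
- rewrite -[in RHS]IHs -[in RHS]IHt -big_split; apply: eq_bigr => p _.
  by rewrite linearD ractDr.
Qed.

Fact ker_proj_linear : linear (fun t : IU => t - itens IU 1 (mu t)).
Proof.
by move=> k s t; rewrite linearP itensPr opprD addrACA scalerBr.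
Qed.

(** The multiplication has the section x ↦ 1 ⊗ x, which is linear for the right
    action only. The corresponding projection onto U' is right linear. *)
Definition ker_proj : {linear IU -> IU} := mk_linear ker_proj_linear.

Lemma ker_projE t : ker_proj t = t - itens IU 1 (mu t).
Proof. exact: mk_linearE. Qed.

Lemma ker_proj_mu t : mu (ker_proj t) = 0.
Proof. by rewrite ker_projE linearB ind_mul_sect subrr. Qed.

Lemma ker_proj_ker t : ker_proj t \in ker_pred mu.
Proof. by rewrite unfold_in ker_proj_mu. Qed.

Lemma ker_proj_id t : mu t = 0 -> ker_proj t = t.
Proof.
move=> mt; rewrite ker_projE mt.
by have := itensPr IU 1 (-1) 0 0; rewrite !scaleN1r !addNr => ->; rewrite subr0.
Qed.

Lemma ker_proj_ract t b : ker_proj (ract t b) = ract (ker_proj t) b.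
Proof.
rewrite !ker_projE ind_mul_ract -ract_itens ractDl; congr (_ + _).
by have := ractZl (-1) (itens IU 1 (mu t)) b; rewrite !scaleN1r => <-.
Qed.

Lemma ker_proj_sum t :
  \sum_p ract (ker_proj (itens IU (aQ p.1) (db_vec d p.2))) (ind_db p t) =
    ker_proj t.
Proof.
rewrite -[in RHS](ind_db_sum t) linear_sum; apply: eq_bigr => p _.
by rewrite ker_proj_ract.
Qed.

Definition ker_basis : dual_basis KU (Q * I)%type.
Proof.
exists (fun p => KerMod (ker_proj_ker (itens IU (aQ p.1) (db_vec d p.2))) : KU)
       (fun p => ind_db p \o kv).
- by move=> p x b; rewrite /= ind_dbR.
- move=> x; apply: val_inj; rewrite linear_sum /=.
  have mx : mu (val x) = 0 by apply/eqP; exact: (valP x).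
  by rewrite -[RHS](ker_proj_id mx) -ker_proj_sum.
Defined.

(** A dual basis of A ⊗_K U adapted to the right splitting: the images in U' of
    the vectors aQ_q ⊗ x_i, followed by the lifts 1 ⊗ x_i of the basis of U. In
    this basis the left action is block triangular, as U' is a subbimodule. *)
Definition ind_basis : dual_basis IU (Q * I + I)%type.
Proof.
exists (fun z => match z with
         | inl p => ker_proj (itens IU (aQ p.1) (db_vec d p.2))
         | inr i => itens IU 1 (db_vec d i) end)
       (fun z => match z with
         | inl p => ind_db p \o ker_proj
         | inr i => db_coord d i \o mu end : {linear IU -> A}).
- case=> [p|i] t b; rewrite [LHS]/= [X in _ = X * _]/=.
    by rewrite ker_proj_ract ind_dbR.
  by rewrite ind_mul_ract db_coordR.
- move=> t; rewrite big_sumType /=.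
  have -> : \sum_p ract (ker_proj (itens IU (aQ p.1) (db_vec d p.2)))
    (ind_db p (ker_proj t)) = ker_proj t.
    by rewrite ker_proj_sum ker_proj_id // ker_proj_mu.
  under eq_bigr do rewrite ract_itens.
  by rewrite -itens_sumr db_sum ker_projE subrK.
Defined.

Lemma transfer_ind_split x : transfer (db_rep ind_basis) x =
  transfer (db_rep ker_basis) x + transfer (db_rep d) x.
Proof.
apply: transfer_block => [a p p'|a i i'|a i p] /=.
- congr (ind_db p _); apply: ker_proj_id.
  by rewrite ind_mul_lact ker_proj_mu lact_0.
- by rewrite lact_itens ind_mulE mulr1.
- by rewrite ind_mul_lact ker_proj_mu lact_0 linear0.
Qed.

End Basis.

(** Dimension shifting along 0 → U' → A ⊗_K U → U → 0. *)
Lemma acyclic_from_ker n : acyclic_from n.+2 U -> acyclic_from n.+1 KU.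
Proof.
move=> aU I rho k nk.
apply: (acyclic_kernel projA (io := power_map rho kv) (pi := power_map rho mu)).
- by apply: power_map_pb_hom.
- by apply: power_map_pb_hom; [apply: ind_mul_lact | apply: ind_mul_ract].
- apply: power_map_inj; exact: val_inj.
- by apply: power_map_surj => w; exists (itens IU 1 w); rewrite ind_mul_sect.
- apply: power_map_exact => t; split=> [mt|[x <-]]; last by apply/eqP;
    exact: (valP x).
  have tk : t \in ker_pred mu by apply/eqP.
  by exists (KerMod tk).
- by apply: acyclic_ind; apply: leq_ltn_trans nk.
- exact: acyclic_ind.
- exact: aU.
Qed.

End FiniteAlgebra.

(** Induction on the degree from which U is acyclic. In 0 → U' → A ⊗_K U → U → 0
    the kernel U' is acyclic from one degree lower, and the transfer of U is the
    difference of those of A ⊗_K U and U'. *)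
Theorem transfer_vanish (K : comNzRingType) (A : algType K) (Q : finType)
    (aQ : Q -> A) (pQ : Q -> {linear A -> K^o})
    (aQP : forall a, \sum_q pQ q a *: aQ q = a)
    (projA : projective (A : lmodType K)) n (U : bimod A A) (I : finType)
    (d : dual_basis U I) :
  acyclic_from n.+1 U -> forall k, (0 < k)%N ->
  forall x, cycles k x -> boundaries k (transfer (db_rep d) x).
Proof.
elim: n U I d => [|n IH] U I d aU k k_gt0 x Zx.
  by apply: transfer_factor Zx; apply: aU.
have := transfer_ind_split aQP d x => /(canLR (addKr _)) <-.
rewrite addrC; apply: boundariesB.
  by apply: transfer_factor Zx; apply: acyclic_ind.
by apply: (IH _ _ (ker_basis aQP d)) Zx => //; apply: acyclic_from_ker.
Qed.

(** * Transfers of tensor products and direct sums *)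
Lemma fgproj_dual (R : nzRingType) (M : lmodType R) : fgproj M ->
  exists (n : nat) (x : 'I_n -> M) (f : 'I_n -> {linear M -> R^o}),
    forall v, \sum_i (f i v : R) *: x i = v.
Proof.
case=> -[s sP] pM; pose n := size s.
pose g (c : {ffun 'I_n -> R^o}) : M := \sum_i (c i : R) *: s`_i.
have gP : linear g.
  move=> k c c'; rewrite /g scaler_sumr -big_split; apply: eq_bigr => i _ /=.
  by rewrite !ffunE scalerDl scalerA.
have surj v : exists c, mk_linear gP c = v.
  have [c ->] := sP v; exists [ffun i => c i : R^o]; rewrite mk_linearE.
  by apply: eq_bigr => i _; rewrite ffunE.
have [h hP] := pM _ _ (mk_linear gP) idfun surj.
have fP i : linear (fun v => h v i : R^o).
  by move=> k u v; rewrite linearP !ffunE.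
exists n, (fun i => s`_i), (fun i => mk_linear (fP i)) => v.
rewrite -[RHS](hP v) mk_linearE; apply: eq_bigr => i _.
by rewrite mk_linearE.
Qed.

Lemma right_dual_basis (K : comNzRingType) (A B : algType K) (M : bimod A B) :
  fgproj (right_mod M) -> exists n : nat, inhabited (dual_basis M 'I_n).
Proof.
case/fgproj_dual=> n [x [f fP]]; exists n; constructor.
have fR i (v : M) (b : B) : f i (ract v b) = ((f i v : B) * b : B).
  exact: (linearZ_LR (f i) (b : B^c) (v : right_mod M)).
have rk (v : M) k : ract v (k%:A) = k *: v by rewrite ractZr ract1.
have fK i : linear (fun v : M => f i v : B).
  move=> k u v; rewrite -rk; transitivity ((f i (ract u k%:A) : B) + f i v).
    exact: (raddfD (f i)).
  by rewrite fR -scalerAr mulr1.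
exists x (fun i => mk_linear (fK i)) => [i v b|v]; rewrite ?mk_linearE //.
rewrite -[RHS](fP v); apply: eq_bigr => i _.
by rewrite mk_linearE.
Qed.

Lemma transfer_eq (K : comNzRingType) (A B : algType K) (X : finType)
    (rho rho' : matrep A B X) :
  (forall a x y, rho a x y = rho' a x y) -> transfer rho =1 transfer rho'.
Proof.
move=> E; apply: chain_ext => a s; rewrite !transfer_gen.
have {}E : rho =1 rho'.
  by move=> b; apply/funext => x; apply/funext => y; apply: E.
by rewrite (E a) (eq_map E).
Qed.

Lemma transfer_id (K : comNzRingType) (A : algType K) (rho : matrep A A unit) :
  (forall a x y, rho a x y = a) -> forall z, transfer rho z = z.
Proof.
move=> E; apply: (chain_ext (f := transfer rho) (g := idfun)) => a s.
rewrite transfer_gen /gtrace.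
have sumU (Z : zmodType) (F : unit -> Z) : \sum_x F x = F tt.
  by rewrite (bigD1 tt) //= big1 ?addr0 // => -[].
have H (Z : zmodType) (phi : seq A -> Z) :
    \sum_(m <- path_words tt tt (map rho s)) phi m = phi s.
  elim: s phi => [|b s IH] phi /=; first by rewrite path_words_nil.
  by rewrite path_words_cons sumU IH E.
by rewrite !sumU H E.
Qed.

Section TensorBasis.
Variables (K : comNzRingType) (A B C : algType K).
Variables (M : bimod A B) (N : bimod B C) (I J : finType).
Variables (d : dual_basis M I) (e : dual_basis N J).

Fact tens_db_bal i j : balanced (@ract _ _ _ M) (@lact _ _ _ N)
  (fun x y => db_coord e j (lact (db_coord d i x) y)).
Proof.
split=> *.
- by rewrite linearD lactDl linearD.
- by rewrite lactDr linearD.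
- by rewrite linearZ lactZl linearZ.
- by rewrite lactZr linearZ.
- by rewrite db_coordR lactM.
Qed.

Definition tens_db p : {linear tens_bimod M N -> C} :=
  tens_lin (tens_db_bal p.1 p.2).

Lemma tens_dbE p x y :
  tens_db p (tmk _ _ x y) = db_coord e p.2 (lact (db_coord d p.1 x) y).
Proof. exact: tens_linE. Qed.

Lemma tens_bimod_ind (P : tens_bimod M N -> Prop) :
  P 0 -> (forall x y, P (tmk _ _ x y)) -> (forall s t, P s -> P t -> P (s + t)) ->
  forall t, P t.
Proof. exact: tens_ind. Qed.

Definition tens_basis : dual_basis (tens_bimod M N) (I * J)%type.
Proof.
exists (fun p => tmk _ _ (db_vec d p.1) (db_vec e p.2)) tens_db.
- move=> p t c; elim/tens_bimod_ind: t => [|x y|s t IHs IHt].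
  + by rewrite ract_0 linear0 mul0r.
  + by rewrite [ract _ c]tens_ractE !tens_dbE lractA db_coordR.
  + rewrite ractDl !(linearD (tens_db p)).
    by rewrite mulrDl; apply: (congr2 +%R IHs IHt).
- move=> t; elim/tens_bimod_ind: t => [|x y|s t IHs IHt].
  + by apply: big1 => p _; rewrite linear0 ract0.
  + transitivity (\sum_i \sum_j tmk (@ract _ _ _ M) (@lact _ _ _ N) (db_vec d i)
      (ract (db_vec e j) (db_coord e j (lact (db_coord d i x) y)))).
      rewrite pair_bigA; apply: eq_bigr => -[i j] _ /=.
      by rewrite tens_dbE tens_ractE.
    under eq_bigr do rewrite -tmk_sumr db_sum -tmkA.
    by rewrite -tmk_suml db_sum.
  + rewrite -[in RHS]IHs -[in RHS]IHt -big_split; apply: eq_bigr => p _.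
    by rewrite linearD ractDr.
Defined.

Lemma transfer_tens x : transfer (db_rep tens_basis) x =
  transfer (db_rep e) (transfer (db_rep d) x).
Proof.
rewrite -transfer_comp; apply: transfer_eq => a p q /=.
transitivity (tens_db p (tmk _ _ (lact a (db_vec d q.1)) (db_vec e q.2))).
  by congr (tens_db p _); apply: tens_lactE.
by rewrite tens_dbE.
Qed.

End TensorBasis.

Definition unit_basis (K : comNzRingType) (A : algType K) :
  dual_basis (regular_bimod A) unit.
Proof.
exists (fun _ => 1 : A) (fun _ => idfun : {linear A -> A}) => // x.
by rewrite (bigD1 tt) //= big1 ?addr0 ?mul1r // => -[].
Defined.

Section SumBasis.
Variables (K : comNzRingType) (A : algType K) (X T : bimod A A) (Q : finType).
Variable d : dual_basis T Q.
Local Notation AX := (sum_bimod (regular_bimod A) X).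
Hypothesis iso : bimod_iso T AX.

(** The dual basis of T restricts to one of X, by projection. Together with the
    basis 1 of A it gives a dual basis of A ⊕ X in which the action is block
    diagonal; the transfers of T and of A ⊕ X agree on homology. *)
Lemma summand_basis : exists dX : dual_basis X Q, forall n x, cycles n x ->
  boundaries n (transfer (db_rep d) x - (x + transfer (db_rep dX) x)).
Proof.
have [h [[g hK gK] hl hr]] := iso.
have gP k y z : g (k *: y + z) = k *: g y + g z.
  by apply: (can_inj hK); rewrite linearP !gK.
have gr y b : g (ract y b) = ract (g y) b.
  by apply: (can_inj hK); rewrite hr !gK.
have fP q : linear (fun x : X => db_coord d q (g (0, x))).
  move=> k x y; rewrite -linearP -gP; congr (db_coord d q (g _)).
  by congr pair; rewrite /= scaler0 addr0.
have fR q x b : mk_linear (fP q) (ract x b) = mk_linear (fP q) x * b.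
  rewrite !mk_linearE -db_coordR -gr; congr (db_coord d q (g _)).
  by rewrite /= mul0r.
have fS x : \sum_q ract (h (db_vec d q)).2 (mk_linear (fP q) x) = x.
  rewrite -[RHS]/((0, x) : AX).2 -[in RHS](gK (0, x)) -[in RHS](db_sum d (g _)).
  rewrite linear_sum (big_morph (fun u : AX => u.2) (id1 := 0) (op1 := +%R)) //.
  by apply: eq_bigr => q _; rewrite hr mk_linearE.
move: (DualBasis fR fS : dual_basis X Q) => dX {fP fR fS gP gr}.
exists dX => n x Zx.
have f1P : linear (fun u : AX => u.1 : A) by [].
have f2P q : linear (fun u : AX => db_coord dX q u.2).
  by move=> k u v; rewrite -linearP.
pose sx (z : unit + Q) : AX :=
  match z with inl _ => (1, 0) | inr q => (0, db_vec dX q) end.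
pose sf (z : unit + Q) : {linear AX -> A} :=
  match z with inl _ => mk_linear f1P | inr q => mk_linear (f2P q) end.
have sR z u b : sf z (ract u b) = sf z u * b.
  by case: z => [t|q]; rewrite /sf !mk_linearE //; apply: (db_coordR dX).
have sS u : \sum_z ract (sx z) (sf z u) = u.
  rewrite big_sumType /= (bigD1 tt) //= big1 ?addr0 => [|[] //].
  rewrite [u in RHS]surjective_pairing.
  have -> : \sum_q ract ((0, db_vec dX q) : AX) (mk_linear (f2P q) u) = (0, u.2).
    rewrite -[in RHS](db_sum dX u.2).
    elim/big_rec2: _ => // q v w _ ->; rewrite mk_linearE.
    by congr pair; rewrite /= mul0r add0r.
  by rewrite mk_linearE; congr pair; rewrite /= ?mul1r ?ract_0 ?addr0 ?add0r.
pose dS : dual_basis AX (unit + Q)%type := DualBasis sR sS.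
have -> : x + transfer (db_rep dX) x = transfer (db_rep dS) x.
  have E : transfer (db_rep (unit_basis A)) x = x.
    by apply: transfer_id => a [] [] /=; rewrite mulr1.
  rewrite -[in X in X + _]E; apply/esym;
    apply: transfer_block => [a [] []|a q q'|a q t] /=.
  - by rewrite mk_linearE /= !mulr1.
  - by rewrite mk_linearE.
  - by rewrite mk_linearE /= lact_0 linear0.
exact: transfer_dual_basis.
Qed.

End SumBasis.

(** * Modules over the enveloping algebra as bimodules *)
Section RightAction.
Variables (K : comNzRingType) (S : algType K).

Section Act.
Variable U : lmodType S^c.

Definition rscale (u : restr U) (s : S) : restr U := (s : S^c) *: (u : U).

Lemma rscaleD u s t : rscale u (s + t) = rscale u s + rscale u t.
Proof. exact: (@scalerDl _ U (u : U) (s : S^c) (t : S^c)). Qed.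
Lemma rscale0 u : rscale u 0 = 0.
Proof. exact: (@scale0r _ U (u : U)). Qed.
Lemma rscaleDl u v s : rscale (u + v) s = rscale u s + rscale v s.
Proof. exact: (@scalerDr _ U (s : S^c) u v). Qed.
Lemma rscaleM u s t : rscale u (s * t) = rscale (rscale u s) t.
Proof. exact: esym (@scalerA _ U (t : S^c) (s : S^c) u). Qed.
Lemma rscale1 u : rscale u 1 = u.
Proof. exact: (@scale1r _ U (u : U)). Qed.
Lemma restr_scaleE k u : k *: u = rscale u (k *: 1).
Proof. by []. Qed.
Lemma rscaleZ k u s : rscale u (k *: s) = k *: rscale u s.
Proof. by rewrite restr_scaleE -rscaleM -scalerAr mulr1. Qed.
Lemma rscaleZl k u s : rscale (k *: u) s = k *: rscale u s.
Proof. by rewrite !restr_scaleE -!rscaleM -scalerAl -scalerAr mul1r mulr1. Qed.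

End Act.

Lemma rscale_map (U V : lmodType S^c) (f : {linear U -> V}) u s :
  f (rscale u s) = rscale (f u) s.
Proof. exact: linearZ. Qed.

Fact restr_map_linear (U V : lmodType S^c) (f : {linear U -> V}) :
  linear (f : restr U -> restr V).
Proof.
move=> k x y; rewrite [f _](raddfD f); congr (_ + _).
rewrite [in RHS]restr_scaleE; exact: (rscale_map f x (k *: 1)).
Qed.

Definition restr_map (U V : lmodType S^c) (f : {linear U -> V}) :
  {linear restr U -> restr V} := mk_linear (restr_map_linear f).

Lemma restr_mapE (U V : lmodType S^c) (f : {linear U -> V}) u :
  restr_map f u = f u.
Proof. exact: mk_linearE. Qed.

End RightAction.

(** What is used of the enveloping algebra: it is generated by commuting images
    of A^op and A. Its presentation as a tensor product stays out of sight. *)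
Record bimod_alg (K : comNzRingType) (A : algType K) := BimodAlg {
  ba_alg :> algType K;
  ba_left : A -> ba_alg;
  ba_right : A -> ba_alg;
  ba_leftP : linear ba_left;
  ba_rightP : linear ba_right;
  ba_left1 : ba_left 1 = 1;
  ba_right1 : ba_right 1 = 1;
  ba_leftM : forall a b, ba_left (a * b) = ba_left b * ba_left a;
  ba_rightM : forall a b, ba_right (a * b) = ba_right a * ba_right b;
  ba_comm : forall a b, ba_left a * ba_right b = ba_right b * ba_left a;
  ba_ind : forall Q : ba_alg -> Prop,
    Q 0 -> (forall a b, Q (ba_left a * ba_right b)) ->
    (forall s t, Q s -> Q t -> Q (s + t)) -> forall s, Q s }.

Section BimodOf.
Variables (K : comNzRingType) (A : algType K) (E : bimod_alg A).

Lemma ba_leftD (a b : A) : ba_left E (a + b) = ba_left E a + ba_left E b.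
Proof. by have := @ba_leftP _ _ E 1 a b; rewrite !scale1r. Qed.
Lemma ba_rightD (a b : A) : ba_right E (a + b) = ba_right E a + ba_right E b.
Proof. by have := @ba_rightP _ _ E 1 a b; rewrite !scale1r. Qed.
Lemma ba_leftZ k (a : A) : ba_left E (k *: a) = k *: ba_left E a.
Proof.
have := @ba_leftP _ _ E k a 0; have := @ba_leftP _ _ E (-1) 0 0.
by rewrite !scaleN1r !addNr => ->; rewrite !addr0.
Qed.
Lemma ba_rightZ k (a : A) : ba_right E (k *: a) = k *: ba_right E a.
Proof.
have := @ba_rightP _ _ E k a 0; have := @ba_rightP _ _ E (-1) 0 0.
by rewrite !scaleN1r !addNr => ->; rewrite !addr0.
Qed.

Definition bimod_of (U : lmodType E^c) : bimod A A.
Proof.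
exists (restr U : lmodType K) (fun a u => rscale u (ba_left E a))
  (fun u b => rscale u (ba_right E b)).
- by move=> a a' x; rewrite ba_leftD rscaleD.
- by move=> a x x'; rewrite rscaleDl.
- by move=> k a x; rewrite ba_leftZ rscaleZ.
- by move=> k a x; rewrite rscaleZl.
- by move=> x; rewrite ba_left1 rscale1.
- by move=> a a' x; rewrite ba_leftM rscaleM.
- by move=> x x' b; rewrite rscaleDl.
- by move=> x b b'; rewrite ba_rightD rscaleD.
- by move=> k x b; rewrite rscaleZl.
- by move=> k x b; rewrite ba_rightZ rscaleZ.
- by move=> x; rewrite ba_right1 rscale1.
- by move=> x b b'; rewrite ba_rightM rscaleM.
- by move=> a x b; rewrite -!rscaleM ba_comm.
Defined.

Lemma bimod_of_act (U : lmodType E^c) a b (u : bimod_of U) :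
  ract (lact a u) b = rscale (u : restr U) (ba_left E a * ba_right E b).
Proof. by rewrite [RHS]rscaleM. Qed.

Section Map.
Variables (U V : lmodType E^c) (f : {linear U -> V}).

Definition bimod_map : {linear bimod_of U -> bimod_of V} := restr_map f.

Lemma bimod_map_lact a x : bimod_map (lact a x) = lact a (bimod_map x).
Proof. by rewrite /bimod_map !restr_mapE; apply: rscale_map. Qed.

Lemma bimod_map_ract x a : bimod_map (ract x a) = ract (bimod_map x) a.
Proof. by rewrite /bimod_map !restr_mapE; apply: rscale_map. Qed.

Lemma bimod_map_pb_hom : @pb_hom _ _ (bimod_pb (bimod_of U))
  (bimod_pb (bimod_of V)) bimod_map.
Proof. by split=> *; [apply: bimod_map_lact | apply: bimod_map_ract]. Qed.

Lemma bimod_map_inj : injective f -> injective bimod_map.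
Proof. by move=> fI x y; rewrite /bimod_map !restr_mapE => /fI. Qed.

Lemma bimod_map_surj : (forall v, exists u, f u = v) ->
  forall v, exists u, bimod_map u = v.
Proof. by move=> fS v; have [u <-] := fS v; exists u; apply: restr_mapE. Qed.

End Map.

Lemma bimod_map_exact (U V W : lmodType E^c) (f : {linear U -> V})
    (g : {linear V -> W}) : exact_at f g ->
  forall v, bimod_map g v = 0 <-> exists u, bimod_map f u = v.
Proof.
move=> ex v; rewrite [bimod_map g v]restr_mapE; split=> [/ex[u fu]|[u fu]].
  by exists u; rewrite -fu; apply: restr_mapE.
by apply/ex; exists u; rewrite -fu; apply/esym/restr_mapE.
Qed.


(** The right module U is the bimodule M up to the bijection rin. Only
    the sum and the actions have to be preserved; K-linearity follows. *)
Record realizes (M : bimod A A) (U : lmodType E^c) := Realizes {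
  rin : M -> U;
  rout : U -> M;
  rinK : cancel rin rout;
  routK : cancel rout rin;
  rinD : forall x y, rin (x + y) = rin x + rin y;
  rin_act : forall a b x, rin (ract (lact a x) b) =
    (ba_left E a * ba_right E b : E^c) *: rin x }.

Section Realization.
Variables (M : bimod A A) (U : lmodType E^c) (rM : realizes M U).

Lemma rin_lact a x : rin rM (lact a x) =
  lact a (rin rM x : bimod_of U) :> bimod_of U.
Proof.
rewrite -[lact a x]ract1 rin_act; rewrite -[RHS]ract1; apply/esym.
exact: bimod_of_act.
Qed.

Lemma rin_ract x b : rin rM (ract x b) =
  ract (rin rM x : bimod_of U) b :> bimod_of U.
Proof.
rewrite -{1}[x]lact1 rin_act -[in RHS](lact1 (rin rM x : bimod_of U)).
by apply/esym; exact: bimod_of_act.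
Qed.

Fact rin_is_linear : linear (rin rM : M -> bimod_of U).
Proof.
have scaleE (V : bimod A A) k (x : V) : k *: x = lact (k *: 1) x.
  by rewrite lactZl lact1.
move=> k x y; rewrite rinD; congr (_ + _).
by rewrite scaleE rin_lact -scaleE.
Qed.

Definition rin_map : {linear M -> bimod_of U} := mk_linear rin_is_linear.
Lemma rin_mapE x : rin_map x = rin rM x. Proof. exact: mk_linearE. Qed.

Lemma rin_map_lact a x : rin_map (lact a x) = lact a (rin_map x).
Proof. by rewrite !rin_mapE rin_lact. Qed.
Lemma rin_map_ract x a : rin_map (ract x a) = ract (rin_map x) a.
Proof. by rewrite !rin_mapE rin_ract. Qed.

Fact rout_is_linear : linear (rout rM : bimod_of U -> M).
Proof.
move=> k x y; apply: (can_inj (rinK rM)).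
by rewrite routK -!rin_mapE linearP !rin_mapE !routK.
Qed.

Definition rout_map : {linear bimod_of U -> M} := mk_linear rout_is_linear.
Lemma rout_mapE x : rout_map x = rout rM x. Proof. exact: mk_linearE. Qed.

Lemma rin_mapK : cancel rin_map rout_map.
Proof. by move=> x; rewrite rout_mapE rin_mapE rinK. Qed.
Lemma rout_mapK : cancel rout_map rin_map.
Proof. by move=> x; rewrite rin_mapE rout_mapE routK. Qed.

Lemma rout_map_lact a x : rout_map (lact a x) = lact a (rout_map x).
Proof. by apply: (can_inj rin_mapK); rewrite rin_map_lact !rout_mapK. Qed.
Lemma rout_map_ract x a : rout_map (ract x a) = ract (rout_map x) a.
Proof. by apply: (can_inj rin_mapK); rewrite rin_map_ract !rout_mapK. Qed.

Lemma realizes_linear (P : lmodType E^c) (f : {linear M -> bimod_of P}) :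
  (forall a x, f (lact a x) = lact a (f x)) ->
  (forall x a, f (ract x a) = ract (f x) a) ->
  exists h : {linear U -> P}, forall x, h x = f (rout rM x).
Proof.
move=> fl fr; pose g : {linear bimod_of U -> bimod_of P} := f \o rout_map.
have gl a x : g (lact a x) = lact a (g x) by rewrite /g /= rout_map_lact fl.
have gr x a : g (ract x a) = ract (g x) a by rewrite /g /= rout_map_ract fr.
have g_act (x : restr U) (s : E) : g (rscale x s) = rscale (g x : restr P) s.
  elim/ba_ind: s => [|a b|s t IHs IHt].
  - by rewrite !rscale0 linear0.
  - by rewrite -bimod_of_act gr gl bimod_of_act.
  - by rewrite !rscaleD -IHs -IHt -linearD.
have hL : linear (g : U -> P).
  move=> s x y; transitivity (g (rscale x (s : E)) + g y : restr P).
    exact: (raddfD g).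
  by rewrite g_act.
by exists (mk_linear hL) => x; rewrite mk_linearE /g /= rout_mapE.
Qed.

End Realization.

End BimodOf.

Lemma free_projective (R : nzRingType) (X : choiceType) :
  projective ({malg R[X]} : lmodType R).
Proof.
move=> U V g f surj.
have [s sP] := choice (fun x : X => surj (f << 1 *g x >>)).
pose h : {linear {malg R[X]} -> U} := free_lift s.
have hU k : h << 1 *g k >> = s k := free_liftU s k.
exists h => x.
have -> : x = \sum_(k <- msupp x) x@_k *: << 1 *g k >>.
  rewrite [LHS]monalgE; apply: eq_bigr => k _.
  by apply/malgP => z; rewrite mcoeffZ !mcoeffU mulrnAr mulr1.
rewrite (linear_sum h) !linear_sum; apply: eq_bigr => k _.
by rewrite (linearZ_LR h) !linearZ_LR hU sP.
Qed.

Lemma acyclic_zero (K : comNzRingType) (A : algType K) (V : prebimod A) n :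
  (forall v : V, v = 0) -> acyclic V n.
Proof.
move=> V0 x _; suff -> : x = 0 by apply: boundaries0.
elim/chain_ind: x => [//|v s|x y -> ->]; last by rewrite addr0.
by rewrite (V0 v) pure0.
Qed.

Lemma kermod_exact (R : nzRingType) (U V : lmodType R) (f : {linear U -> V}) :
  exact_at (val : {linear kermod f -> U}) f.
Proof.
move=> v; split=> [/eqP fv|[u <-]]; last by apply/eqP; exact: (valP u).
by exists (KerMod (fv : v \in ker_pred f)).
Qed.

(** * Bimodules of finite projective dimension *)
Section ProjectiveDimension.
Variables (K : comNzRingType) (A : algType K) (E : bimod_alg A).
Hypothesis projA : projective (A : lmodType K).
Hypothesis realizable :
  forall M : bimod A A, exists U : lmodType E^c, inhabited (realizes M U).

(** The multiplication A ⊗_K P → P is a surjection of bimodules, so it splits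
    when P is projective, and P is a retract of an acyclic bimodule. *)
Lemma projective_acyclic (P : lmodType E^c) : projective P ->
  acyclic_from 1 (bimod_of P).
Proof.
move=> projP; pose IP := ind (bimod_of P).
have [U [rU]] := realizable IP.
have [mu muE] := realizes_linear rU
  (@ind_mul_lact _ _ (bimod_of P)) (@ind_mul_ract _ _ (bimod_of P)).
have surj (u : bimod_of P) : exists t, mu t = u.
  by exists (rin rU (itens IP 1 u)); rewrite muE rinK; exact: (ind_mul_sect u).
have [h hP] := projP _ _ mu idfun surj.
pose g : {linear bimod_of P -> IP} := rout_map rU \o bimod_map h.
have gl a x : g (lact a x) = lact a (g x).
  by rewrite /g /= bimod_map_lact rout_map_lact.
have gr x a : g (ract x a) = ract (g x) a.
  by rewrite /g /= bimod_map_ract rout_map_ract.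
have gK x : ind_mul (bimod_of P) (g x) = x.
  by rewrite /g /= rout_mapE -muE [bimod_map h x]restr_mapE hP.
move=> I rho k k_gt0.
apply: (acyclic_retract (power_map_pb_hom rho gl gr)
          (power_map_pb_hom rho (@ind_mul_lact _ _ _) (@ind_mul_ract _ _ _))).
  by move=> y; apply/ffunP => i; rewrite !ffunE gK.
exact: acyclic_ind.
Qed.

Lemma acyclic_from_step (P X : lmodType E^c) (e : {linear P -> X}) m :
  projective P -> (forall x, exists y, e y = x) ->
  acyclic_from m (bimod_of (kermod e)) -> acyclic_from m.+1 (bimod_of X).
Proof.
move=> projP surj aK I rho [//|k] mk.
pose io : {linear kermod e -> P} := val.
apply: (acyclic_quotient projA (io := power_map rho (bimod_map io))
  (pi := power_map rho (bimod_map e))).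
- by apply: power_map_pb_hom; [apply: bimod_map_lact | apply: bimod_map_ract].
- by apply: power_map_pb_hom; [apply: bimod_map_lact | apply: bimod_map_ract].
- by apply: power_map_inj; apply: bimod_map_inj; apply: val_inj.
- by apply: power_map_surj; apply: bimod_map_surj.
- by apply: power_map_exact; apply: bimod_map_exact; apply: kermod_exact.
- exact: (projective_acyclic projP).
- exact: aK.
Qed.

(** One syzygy at a time: the kernel of the augmentation is resolved by the
    shifted complex, which is shorter by one. *)
Lemma resolution_acyclic n (X : lmodType E^c) (P : nat -> lmodType E^c)
    (d : forall i, {linear P i.+1 -> P i}) (e : {linear P 0%N -> X}) :
  (forall i, projective (P i)) -> (forall x, exists y, e y = x) ->
  exact_at (d 0%N) e -> (forall i, exact_at (d i.+1) (d i)) ->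
  (forall i, (n <= i)%N -> forall x : P i, x = 0) ->
  acyclic_from n (bimod_of X).
Proof.
elim: n X P d e => [|n IH] X P d e projP surj ex0 ex P0.
  move=> I rho k _; apply: acyclic_zero => v; apply/ffunP => i; rewrite ffunE.
  have [y <-] := surj (v i); rewrite (P0 0%N _ y) //; exact: linear0.
apply: (acyclic_from_step (e := e)) => //.
have dk x : d 0%N x \in ker_pred e by apply/eqP/ex0; exists x.
have e'P : linear (fun x => KerMod (dk x)).
  by move=> k x y; apply: val_inj; rewrite [RHS]linearP; apply: linearP.
apply: (IH _ (fun i => P i.+1) (fun i => d i.+1) (mk_linear e'P)) => //.
- move=> x; have [y yx] : exists y, d 0%N y = val x.
    by apply/ex0/eqP; exact: (valP x).
  by exists y; rewrite mk_linearE; apply: val_inj.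
- move=> v; rewrite -[exists _, _](ex 0%N v) mk_linearE;
    split=> [/(congr1 val)//|dv].
  by apply: val_inj.
- by move=> i ni; apply: P0.
Qed.

Lemma finite_pd_acyclic (X : bimod A A) (U : lmodType E^c) (rU : realizes X U) :
  finite_pd U -> exists n, acyclic_from n.+1 X.
Proof.
case=> n [P [d [e [projP surj ex0 ex P0]]]]; exists n => I rho k nk.
apply: (acyclic_retract (power_map_pb_hom rho (rin_map_lact rU) (rin_map_ract rU))
          (power_map_pb_hom rho (rout_map_lact rU) (rout_map_ract rU))).
  by move=> y; apply/ffunP => i; rewrite !ffunE rin_mapK.
by apply: (resolution_acyclic projP surj ex0 ex P0).
Qed.

End ProjectiveDimension.

(** * Hochschild homology as Tor over the enveloping algebra *)
Lemma gen_submodP (R : nzRingType) (M : lmodType R) (P : M -> Prop) :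
  P 0 -> (forall k x y, P x -> P y -> P (k *: x + y)) ->
  forall x, x \in gen_submod P -> P x.
Proof.
move=> P0 PP x /asboolP H; pose S : {pred M} := fun z => `[< P z >].
apply/asboolP; apply: (H S) => [|y Py]; last exact/asboolP.
split=> [|k y z]; rewrite !unfold_in; first exact/asboolP.
by move=> /asboolP Py /asboolP Pz; apply/asboolP; apply: PP.
Qed.

Record lrealizes (K : comNzRingType) (A : algType K) (E : bimod_alg A)
  (N : lmodType E) :=
  LRealizes {
  lrin : A -> N;
  lrout : N -> A;
  lrinK : cancel lrin lrout;
  lroutK : cancel lrout lrin;
  lrinD : forall x y, lrin (x + y) = lrin x + lrin y;
  lrin_act : forall a b x, (ba_left E a * ba_right E b) *: lrin x =
    lrin (b * x * a) }.

Section TensorCommutators.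
Variables (K : comNzRingType) (A : algType K) (E : bimod_alg A) (N : lmodType E).
Variable rN : lrealizes N.

Let lroutD x y : lrout rN (x + y) = lrout rN x + lrout rN y.
Proof. by apply: (can_inj (lrinK rN)); rewrite lrinD !lroutK. Qed.

Let lrout_act a b (y : N) : lrout rN ((ba_left E a * ba_right E b) *: y) =
  b * lrout rN y * a.
Proof. by rewrite -[y in LHS](lroutK rN) lrin_act lrinK. Qed.

Let lroutZ (k : K) (y : restr N) : lrout rN (k *: y) = k *: lrout rN y.
Proof.
have -> : k *: y = (ba_left E (k *: 1) * ba_right E 1) *: (y : N).
  by rewrite ba_right1 mulr1 ba_leftZ ba_left1.
by rewrite lrout_act mul1r -scalerAr mulr1.
Qed.

Section Module.
Variable U : lmodType E^c.
Local Notation W := (bimod_of U).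
Local Notation chW := (chain A (bimod_pb W)).
Local Notation T := (tensR N U).

Definition tensR_mk (u : restr U) (y : restr N) : T := tmk _ _ u y.

Lemma tensR_mk_act u s y : tensR_mk (rscale u s) y =
  tensR_mk u ((s : E) *: (y : N)).
Proof. exact: tmkA. Qed.

(** As N is generated by 1, every element of U ⊗ N is of the form u ⊗ 1. The
    kernel of u ↦ u ⊗ 1 consists of the sums of commutators au - ua, which are
    the boundaries of degree 0. *)
Definition tens_one (u : restr U) : T := tensR_mk u (lrin rN 1).

Lemma tens_oneP k u v : tens_one (k *: u + v) = k *: tens_one u + tens_one v.
Proof. by rewrite /tens_one /tensR_mk tmkDl tmkZl. Qed.

Lemma tens_one_comm (u : W) a : tens_one (lact a u) = tens_one (ract u a).
Proof.
rewrite /tens_one !tensR_mk_act -[ba_left E a]mulr1 -(ba_right1 E)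
  -[ba_right E a]mul1r -(ba_left1 E) !lrin_act.
by rewrite !mulr1 !mul1r.
Qed.

Lemma tens_one_surj t : exists u, tens_one u = t.
Proof.
elim/tens_ind: t => [|u y|s t [u <-] [v <-]].
- by exists 0; have := tens_oneP (-1) 0 0; rewrite !scaleN1r !addNr.
- exists (rscale u (ba_right E (lrout rN y))); rewrite /tens_one tensR_mk_act.
  by rewrite -[ba_right E _]mul1r -(ba_left1 E) lrin_act !mulr1 lroutK.
- by exists (u + v); have := tens_oneP 1 u v; rewrite !scale1r.
Qed.

Let P (u : W) : Prop := boundaries 0 (pure u [::] : chW).

Let P0 : P 0. Proof. by rewrite /P pure0; apply: boundaries0. Qed.
Let PP k x y : P x -> P y -> P (k *: x + y).
Proof. by rewrite /P pureV; apply: boundariesP. Qed.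
Let P_comm (u : W) a : P (lact a u - ract u a).
Proof.
exists (- pure u [:: a]).
  by rewrite -scaleN1r; apply/homogZ/homog_pure.
rewrite linearN (bndE (homog_pure _ _)) !big_ord_recl big_ord0 /= addr0.
rewrite dface_first (dface_last _ (s := [::])) //= expr0 expr1 scale1r scaleN1r.
by rewrite opprB pureB.
Qed.

(* The inverse modulo boundaries: u ⊗ y is sent to the class of u y. *)
Let Psi_exists : {h : {linear T -> quotmod P} |
  forall u y, h (tensR_mk u y) = quot_proj P (ract (u : W) (lrout rN y))}.
Proof.
have bal : balanced (fun (x : restr U) (r : E) => (r : E^c) *: (x : U) : restr U)
    (fun (r : E) (y : restr N) => r *: (y : N) : restr N)
    (fun u y => quot_proj P (ract (u : W) (lrout rN y))).
  split=> [u u' y|u y y'|k u y|k u y|u s y].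
  - by rewrite ractDl linearD.
  - by rewrite lroutD ractDr linearD.
  - by rewrite ractZl linearZ.
  - by rewrite lroutZ ractZr linearZ.
  - rewrite -[_ *: (u : U)]/(rscale u s); elim/ba_ind: s => [|a b|s t IHs IHt].
    + rewrite rscale0 ract_0 scale0r.
      have -> : lrout rN 0 = 0 by have := lroutZ 0 0; rewrite !scale0r.
      by rewrite ract0.
    + rewrite lrout_act -bimod_of_act !ractM.
      apply: quot_proj_rel; rewrite -!lractA.
      exact: P_comm.
    + rewrite rscaleD ractDl linearD scalerDl lroutD ractDr linearD.
      exact: (congr2 +%R IHs IHt).
by exists (tens_lin bal) => u y; apply: tens_linE.
Qed.

Lemma tens_one_ker (u : W) : tens_one u = 0 <-> boundaries 0 (pure u [::] : chW).
Proof.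
split=> [thu|[y yd yu]].
  have := svalP Psi_exists u (lrin rN 1);
    rewrite -[tensR_mk _ _]/(tens_one u) thu linear0.
  rewrite lrinK ract1 => /esym; rewrite -(linear0 (quot_proj P)).
  by move/quot_projP; rewrite subr0; apply: gen_submodP.
(* A chain of degree 1 is a sum of u ⊗ a, with boundary ua - au. *)
pose f v (s : seq A) : T := if s is [::] then tens_one v else 0.
have fP : multilin f.
  split=> [[|a s] k v v'|v [|b s1] s2 k a a'];
    by rewrite /f /= ?tens_oneP ?scaler0 ?addr0.
have f0 z : homog 1 z -> chain_lift (V := bimod_pb W) fP (bnd z) = 0.
  elim/homog_ind: z / => [|v s|x z IHx IHz]; first by rewrite !linear0.
    case: s => [|a [|b s]] // _.
    rewrite (bndE (homog_pure _ _)) !big_ord_recl big_ord0 /= addr0.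
    rewrite dface_first (dface_last _ (s := [::])) //= expr0 expr1 scale1r scaleN1r.
    have fE (w : W) : chain_lift (V := bimod_pb W) fP (pure w [::]) = tens_one w :=
      chain_liftE fP w [::].
    by rewrite (linearB (chain_lift (V := bimod_pb W) fP)) !fE tens_one_comm subrr.
  by rewrite !linearD IHx IHz addr0.
by rewrite -(f0 y yd) yu chain_liftE.
Qed.

End Module.

Lemma tensR_map_mk (U V : lmodType E^c) (f : {linear U -> V}) u y :
  tensR_map (N := N) f (tensR_mk u y) = tensR_mk (f u : restr V) y.
Proof.
apply: tens_liftE; split=> *.
- by rewrite linearD tmkDl.
- by rewrite tmkDr.
- by rewrite -tmkZl /= linearZ.
- by rewrite tmkZr.
- by rewrite /= linearZ tmkA.
Qed.

Lemma tens_one_map (U V : lmodType E^c) (f : {linear U -> V}) u :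
  tensR_map (N := N) f (tens_one u) = tens_one (f u : restr V).
Proof. exact: tensR_map_mk. Qed.

(** Right exactness of the tensor product, read off the Hochschild complex: a
    chain of degree 1 that bounds the image of u lifts along f, and subtracting
    its boundary from u moves u into the kernel. *)
Section RightExact.
Variables (U V : lmodType E^c) (f : {linear U -> V}).
Hypothesis surj : forall v, exists u, f u = v.

Lemma tensR_map_surj t : exists s, tensR_map (N := N) f s = t.
Proof.
have [v <-] := tens_one_surj t; have [u <-] := surj v.
by exists (tens_one u); rewrite tens_one_map.
Qed.

Lemma tensR_map_ker t : tensR_map (N := N) f t = 0 ->
  exists s, tensR_map (N := N) (val : {linear kermod f -> U}) s = t.
Proof.
have [u <-] := tens_one_surj t; rewrite tens_one_map => /tens_one_ker[y yd yE].
have surj' := bimod_map_surj surj.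
have [z zd zy] := chain_map_surj_homog surj' yd.
pose w : chain A (bimod_pb (bimod_of U)) :=
  pure u [::] - bnd (V := bimod_pb (bimod_of U)) z.
have wd : homog 0 w by apply: homogB; [apply: homog_pure | apply: bnd_homog].
have [u' wE] : exists u' : bimod_of U, w = pure u' [::].
  elim/homog_ind: w / wd => [|v s /size0nil ->|x x' [v ->] [v' ->]].
  - by exists 0; rewrite pure0.
  - by exists v.
  - by exists (v + v'); rewrite pureD.
have fu' : f u' = 0.
  have : chain_map A (bimod_map f) w = 0.
    rewrite linearB (chain_map_bnd (bimod_map_pb_hom f)) zy yE chain_mapE.
    by rewrite [bimod_map f u]restr_mapE subrr.
  pose g v (s : seq A) : bimod_of V := if s is [::] then v else 0.
  have gP : multilin g.
    split=> [[|a s] k v v'|v [|b s1] s2 k a a'];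
      by rewrite /g /= ?scaler0 ?addr0.
  rewrite wE chain_mapE => /(congr1 (chain_lift gP)).
  by rewrite chain_liftE linear0 /g [bimod_map f u']restr_mapE.
have ku : u' \in ker_pred f by apply/eqP.
exists (tens_one (KerMod ku : restr (kermod f))); rewrite tens_one_map /=.
apply/eqP; rewrite -subr_eq0; apply/eqP.
have -> : tens_one u' - tens_one u = tens_one (u' - u : restr U).
  by have := tens_oneP (-1) u u'; rewrite !scaleN1r ![- _ + _]addrC => ->.
apply/tens_one_ker; exists (- z); first by rewrite -scaleN1r; apply: homogZ.
rewrite pureB -wE /w linearN.
by rewrite addrAC subrr add0r.
Qed.

End RightExact.

Section TorHochschild.
Hypothesis projA : projective (A : lmodType K).
Hypothesis realizable :
  forall M : bimod A A, exists U : lmodType E^c, inhabited (realizes M U).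
Variable M : lmodType E^c.

Local Notation S := (syzygy M).
Local Notation F := (std_res M).
Local Notation io m := (val : {linear kermod (free_cover (S m)) -> F m}).

Local Notation Zn U n := (@cycles K A (bimod_pb (bimod_of U)) n).
Local Notation Bn U n := (@boundaries K A (bimod_pb (bimod_of U)) n).

Lemma free_cover_surj (V : lmodType E^c) v : exists x, free_cover V x = v.
Proof. by exists << 1 *g v >>; rewrite [LHS]free_liftU. Qed.

Lemma tor_diffE m t : tor_diff M N m t =
  tensR_map (io m) (tensR_map (free_cover (S m.+1)) t).
Proof.
have [u <-] := tens_one_surj t.
by rewrite [LHS]tens_one_map !tens_one_map.
Qed.

(** Tor_{m+1} as the kernel of the map from S_{m+1} ⊗ N to F_m ⊗ N, where
    F_m is the free cover of the m-th syzygy S_m. A Tor cycle t is related to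
    the chains u of degree 0 such that t maps to u ⊗ 1. *)
Lemma tor_syzygy m : subquot_iso
  (fun t => tor_diff M N m t = 0) (fun t => exists y, tor_diff M N m.+1 y = t)
  (fun w : chain A (bimod_pb (bimod_of (S m.+1))) =>
     Zn (S m.+1) 0 w /\ Bn (F m) 0 (chain_map A (bimod_map (io m)) w))
  (Bn (S m.+1) 0).
Proof.
pose c : {linear tensR N (F m.+1) -> tensR N (S m.+1)} :=
  tensR_map (N := N) (free_cover (S m.+1)).
have ker0 (u : S m.+1) : tensR_map (io m) (tens_one (u : restr (S m.+1))) = 0 <->
    Bn (F m) 0 (chain_map A (bimod_map (io m)) (pure (u : bimod_of (S m.+1)) [::])).
  by rewrite tens_one_map tens_one_ker chain_mapE [bimod_map _ _]restr_mapE.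
exists (fun t (w : chain A (bimod_pb (bimod_of (S m.+1)))) =>
  tor_diff M N m t = 0 /\ exists u : restr (S m.+1),
    w = pure (u : bimod_of (S m.+1)) [::] /\ c t = tens_one u); split.
- move=> k t t' w w' [t0 [u [-> cu]]] [t0' [u' [-> cu']]]; split.
    by rewrite linearP t0 t0' scaler0 addr0.
  by exists (k *: u + u'); rewrite pureV linearP cu cu' tens_oneP.
- move=> t w [t0 [u [-> cu]]]; split=> //; split.
    by split; [apply: homog_pure | apply/bnd_homog0/homog_pure].
  by apply/ker0; rewrite -cu -tor_diffE.
- move=> t t0; have [u cu] := tens_one_surj (c t).
  by exists (pure (u : bimod_of (S m.+1)) [::]); split=> //; exists u.
- move=> w [[wd _] Bw].
  have [u wE] : exists u : bimod_of (S m.+1), w = pure u [::].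
    elim/homog_ind: w / wd {Bw} => [|v s /size0nil ->|x x' [v ->] [v' ->]].
    - by exists 0; rewrite pure0.
    - by exists v.
    - by exists (v + v'); rewrite pureD.
  have [t ct] := tensR_map_surj (@free_cover_surj (S m.+1))
    (tens_one (u : restr (S m.+1))).
  exists t; split; last by exists u.
  by rewrite tor_diffE ct; apply/ker0; rewrite -wE.
- move=> t w [t0 [u [-> cu]]]; rewrite -tens_one_ker -cu;
    split=> [[y <-]|/tensR_map_ker].
    rewrite tor_diffE /c.
    have [v <-] := tens_one_surj (tensR_map (free_cover (S m.+2)) y).
    rewrite tens_one_map; have cv : free_cover (S m.+1) (io m.+1 v) = 0.
      by apply/eqP; exact: (valP v).
    rewrite [LHS](tens_one_map (free_cover (S m.+1)) (io m.+1 v)).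
    transitivity (tens_one (0 : restr (S m.+1)));
      first exact: (congr1 (@tens_one (S m.+1)) cv).
    by have := tens_oneP (-1) (0 : restr (S m.+1)) 0; rewrite !scaleN1r !addNr.
  case=> [|s st]; first exact: free_cover_surj.
  have [y yE] := tensR_map_surj (@free_cover_surj (S m.+2)) s.
  by exists y; rewrite tor_diffE yE.
Qed.

Lemma std_res_acyclic m k : (0 < k)%N -> acyclic (bimod_pb (bimod_of (F m))) k.
Proof.
move=> k_gt0; apply: acyclic_from_pb k_gt0.
by apply: (projective_acyclic realizable); apply: free_projective.
Qed.

(** The shift [shift_iso] into degree 0 describes H_1 of S_m by the same kernel
    as [tor_syzygy]. *)
Lemma syzygy_shift m :
  subquot_iso (Zn (S m) 1) (Bn (S m) 1)
  (fun w : chain A (bimod_pb (bimod_of (S m.+1))) =>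
     Zn (S m.+1) 0 w /\ Bn (F m) 0 (chain_map A (bimod_map (io m)) w))
  (Bn (S m.+1) 0).
Proof.
apply: (@shift_iso K A projA (bimod_pb (bimod_of (S m.+1)))
  (bimod_pb (bimod_of (F m)))
  (bimod_pb (bimod_of (S m))) (bimod_map (io m)) (bimod_map (free_cover (S m)))).
- exact: bimod_map_pb_hom.
- exact: bimod_map_pb_hom.
- by apply: bimod_map_inj; apply: val_inj.
- by apply: bimod_map_surj; apply: free_cover_surj.
- by apply: bimod_map_exact; apply: kermod_exact.
- exact: std_res_acyclic.
Qed.

Lemma syzygy_shift_pos m n : (0 < n)%N ->
  subquot_iso (Zn (S m) n.+1) (Bn (S m) n.+1)
  (Zn (S m.+1) n) (Bn (S m.+1) n).
Proof.
move=> n0.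
apply: (@shift_iso_pos K A projA (bimod_pb (bimod_of (S m.+1)))
  (bimod_pb (bimod_of (F m)))
  (bimod_pb (bimod_of (S m))) (bimod_map (io m)) (bimod_map (free_cover (S m)))).
- exact: bimod_map_pb_hom.
- exact: bimod_map_pb_hom.
- by apply: bimod_map_inj; apply: val_inj.
- by apply: bimod_map_surj; apply: free_cover_surj.
- by apply: bimod_map_exact; apply: kermod_exact.
- exact: std_res_acyclic.
- exact: std_res_acyclic.
Qed.

(** Tor_{m+1}(M) ≅ H_1(S_m) ≅ H_2(S_{m-1}) ≅ ... ≅ H_{m+1}(M). *)
Theorem tor_hochschild m : subquot_iso
  (fun t => tor_diff M N m t = 0) (fun t => exists y, tor_diff M N m.+1 y = t)
  (Zn M m.+1) (Bn M m.+1).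
Proof.
apply: (subquot_iso_trans (tor_syzygy m));
  apply: (subquot_iso_trans (subquot_iso_sym (syzygy_shift m))).
suff H j n : (0 < n)%N ->
  subquot_iso (Zn (S j) n) (Bn (S j) n) (Zn M (n + j)) (Bn M (n + j)).
  by have := H m 1 isT; rewrite add1n.
elim: j n => [|j IH] n n0.
  by rewrite addn0; apply: (@prebimod_iso_homology _ _ _ _ idfun idfun).
apply: subquot_iso_trans (subquot_iso_sym (syzygy_shift_pos j n0)) _.
by rewrite addnS -addSn; apply: IH.
Qed.

End TorHochschild.

Lemma tor_regular (U : lmodType E^c) m :
  projective (A : lmodType K) ->
  (forall M : bimod A A, exists U : lmodType E^c, inhabited (realizes M U)) ->
  realizes (regular_bimod A) U -> subquot_iso
  (fun t => tor_diff U N m t = 0) (fun t => exists y, tor_diff U N m.+1 y = t)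
  (@cycles K A (regular_pb A) m.+1) (@boundaries K A (regular_pb A) m.+1).
Proof.
move=> projA realizable rU.
apply: subquot_iso_trans (tor_hochschild projA realizable U m) _.
apply: (@prebimod_iso_homology _ _ (bimod_pb (bimod_of U)) (regular_pb A)
  (rout_map rU) (rin_map rU)).
- by split=> *; [apply: rout_map_lact | apply: rout_map_ract].
- by split=> *; [apply: rin_map_lact | apply: rin_map_ract].
- exact: rout_mapK.
- exact: rin_mapK.
Qed.

End TensorCommutators.

(** * The theorem *)
Lemma transfer_homology_iso (K : comNzRingType) (A B : algType K) (I J : finType)
    (rho : matrep A B I) (rho' : matrep B A J) n :
  (forall z, cycles n z -> boundaries n (transfer rho' (transfer rho z) - z)) ->
  (forall z, cycles n z -> boundaries n (transfer rho (transfer rho' z) - z)) ->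
  subquot_iso (@cycles K A (regular_pb A) n) (@boundaries K A (regular_pb A) n)
        (@cycles K B (regular_pb B) n) (@boundaries K B (regular_pb B) n).
Proof.
move=> AA BB.
have BcN C (V : prebimod C) (x : chain C V) : boundaries n x -> boundaries n (- x).
  by move=> Bx; rewrite -sub0r; apply: boundariesB => //; apply: boundaries0.
exists (fun z w => [/\ cycles n z, cycles n w & boundaries n (w - transfer rho z)]);
  split.
- move=> k z z' w w' [Zz Zw Bzw] [Zz' Zw' Bzw'].
  split; [exact: cyclesP | exact: cyclesP |].
  by rewrite linearP opprD addrACA -scalerBr; apply: boundariesP.
- by move=> z w [].
- move=> z Zz; exists (transfer rho z); split=> //; first exact: trace_map_cycles.
  by rewrite subrr; apply: boundaries0.
- move=> w Zw; exists (transfer rho' w); split=> //; first exact: trace_map_cycles.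
  by rewrite -opprB; apply: BcN; apply: BB.
- move=> z w [Zz Zw Bzw]; split=> [Bz|Bw].
    rewrite -[w](subrK (transfer rho z)); apply: boundariesD => //.
    exact: trace_map_boundaries.
  rewrite -[z](subrK (transfer rho' (transfer rho z))); apply: boundariesD.
    by rewrite -opprB; apply: BcN; apply: AA.
  apply: trace_map_boundaries; rewrite -[transfer rho z](subKr w).
  exact: boundariesB.
Qed.

Section RoundTrip.
Variables (K : comNzRingType) (A B : algType K).
Variables (M : bimod A B) (N : bimod B A) (X : bimod A A) (I J : finType).
Variables (d : dual_basis M I) (e : dual_basis N J).
Hypothesis iso : bimod_iso (tens_bimod M N) (sum_bimod (regular_bimod A) X).

Lemma transfer_roundtrip n :
  (forall (Q : finType) (dX : dual_basis X Q) z, cycles n z ->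
     boundaries n (transfer (db_rep dX) z)) ->
  forall z, cycles n z ->
    boundaries n (transfer (db_rep e) (transfer (db_rep d) z) - z).
Proof.
move=> vX z Zz; have [dX H] := summand_basis (tens_basis d e) iso.
have := boundariesD (H n z Zz) (vX _ dX z Zz).
by rewrite transfer_tens opprD addrA subrK.
Qed.

End RoundTrip.

Section Enveloping.
Variables (K : comNzRingType) (A : algType K).

Definition env_bimod_alg : bimod_alg A.
Proof.
refine (@BimodAlg K A (env A) (fun a => ev a 1) (fun b => ev 1 b) _ _ _ _ _ _ _ _).
- by move=> k a b; rewrite /ev /ta tmkDl tmkZl.
- by move=> k a b; rewrite /ev /ta tmkDr tmkZr.
- by [].
- by [].
- by move=> a b; rewrite env_mulE mul1r.
- by move=> a b; rewrite env_mulE mul1r.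
- by move=> a b; rewrite !env_mulE !mul1r !mulr1.
- move=> Q Q0 Qev QD; apply: env_ind => // a b.
  by have := Qev a b; rewrite env_mulE !mul1r.
Defined.

Definition renv_realizes (M : bimod A A) :
  @realizes K A env_bimod_alg M (renv_mod M).
Proof.
refine (@Realizes K A env_bimod_alg M (renv_mod M) id id _ _ _ _) => //.
move=> a b x; apply/esym; rewrite -renv_actE.
by rewrite [ev a b](_ : _ = ev a 1 * ev 1 b) // env_mulE !mul1r.
Defined.

Definition lenv_realizes :
  @lrealizes K A env_bimod_alg (lenv_mod (regular_bimod A)).
Proof.
refine (@LRealizes K A env_bimod_alg (lenv_mod (regular_bimod A)) id id _ _ _ _)
  => //.
move=> a b x; rewrite -mulrA -[RHS](lenv_actE a b (x : regular_bimod A)).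
by rewrite [ev a b](_ : _ = ev a 1 * ev 1 b) // env_mulE !mul1r.
Defined.

Hypothesis projA : projective (A : lmodType K).

Lemma env_realizable (M : bimod A A) :
  exists U : lmodType env_bimod_alg^c, inhabited (realizes M U).
Proof. by exists (renv_mod M); constructor; apply: renv_realizes. Qed.

Lemma HH_chain_iso m : subquot_iso
  (fun t => tor_diff (R := env A) (renv_mod (regular_bimod A))
    (lenv_mod (regular_bimod A)) m t = 0)
  (fun t => exists y, tor_diff (R := env A) (renv_mod (regular_bimod A))
    (lenv_mod (regular_bimod A)) m.+1 y = t)
  (@cycles K A (regular_pb A) m.+1) (@boundaries K A (regular_pb A) m.+1).
Proof.
exact: (tor_regular lenv_realizes m projA env_realizable (renv_realizes _)).
Qed.

Lemma finite_pd_env_acyclic (X : bimod A A) : P_fin_env X ->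
  exists n, acyclic_from n.+1 X.
Proof.
case=> _; exact: (finite_pd_acyclic projA env_realizable (renv_realizes X)).
Qed.

End Enveloping.

Lemma HH_iso (K : comNzRingType) (A B : algType K) m :
  projective (A : lmodType K) -> projective (B : lmodType K) ->
  subquot_iso (@cycles K A (regular_pb A) m.+1)
    (@boundaries K A (regular_pb A) m.+1)
        (@cycles K B (regular_pb B) m.+1) (@boundaries K B (regular_pb B) m.+1) ->
  lmod_iso (HH A m.+1) (HH B m.+1).
Proof.
move=> projA projB AB; apply: subquot_iso_lmod.
apply: subquot_iso_trans (HH_chain_iso projA m) _.
apply: subquot_iso_trans AB _; apply: subquot_iso_sym; exact: HH_chain_iso.
Qed.

Theorem theorem4p1 (K : comNzRingType) (A B : algType K)
    (noethK : noetherian_ring K)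
    (noethA : noetherian_ring A) (noethB : noetherian_ring B)
    (projA : projective (A : lmodType K)) (projB : projective (B : lmodType K))
    (M : bimod A B) (N : bimod B A)
    (MN_sing : singular_equiv_Morita M N) :
  (exists n0 : nat, forall n : nat, (n0 < n)%N -> lmod_iso (HH A n) (HH B n)) /\
  (is_field K -> fin_gen (A : lmodType K) -> fin_gen (B : lmodType K) ->
   forall n : nat, (0 < n)%N -> lmod_iso (HH A n) (HH B n)).
Proof.
have [[_ fgM] [_ fgN] [X pdX isoX] [Y pdY isoY]] := MN_sing.
have [I [d]] := right_dual_basis fgM; have [J [e]] := right_dual_basis fgN.
have [p aX] := finite_pd_env_acyclic projA pdX.
have [q aY] := finite_pd_env_acyclic projB pdY.
split.
  (* X and Y have acyclic powers in degrees above p and q respectively. *)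
  exists (maxn p q) => -[//|m]; rewrite gtn_max => /andP[pm qm].
  apply: HH_iso => //.
  apply: (transfer_homology_iso (rho := db_rep d) (rho' := db_rep e)).
  - by apply: (transfer_roundtrip d e isoX) => Q dX; apply: transfer_factor;
      apply: aX.
  - by apply: (transfer_roundtrip e d isoY) => Q dY; apply: transfer_factor;
      apply: aY.
move=> _ fgA fgB [//|m] _; apply: HH_iso => //.
have [k [a [f af]]] := fgproj_dual (conj fgA projA).
have [l [b [g bg]]] := fgproj_dual (conj fgB projB).
apply: (transfer_homology_iso (rho := db_rep d) (rho' := db_rep e)).
- apply: (transfer_roundtrip d e isoX) => Q dX z.
  exact: (transfer_vanish af projA dX aX).
- apply: (transfer_roundtrip e d isoY) => Q dY z.
  exact: (transfer_vanish bg projB dY aY).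
Qed.
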